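(* Let $a,b\ge1$. Each additive standard tableau $T$ of rectangular shape $a\times b$ defines a regular face $f_T=\{(a_T(\lambda),b_T(\lambda),\lambda)\}$ (where $\lambda$ runs over the real sequences $\lambda_1\ge\cdots\ge\lambda_{ab}\ge0$) of the Kronecker polyhedron $PKron_{a,b,ab}$, of minimal dimension among its regular faces.
   Context: Kronecker coefficients: $g(\lambda,\mu,\nu)=\dim([\lambda]\otimes[\mu]\otimes[\nu])^{S_n}$ for partitions of $n$, with $[\lambda]$ the irreducible complex $S_n$-representation indexed by $\lambda$; $g=0$ if the sizes differ. $Kron_{a,b,c}$ is the set of triples of partitions $(\beta,\gamma,\alpha)$ with $\ell(\beta)\le a$, $\ell(\gamma)\le b$, $\ell(\alpha)\le c$ and $g(\beta,\gamma,\alpha)\ne0$, and the Kronecker polyhedron $PKron_{a,b,c}\subset\mathbb{R}^{a+b+c}$ is the (rational polyhedral) cone generated by it. A standard tableau $T$ of shape $a\times b$ is a bijective filling of the boxes $(i,j)$, $1\le i\le a$, $1\le j\le b$, by $1,\dots,ab$, with entries $T(i,j)$ increasing along rows and columns. It is additive if there exist sequences $x_1<\cdots<x_a$ and $y_1<\cdots<y_b$ such that $T(i,j)<T(k,l)\Leftrightarrow x_i+y_j<x_k+y_l$. One puts $a_T(\lambda)_i=\sum_{j=1}^b\lambda_{T(i,j)}$ and $b_T(\lambda)_j=\sum_{i=1}^a\lambda_{T(i,j)}$. A face is regular if it meets the interior of the Weyl chamber, i.e. contains a triple of strictly decreasing sequences.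
   Formalization: A regular face is required to contain a triple of strictly decreasing sequences with all entries positive; if a last entry 0 were allowed, the face of f_T where λ_ab = 0 would be regular of dimension ab−1 and minimality would fail. *)

(* Defs.v *)
From HB Require Import structures.
From mathcomp Require Import all_boot all_order all_algebra all_fingroup.
From mathcomp Require Import all_solvable all_field all_character.
From mathcomp Require Import all_classical all_reals.

Set Implicit Arguments.
Unset Strict Implicit.
Unset Printing Implicit Defensive.

Import Order.TTheory GRing.Theory Num.Theory.

Local Open Scope ring_scope.
Local Open Scope classical_set_scope.

Definition is_partition (l : seq nat) : bool :=
  sorted geq l && (0%N \notin l).

(* The boxes of the diagram of [l] are numbered row by row by 'I_n, where
   n = sumn l: the k-th box lies in row [reshape_index l k] and column
   [reshape_offset l k]. *)
Definition row_stab (n : nat) (l : seq nat) : {set 'S_n} :=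
  [set s : 'S_n | [forall k : 'I_n, reshape_index l (s k) == reshape_index l k]]%SET.

Definition col_stab (n : nat) (l : seq nat) : {set 'S_n} :=
  [set s : 'S_n | [forall k : 'I_n, reshape_offset l (s k) == reshape_offset l k]]%SET.

(* The Young symmetrizer, as an element of the group algebra of 'S_n, written in
   the standard basis of its regular representation. *)
Definition young_symmetrizer (n : nat) (l : seq nat) : 'rV[algC]_#|[set: 'S_n]%G| :=
  gring_row (\sum_(p in row_stab n l) \sum_(q in col_stab n l)
    (-1) ^+ odd_perm q *: regular_repr algC [set: 'S_n]%G (p * q)%g).

(* The irreducible representation [l] of 'S_n: the right ideal of the group algebra
   generated by the Young symmetrizer. MathComp representations act on row
   vectors from the right, hence a right ideal; the left ideal gives the
   contragredient representation, which is isomorphic to it. *)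
Definition specht (n : nat) (l : seq nat) :=
  submod_repr
    (cyclic_mx_module (regular_repr algC [set: 'S_n]%G) (young_symmetrizer n l)).

Definition kronecker (l m k : seq nat) : nat :=
  let n := sumn l in
  if (sumn m == n) && (sumn k == n) then
    \rank (rfix_mx (prod_repr (prod_repr (specht n l) (specht n m)) (specht n k))
                   [set: 'S_n]%SET)
  else 0%N.

Definition Kron (a b c : nat) : set (seq nat * seq nat * seq nat) :=
  [set t | let: (l, m, k) := t in
    [/\ is_partition l, is_partition m & is_partition k] /\
    [/\ (size l <= a)%N, (size m <= b)%N, (size k <= c)%N & kronecker l m k != 0%N]].

Section Polyhedron.

Variable R : realType.

Definition part_vec (n : nat) (l : seq nat) : 'rV[R]_n :=
  \row_(i < n) (nth 0%N l i)%:R.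

Definition triple (a b c : nat) (u : 'rV[R]_a) (v : 'rV[R]_b) (w : 'rV[R]_c) :
  'rV[R]_(a + b + c) := row_mx (row_mx u v) w.

Definition cone_hull (N : nat) (S : set 'rV[R]_N) : set 'rV[R]_N :=
  [set v | exists (n : nat) (s : 'I_n -> 'rV[R]_N) (t : 'I_n -> R),
    [/\ forall i, S (s i), forall i, 0 <= t i & v = \sum_(i < n) t i *: s i]].

Definition PKron (a b c : nat) : set 'rV[R]_(a + b + c) :=
  cone_hull [set v | exists l m k : seq nat,
    Kron a b c (l, m, k) /\ v = triple (part_vec a l) (part_vec b m) (part_vec c k)].

(* The nonempty faces of a polyhedral cone are its intersections with the kernels
   of the linear forms that are nonnegative on it; [u] is the coefficient vector
   of the form, and u = 0 gives the improper face. *)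
Definition is_face (N : nat) (C F : set 'rV[R]_N) : Prop :=
  exists u : 'cV[R]_N,
    (forall v, C v -> 0 <= (v *m u) 0 0) /\
    F = [set v | C v /\ (v *m u) 0 0 = 0].

(* The dimension of the linear span, i.e. the largest number of linearly
   independent vectors; faces of a cone contain 0, so this is their dimension. *)
Definition face_dim (N : nat) (F : set 'rV[R]_N) : nat :=
  (\max_(d < N.+1 |
    `[< exists M : 'M[R]_(d, N), (forall i, F (row i M)) /\ row_free M >]) d)%N.

Definition dominant (n : nat) (l : 'rV[R]_n) : Prop :=
  (forall i j : 'I_n, (i < j)%N -> l 0 j <= l 0 i) /\ (forall i, 0 <= l 0 i).

(* The interior of the chamber [dominant]. Positivity is part of it: sequences
   l_1 > ... > l_n = 0 lie on the boundary. *)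
Definition strictly_dominant (n : nat) (l : 'rV[R]_n) : Prop :=
  (forall i j : 'I_n, (i < j)%N -> l 0 j < l 0 i) /\ (forall i, 0 < l 0 i).

Definition regular (a b c : nat) (F : set 'rV[R]_(a + b + c)) : Prop :=
  exists (u : 'rV[R]_a) (v : 'rV[R]_b) (w : 'rV[R]_c),
    F (triple u v w) /\
    [/\ strictly_dominant u, strictly_dominant v & strictly_dominant w].

(* Rows, columns and entries are numbered from 0. *)
Definition standard_tableau (a b : nat) (T : 'I_a -> 'I_b -> 'I_(a * b)) : Prop :=
  [/\ bijective (fun p : 'I_a * 'I_b => T p.1 p.2),
      forall (i k : 'I_a) (j : 'I_b), (i < k)%N -> (T i j < T k j)%N &
      forall (i : 'I_a) (j l : 'I_b), (j < l)%N -> (T i j < T i l)%N].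

Definition additive_tableau (a b : nat) (T : 'I_a -> 'I_b -> 'I_(a * b)) : Prop :=
  exists (x : 'I_a -> R) (y : 'I_b -> R),
    [/\ forall i k : 'I_a, (i < k)%N -> x i < x k,
        forall j l : 'I_b, (j < l)%N -> y j < y l &
        forall (i k : 'I_a) (j l : 'I_b),
          (T i j < T k l)%N <-> x i + y j < x k + y l].

Definition row_sums (a b : nat) (T : 'I_a -> 'I_b -> 'I_(a * b))
    (l : 'rV[R]_(a * b)) : 'rV[R]_a :=
  \row_(i < a) \sum_(j < b) l 0 (T i j).

Definition col_sums (a b : nat) (T : 'I_a -> 'I_b -> 'I_(a * b))
    (l : 'rV[R]_(a * b)) : 'rV[R]_b :=
  \row_(j < b) \sum_(i < a) l 0 (T i j).

Definition tableau_face (a b : nat) (T : 'I_a -> 'I_b -> 'I_(a * b)) :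
  set 'rV[R]_(a + b + a * b) :=
  [set v | exists l : 'rV[R]_(a * b),
    dominant l /\ v = triple (row_sums T l) (col_sums T l) l].

End Polyhedron.

Arguments PKron R a b c _ : clear implicits.
Arguments tableau_face R {a b} T _.

(* Main.v *)
Require Import Defs.
From mathcomp Require Import all_classical all_reals.
From mathcomp Require Import all_boot all_order all_algebra.
From mathcomp Require Import all_fingroup all_solvable all_field all_character.
From mathcomp Require Import -(notations) mpoly.
From mathcomp Require Import ring lra zify.

(** Put [c = a * b] and let [gl_a], [gl_b], [gl_c] act by derivations on the polynomials in
    the variables [X_ijt], [i < a], [j < b], [t < c]: the matrix unit [E_kl] of [gl_a] sends
    [X_ljt] to [X_kjt] and kills the variables with another first index, and so on.  By
    Schur-Weyl duality [g(beta, gamma, alpha)] is the dimension of the space of highest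
    weight polynomials of weight [(beta, gamma, alpha)], those killed by the [E_kl] with
    [k < l] in the three algebras.  Its part that enters here is that [g <> 0] if and only if
    such a polynomial [f <> 0] exists ([kronecker_hw], [hw_kronecker]).  Highest weight
    polynomials multiply, so they can be combined along a face.

    On the side of the symmetric group, [kroneckerP] turns [g <> 0] into the nonvanishing of
    the sum over the group of a product of three translates of polytabloids, the
    coefficient functions of Young symmetrizers.  Polytabloids satisfy the highest weight
    equations ([polytabloid_raise]), which gives [f] from [g <> 0].  For the converse, the
    coefficients of the full polarization of [f] form a highest weight function on the
    symmetric group in each of the three arguments, and the point is that a nonzero highest
    weight function pairs nontrivially with some translate of the polytabloid
    ([highest_weight_pairing]).  The proof compares the eigenvalues of the sum of all
    transpositions on both sides of the group, as a Casimir element is used.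

    The tableau gives a face.  Let [x_i + y_j] order the boxes as [T] does and put
    [z_(T(i,j)) = x_i + y_j].  The form is
    [sum_i x_i beta_i + sum_j y_j gamma_j - sum_t z_t alpha_t].  If [g <> 0], the boxes of
    the diagram of [alpha] can be marked by pairs [(i, j)], with [i] used [beta_i] times and
    [j] used [gamma_j] times, no pair occurring twice in a column ([kronecker_words]).  The
    values of [T] at the pairs of a column of height [h] are distinct, so that column
    contributes at least [z_0 + ... + z_(h-1)], its contribution to [sum_t z_t alpha_t].
    Hence the form is nonnegative, and it vanishes only if each [T^-1(t)] is used [alpha_t]
    times, so that [beta = a_T(alpha)] and [gamma = b_T(alpha)] ([kron_form]).
    Conversely a dominant [lambda] is a nonnegative combination of the vectors
    [(1, ..., 1, 0, ..., 0)] with [k] ones, and for such a vector a highest weight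
    polynomial is the minor with the rows [(i, j)], [T(i,j) < k], and the columns [t < k]:
    raising an index sends a row to an earlier one because [T] is standard
    ([tableau_minor]).

    Minimality.  The map [lambda |-> (a_T(lambda), b_T(lambda), lambda)] is linear, so the
    face of [T] has dimension at most [c].  A regular face [F], cut out by the form [u],
    contains the weight [(beta, gamma, alpha)], strictly decreasing in each part, of some
    highest weight polynomial [f <> 0]: multiply polynomials of the triples that span a
    point of [F] in the open chamber.  It is enough to find in [F], for every [t < c], the
    weight [N (beta, gamma, alpha) + (e_i, e_j, e_t)] for some [i] and [j] and a fixed
    [N > 0]: the last parts [N alpha + e_t] are independent, so [dim F >= c].

    These weights come from a change of variables with polynomial coefficients.  The matrix
    [M] with entries [M_pq = E_qp f] is upper triangular with the distinct diagonal entries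
    [beta_i f], and the derivations act on it by commutators, up to the weight of [f].  So
    its eigenvectors [(M - beta_0 f) ... (M - beta_(i-1) f) e_i] are highest weight vectors
    in the index [i], while their entries transform dually to the variables
    ([raise_eig_mx_self]).  With these vectors, scaled by powers of [f] to a common degree,
    as columns of [S_A], and [S_B], [S_C] likewise for the other two indices, each entry of
    [P = X . (S_A, S_B, S_C)] is zero or a highest weight polynomial of weight
    [(a + b + c) (beta, gamma, alpha) + (e_i, e_j, e_t)] ([shifted_var_hw]).  As [f] is a
    highest weight polynomial and the three matrices are triangular, [f(P)] is [f] times
    powers of their diagonal entries, hence nonzero ([mmap_shifted_var_neq0]).  So some
    monomial of [f] does not vanish at [P].  The form [u] vanishes on the weight of that
    monomial and is nonnegative on the weight of each nonzero [P_ijt], hence zero on those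
    that occur in the monomial; and every [t] occurs, because [alpha_t > 0]
    ([exists_shift]). *)

Set Implicit Arguments.
Unset Strict Implicit.
Unset Printing Implicit Defensive.

Import Order.TTheory GRing.Theory Num.Theory.
Local Open Scope ring_scope.

(** * Nonvanishing Kronecker coefficients and polytabloids *)

Section TensorEntries.
Variable F : fieldType.

Lemma trow_entry (n1 m2 n2 : nat) :
  (forall i2 J, exists j1 j2, forall (A : 'rV[F]_n1) (B : 'M[F]_(m2, n2)),
     trow A B i2 J = A 0 j1 * B i2 j2) /\
  (forall j1 j2, exists J, forall i2 (A : 'rV[F]_n1) (B : 'M[F]_(m2, n2)),
     trow A B i2 J = A 0 j1 * B i2 j2).
Proof.
elim: n1 => [|n1 [IH1 IH2]]; first by split=> [i2 []|[]].
split=> [i2|] /=.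
  move=> J; rewrite -(@splitK n2 (n1 * n2) J); case: split => [j2|J'] /=.
    by exists (lshift n1 (0 : 'I_1)), j2 => A B; rewrite row_mxEl !mxE.
  have [j1 [j2 H]] := IH1 i2 J'.
  by exists (rshift 1 j1), j2 => A B; rewrite row_mxEr H mxE.
move=> j1 j2; rewrite -(@splitK 1 n1 j1); case: split => [k|j1'] /=.
  by exists (lshift _ j2) => i2 A B; rewrite row_mxEl !mxE ord1.
have [J H] := IH2 j1' j2.
by exists (rshift n2 J) => i2 A B; rewrite row_mxEr H mxE.
Qed.

(** All that is used of the indexing of the entries of a tensor product of matrices, which is
    defined by recursion on the number of rows. *)
Lemma tprod_entry (m1 n1 m2 n2 : nat) :
  (forall I J, exists i1 j1 i2 j2, forall (A : 'M[F]_(m1, n1)) (B : 'M[F]_(m2, n2)),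
     tprod A B I J = A i1 j1 * B i2 j2) /\
  (forall i1 j1 i2 j2, exists I J, forall (A : 'M[F]_(m1, n1)) (B : 'M[F]_(m2, n2)),
     tprod A B I J = A i1 j1 * B i2 j2).
Proof.
elim: m1 => [|m1 [IH1 IH2]]; first by split=> [[]|[]].
have [T1 T2] := trow_entry n1 m2 n2.
split=> [I J|i1 j1 i2 j2] /=.
  rewrite -(@splitK m2 (m1 * m2) I); case: split => [i2|I'] /=.
    have [j1 [j2 H]] := T1 i2 J.
    by exists (lshift m1 (0 : 'I_1)), j1, i2, j2 => A B; rewrite col_mxEu H !mxE.
  have [i1 [j1 [i2 [j2 H]]]] := IH1 I' J.
  by exists (rshift 1 i1), j1, i2, j2 => A B; rewrite col_mxEd H !mxE.
rewrite -(@splitK 1 m1 i1); case: split => [k|i1'] /=.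
  have [J H] := T2 j1 j2.
  by exists (lshift _ i2), J => A B; rewrite col_mxEu H !mxE ord1.
have [I [J H]] := IH2 i1' j1 i2 j2.
by exists (rshift m2 I), J => A B; rewrite col_mxEd H !mxE.
Qed.

End TensorEntries.

(** The sum of the matrices of the group elements is [#|G|] times a projection onto the space
    of fixed vectors. *)
Lemma rfix_mx_neq0 (F : fieldType) (gT : finGroupType) (G : {group gT}) (d : nat)
    (rG : mx_representation F G d) : (#|G|%:R != 0 :> F) ->
  (\rank (rfix_mx rG G) != 0%N) = (\sum_(g in G) rG g != 0).
Proof.
move=> nzG; rewrite mxrank_eq0; congr negb; apply/eqP/eqP => [fix0|sum0].
  have: ((\sum_(g in G) rG g)%R <= rfix_mx rG G)%MS; last by rewrite fix0 submx0 => /eqP.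
  apply/rfix_mxP => x xG; rewrite mulmx_suml.
  rewrite [RHS](reindex_inj (mulIg x)) /=; apply: eq_big => g; first by rewrite groupMr.
  by move=> gG; rewrite repr_mxM.
have: rfix_mx rG G *m (\sum_(g in G) rG g) = #|G|%:R *: rfix_mx rG G.
  rewrite mulmx_sumr (eq_bigr (fun=> rfix_mx rG G)) => [|g gG].
    by rewrite sumr_const scaler_nat.
  exact: rfix_mx_id.
by rewrite sum0 mulmx0 => /esym/eqP; rewrite scalemx_eq0 (negPf nzG) => /eqP.
Qed.

(** The coefficient of the word [w] in the product over the columns of the diagram of the
    antisymmetrizations of the words [0, 1, 2, ...]. *)
Definition word_polytabloid (n : nat) (l : seq nat) (w : 'I_n -> nat) : algC :=
  \sum_(q in col_stab n l) (-1) ^+ odd_perm q * [forall k, w k == reshape_index l (q k)]%:R.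

Definition polytabloid (n : nat) (l : seq nat) (y : 'S_n) : algC :=
  word_polytabloid l (fun k => reshape_index l (y k)).

Section KroneckerCriterion.
Variable n : nat.
Implicit Types l : seq nat.

Lemma row_stabP l (p : 'S_n) :
  reflect (forall k, reshape_index l (p k) = reshape_index l k) (p \in row_stab n l).
Proof. by rewrite inE; apply: (iffP forallP) => H k; apply/eqP. Qed.

Lemma col_stabP l (p : 'S_n) :
  reflect (forall k, reshape_offset l (p k) = reshape_offset l k) (p \in col_stab n l).
Proof. by rewrite inE; apply: (iffP forallP) => H k; apply/eqP. Qed.

Lemma col_stabV l (q : 'S_n) : (q^-1%g \in col_stab n l) = (q \in col_stab n l).
Proof.
apply/col_stabP/col_stabP => H k; first by rewrite -(H (q k)) permK.
by rewrite -{2}(permKV q k) H.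
Qed.

Lemma col_stabM l (q r : 'S_n) : q \in col_stab n l ->
  ((q * r)%g \in col_stab n l) = (r \in col_stab n l).
Proof.
move=> /col_stabP qC; apply/col_stabP/col_stabP => H k.
  by rewrite -[k](permKV q) -(permM q r) H qC.
by rewrite permM H qC.
Qed.

Local Notation GS := [set: 'S_n]%G.
Local Notation reg := (regular_repr algC GS).

(** The coefficient of the Young symmetrizer at [y^-1] is [polytabloid l y]: for each column
    permutation there is at most one row permutation that contributes. *)
Lemma young_row_entry l (x g z : 'S_n) :
  (young_symmetrizer n l *m reg x *m reg g) 0 (gring_index GS z)
    = polytabloid l (x * g * z^-1)%g.
Proof.
rewrite -mulmxA -repr_mxM ?inE // -/reg.
rewrite /young_symmetrizer -gring_row_mul mulmx_suml linear_sum summxE.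
rewrite (eq_bigr (fun p => \sum_(q in col_stab n l)
  (-1) ^+ odd_perm q * (p * q * (x * g) == z)%g%:R)); last first.
  move=> p _; rewrite mulmx_suml linear_sum summxE; apply: eq_bigr => q _.
  rewrite -scalemxAl -repr_mxM ?inE // linearZ mxE; congr (_ * _).
  rewrite !mxE /= gring_indexK ?inE // mul1g.
  by rewrite (can_in_eq (gring_indexK (G := GS))) ?inE // eq_sym.
rewrite exchange_big /= /polytabloid /word_polytabloid (reindex_inj invg_inj) /=.
apply: eq_big => q; first exact: col_stabV.
move=> _; rewrite -mulr_sumr odd_permV; congr (_ * _).
set p0 := (z * (q^-1 * (x * g))^-1)%g.
have E p : (p * q^-1 * (x * g) == z)%g = (p == p0).
  by rewrite -mulgA /p0; apply/eqP/eqP => [<-|->]; rewrite ?mulgK ?mulgKV.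
rewrite (eq_bigr (fun p => if p == p0 then 1 else 0)) => [|p _]; last by rewrite E; case: eqP.
rewrite -big_mkcondr /=.
have Ep j : p0 ((x * g * z^-1)%g j) = q j.
  by rewrite /p0 -permM !invMg !mulgA mulgKV mulgK mulgV mul1g invgK.
have -> : [forall k, reshape_index l ((x * g * z^-1)%g k) == reshape_index l (q k)]
        = (p0 \in row_stab n l).
  apply/forallP/row_stabP => H k; last by rewrite -(Ep k) H.
  by rewrite -(permKV (x * g * z^-1)%g k) Ep (eqP (H _)).
case: (boolP (p0 \in _)) => [p0R|p0R].
  by rewrite (big_pred1 p0) // => p /=; case: eqP => [->|]; rewrite ?p0R ?andbF.
by rewrite big1 // => p /andP[pR /eqP Ep0]; rewrite -Ep0 pR in p0R.
Qed.

(** The operator [sum_g h(g) g] is zero on the right ideal generated by the Young symmetrizer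
    [e] if and only if it kills all [e x], and the coordinates of their images are the sums
    of [h] against two-sided translates of the polytabloid. *)
Lemma specht_orth l (h : 'S_n -> algC) :
  (\sum_(g in GS) h g *: specht n l g = 0) <->
  (forall x y, \sum_(g in GS) h g * polytabloid l (x * g * y)%g = 0).
Proof.
set e := young_symmetrizer n l; set H := \sum_(g in GS) h g *: reg g.
have entry x z : (e *m reg x *m H) 0 (gring_index GS z) =
    \sum_(g in GS) h g * polytabloid l (x * g * z^-1)%g.
  rewrite mulmx_sumr summxE; apply: eq_bigr => g _.
  by rewrite -scalemxAr mxE young_row_entry.
pose U := cyclic_mx reg e.
have sumE : \sum_(g in GS) h g *: specht n l g = in_submod U (val_submod 1%:M *m H).
  by rewrite mulmx_sumr linear_sum; apply: eq_bigr => g _; rewrite -scalemxAr linearZ.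
have UH : (val_submod (1%:M : 'M_(\rank U)) *m H <= U)%MS.
  rewrite mulmx_sumr summx_sub // => g gG; rewrite -scalemxAr scalemx_sub //.
  exact: submx_trans (submxMr _ (val_submodP _)) (mxmoduleP (cyclic_mx_module _ _) g gG).
have zeroE : (\sum_(g in GS) h g *: specht n l g = 0) <-> (U <= kermx H)%MS.
  rewrite sumE; split=> [eq0|/sub_kermxP UH0].
    apply/sub_kermxP; apply/eqP; rewrite -submx0 -(eqmxMr _ (val_submod1 U)).
    by rewrite -(in_submodK UH) eq0 linear0 sub0mx.
  apply: val_submod_inj; rewrite in_submodK // linear0.
  by apply/eqP; rewrite -submx0 (eqmxMr _ (val_submod1 U)) UH0.
split=> [/zeroE Uker x y|H0]; last first.
  apply/zeroE/row_subP => i; have /cyclic_mxP[A /envelop_mxP[a ->] ->] := row_sub i U.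
  rewrite mulmx_sumr summx_sub // => x _; rewrite -scalemxAr scalemx_sub //.
  apply/sub_kermxP/rowP => j; rewrite -(gring_valK j) entry mxE.
  by have := H0 x (enum_val j)^-1%g.
rewrite -[y]invgK -entry.
have /sub_kermxP -> : (e *m reg x <= kermx H)%MS; last by rewrite mxE.
apply: submx_trans Uker; apply: submx_trans (submxMr _ (cyclic_mx_id _ _)) _.
by apply: (mxmoduleP (cyclic_mx_module _ _)); rewrite inE.
Qed.

Lemma specht_orth_neq0 l (h : 'S_n -> algC) :
  (exists i j, \sum_(g in GS) h g * specht n l g i j != 0) <->
  (exists x y, \sum_(g in GS) h g * polytabloid l (x * g * y)%g != 0).
Proof.
have sumE i j : \sum_(g in GS) h g * specht n l g i j =
    (\sum_(g in GS) h g *: specht n l g) i j.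
  by rewrite summxE; apply: eq_bigr => g _; rewrite [RHS]mxE.
split; apply: contraPP => N.
  have Z : \sum_(g in GS) h g *: specht n l g = 0.
    apply/specht_orth => x y; apply/eqP; apply: contra_notT N => nz.
    by exists x, y.
  by case=> i [j]; rewrite sumE Z mxE eqxx.
have Z : \sum_(g in GS) h g *: specht n l g = 0.
  apply/matrixP => i j; rewrite -sumE mxE; apply/eqP; apply: contra_notT N => nz.
  by exists i, j.
by case=> x [y]; rewrite (specht_orth _ _).1 ?eqxx.
Qed.

(** Averaging gives a nonzero sum over the group of a product of three matrix entries; each of
    them can be traded in turn for a translate of a polytabloid, the other two making up the
    function [h] of [specht_orth_neq0]. *)
Lemma kroneckerP (l m k : seq nat) : sumn l = n -> sumn m = n -> sumn k = n ->
  kronecker l m k != 0%N <->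
  exists x1 x2 x3 y1 y2 y3,
    \sum_(g in GS) polytabloid l (x1 * g * y1)%g * polytabloid m (x2 * g * y2)%g
      * polytabloid k (x3 * g * y3)%g != 0.
Proof.
move=> ln mn kn; rewrite /kronecker ln mn kn eqxx /=.
rewrite rfix_mx_neq0; last by rewrite pnatr_eq0 -lt0n cardG_gt0.
set S := \sum_(g in _) _.
have -> : (S != 0) <-> exists i1 j1 i2 j2 i3 j3, \sum_(g in GS)
    specht n l g i1 j1 * specht n m g i2 j2 * specht n k g i3 j3 != 0.
  pose r q := \rank (cyclic_mx (regular_repr algC GS) (young_symmetrizer n q)).
  have [t1 t2] := tprod_entry algC (r l) (r l) (r m) (r m).
  have [T1 T2] := tprod_entry algC (r l * r m) (r l * r m) (r k) (r k).
  split=> [/matrix0Pn[I [J]]|[i1 [j1 [i2 [j2 [i3 [j3 nz]]]]]]].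
    have [I2 [J2 [i3 [j3 E]]]] := T1 I J; have [i1 [j1 [i2 [j2 E2]]]] := t1 I2 J2.
    rewrite summxE => nz; exists i1, j1, i2, j2, i3, j3.
    by apply: contra nz => /eqP Z; apply/eqP; rewrite -[RHS]Z; apply: eq_bigr => g _ /=; rewrite E E2.
  have [I2 [J2 E2]] := t2 i1 j1 i2 j2; have [I [J E]] := T2 I2 J2 i3 j3.
  apply/matrix0Pn; exists I, J; rewrite summxE.
  apply: contra nz => /eqP Z; apply/eqP; rewrite -[RHS]Z; apply: eq_bigr => g _ /=.
  by rewrite E E2.
have mid A B C : \sum_(g in GS) (A g * B g * C g : algC) = \sum_(g in GS) A g * C g * B g.
  by apply: eq_bigr => g _; rewrite mulrAC.
have fst A B C : \sum_(g in GS) (A g * B g * C g : algC) = \sum_(g in GS) B g * C g * A g.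
  by apply: eq_bigr => g _; rewrite -mulrA mulrC.
split.
  case=> i1 [j1 [i2 [j2 [i3 [j3 nz]]]]].
  have [x3 [y3 {}nz]] := (specht_orth_neq0 k _).1 (ex_intro _ i3 (ex_intro _ j3 nz)).
  rewrite mid in nz.
  have [x2 [y2 {}nz]] := (specht_orth_neq0 m _).1 (ex_intro _ i2 (ex_intro _ j2 nz)).
  rewrite -mid fst in nz.
  have [x1 [y1 {}nz]] := (specht_orth_neq0 l _).1 (ex_intro _ i1 (ex_intro _ j1 nz)).
  by exists x1, x2, x3, y1, y2, y3; rewrite fst.
case=> x1 [x2 [x3 [y1 [y2 [y3 nz]]]]].
have [i3 [j3 {}nz]] := (specht_orth_neq0 k _).2 (ex_intro _ x3 (ex_intro _ y3 nz)).
rewrite mid in nz.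
have [i2 [j2 {}nz]] := (specht_orth_neq0 m _).2 (ex_intro _ x2 (ex_intro _ y2 nz)).
rewrite -mid fst in nz.
have [i1 [j1 {}nz]] := (specht_orth_neq0 l _).2 (ex_intro _ x1 (ex_intro _ y1 nz)).
by exists i1, j1, i2, j2, i3, j3; rewrite fst.
Qed.

End KroneckerCriterion.

(** * Highest weight functions on the symmetric group *)

(** Of two maps that are jointly injective, [v] takes distinct values on each fiber of [u], so
    the rank of an element in its fiber is at most the value of [v].  The sum of the fiber
    sizes counts the pairs in a common fiber: the [n] diagonal ones, and each other pair
    twice, so that it is [n] plus twice the sum of the ranks. *)
Section Fibers.
Variables (n : nat) (u v : 'I_n -> nat).
Hypothesis uv_inj : forall r s, u r = u s -> v r = v s -> r = s.

Let rank s := #|[set r | (u r == u s) && (v r < v s)%N]|.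

Let rank_le s : (rank s <= v s)%N.
Proof.
rewrite /rank -[X in (_ <= X)%N]card_ord.
have H r : r \in [set r | (u r == u s) && (v r < v s)%N] -> (v r < v s)%N.
  by rewrite inE => /andP[].
pose g (r : 'I_n) : option 'I_(v s) := insub (v r).
have ginj : {in [set r | (u r == u s) && (v r < v s)%N] &, injective g}.
  move=> r1 r2 r1A r2A; rewrite /g !insubT ?H // => p1 p2 [] e.
  by apply: uv_inj => //; move: r1A r2A; rewrite !inE => /andP[/eqP-> _] /andP[/eqP-> _].
rewrite -(card_in_imset ginj).
have -> : #|'I_(v s)| = #|[set Some i | i : 'I_(v s)]|.
  by rewrite card_imset // => i j [].
apply/subset_leq_card/fintype.subsetP => _ /imsetP[r rA ->].
by rewrite /g insubT ?H // => p; rewrite imset_f.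
Qed.

Let pairs_count :
  (\sum_s #|[set r | u r == u s]| = n + 2 * \sum_s rank s)%N.
Proof.
have cardE (P : 'I_n -> 'I_n -> bool) :
    (\sum_s #|[set r | P r s]| = \sum_s \sum_r P r s)%N.
  apply: eq_bigr => s _; rewrite -sum1_card big_mkcond; apply: eq_bigr => r _.
  by rewrite inE; case: (P r s).
rewrite !cardE mul2n -addnn [X in (_ + (_ + X))%N]exchange_big /=.
rewrite -[X in (X + _)%N]card_ord -sum1_card.
rewrite -!big_split; apply: eq_bigr => s _ /=.
rewrite -(@big_pred1_eq _ 0%N addn _ s (fun=> 1%N)) big_mkcond -!big_split; apply: eq_bigr => r _ /=.
rewrite (eq_sym (u s)) /=; have [->|rs] := eqVneq r s; first by rewrite eqxx ltnn.
have [eu|//] := eqVneq (u r) (u s).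
by case: ltngtP => // ev; rewrite (uv_inj eu ev) eqxx in rs.
Qed.

Lemma card_fibers_le : (\sum_s #|[set r | u r == u s]| <= n + 2 * \sum_s v s)%N.
Proof. by rewrite pairs_count leq_add2l leq_mul2l leq_sum. Qed.

(** In the case of equality [v] is the rank, so its values on a fiber are the initial segment of
    the integers. *)
Lemma card_fibers_eq : (n + 2 * \sum_s v s <= \sum_s #|[set r | u r == u s]|)%N ->
  forall s, (v s < #|[set r | u r == u s]|)%N.
Proof.
rewrite pairs_count leq_add2l leq_mul2l /= => le s.
have -> : v s = rank s.
  apply/eqP; rewrite eqn_leq rank_le andbT leqNgt; apply/negP => lt.
  move: le; rewrite leqNgt (bigD1 s) //= [X in (_ < X)%N](bigD1 s) //= -addSn.
  by rewrite leq_add // leq_sum.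
apply: proper_card; apply/properP; split.
  by apply/fintype.subsetP => r; rewrite !inE => /andP[].
by exists s; rewrite !inE ?eqxx ?ltnn ?andbF.
Qed.

End Fibers.

Section PolytabloidDuality.
Variables (n : nat) (l : seq nat).
Hypothesis sum_l : sumn l = n.
Local Notation rw := (reshape_index l).
Implicit Types (y z h : 'S_n) (psi chi : 'S_n -> algC).

(** Think of [psi y] as the coefficient of the word [t |-> rw (y t)] in a tensor.  The second
    condition says that the operator that raises a letter [rw s] to [i] kills the tensor, at
    the word in which the letter [rw s] at the position [y^-1 s] has been replaced by [i]: the
    letters [i] of that word are the one put there, which gives [psi y], and those that were
    there, which give the other terms. *)
Definition highest_weight psi :=
  (forall y p, p \in row_stab n l -> psi (y * p)%g = psi y) /\
  (forall y (s : 'I_n) i, (i < rw s)%N ->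
     psi y + \sum_(r : 'I_n | rw r == i) psi (y * tperm r s)%g = 0).

Definition hw_orthogonal psi :=
  highest_weight psi /\ forall x, \sum_y psi y * polytabloid l (x * y)%g = 0.

Lemma highest_weight_sum (I : finType) (P : pred I) (c : I -> algC) (F : I -> 'S_n -> algC) :
  (forall i, P i -> highest_weight (F i)) ->
  highest_weight (fun y => \sum_(i | P i) c i * F i y).
Proof.
move=> HF; split=> [y p pR|y s i lt].
  by apply: eq_bigr => i Pi; have [-> //] := HF i Pi.
rewrite exchange_big /= -big_split big1 //= => j Pj; have [_ H] := HF j Pj.
by rewrite -mulr_sumr -mulrDr H ?mulr0.
Qed.

Lemma hw_orthogonal_translate psi h : hw_orthogonal psi -> hw_orthogonal (fun y => psi (h * y)%g).
Proof.
case=> [[H1 H2] H3]; split=> [|x]; first split=> [y p pR|y s i lt].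
- by rewrite mulgA; exact: H1.
- rewrite -[RHS](H2 (h * y)%g s i lt); congr (_ + _).
  by apply: eq_bigr => r _; rewrite mulgA.
rewrite -[RHS](H3 (x * h^-1)%g) (reindex_inj (mulgI h^-1%g)) /=.
by apply: eq_bigr => y _; rewrite mulgA mulgV mul1g mulgA.
Qed.

Lemma hw_orthogonal_sum (I : finType) (P : pred I) (c : I -> algC) (F : I -> 'S_n -> algC) :
  (forall i, P i -> hw_orthogonal (F i)) -> hw_orthogonal (fun y => \sum_(i | P i) c i * F i y).
Proof.
move=> HF; split=> [|x].
  by apply: highest_weight_sum => i Pi; case: (HF i Pi).
under eq_bigr do rewrite mulr_suml.
rewrite exchange_big big1 //= => j Pj; have [_ H] := HF j Pj.
by under eq_bigr do rewrite -mulrA; rewrite -mulr_sumr H mulr0.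
Qed.

Lemma hw_orthogonal_comb psi1 (c : algC) psi2 : hw_orthogonal psi1 -> hw_orthogonal psi2 ->
  hw_orthogonal (fun y => psi1 y + c * psi2 y).
Proof.
move=> H1 H2.
have H : hw_orthogonal (fun y => \sum_b (if b then 1 else c) * (if b then psi1 else psi2) y).
  by apply: hw_orthogonal_sum => -[].
by congr hw_orthogonal: H; apply/funext => y; rewrite big_bool mul1r.
Qed.

(** The labels [P] play on the left of the group the role that the columns of the diagram
    play for the polytabloid, which is antisymmetric under them. *)
Definition antisymmetric_on (P : 'I_n -> 'I_n) chi :=
  forall (r s : 'I_n) y, r != s -> P r = P s -> chi (tperm r s * y)%g = - chi y.

(** Induction on the support: transpositions inside the classes of [P] generate all the
    permutations that preserve [P]. *)
Lemma antisymmetric_on_perm (P : 'I_n -> 'I_n) chi h :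
  antisymmetric_on P chi -> (forall k, P (h k) = P k) ->
  forall y, chi (h * y)%g = (-1) ^+ odd_perm h * chi y.
Proof.
move=> chiP; have [d] := ubnP #|[set k | h k != k]|.
elim: d h => // d IH h hd hP y.
have [/forallP h1|] := boolP [forall k, h k == k].
  have -> : h = 1%g by apply/permP => k; rewrite perm1; apply/eqP.
  by rewrite mul1g odd_perm1 mul1r.
rewrite negb_forall => /existsP[x hx].
set t := tperm x (h x).
have th : h = (t * (t * h))%g by rewrite mulgA tperm2 mul1g.
have thx : (t * h)%g x = h (h x) by rewrite permM tpermL.
have thhx : (t * h)%g (h x) = h x by rewrite permM tpermR.
rewrite {1}th -mulgA chiP ?(eq_sym x) ?hP // IH.
- by rewrite odd_permM odd_tperm (eq_sym x) hx /= signrN mulNr opprK.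
- rewrite -ltnS; apply: leq_trans hd; rewrite ltnS; apply: proper_card.
  apply/properP; split; last by exists (h x); rewrite !inE ?thhx ?eqxx // (inj_eq perm_inj).
  apply/fintype.subsetP => k; rewrite !inE; apply: contra => /eqP hk.
  have kx : k != x by apply: contraNneq hx => <-; rewrite hk.
  have khx : k != h x by apply: contraNneq kx => kE; rewrite -(inj_eq (@perm_inj _ h)) hk kE.
  by rewrite permM tpermD ?hk // eq_sym.
move=> k; rewrite permM hP /t; case: tpermP => [->|->|] //; by rewrite hP.
Qed.

(** Moving the position [s] from its class to the class of the label [i] and antisymmetrizing
    over that larger class: coset representatives are the identity and the transpositions of
    [s] with the members of the class. *)
Lemma antisymmetric_on_lower (P : {ffun 'I_n -> 'I_n}) chi (s i : 'I_n) :
  antisymmetric_on P chi -> (i < P s)%N ->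
  antisymmetric_on [ffun k => if k == s then i else P k]
    (fun y => chi y + (-1) * \sum_(r | P r == i) chi (tperm r s * y)%g).
Proof.
move=> chiP lt r1 r2 y; rewrite !ffunE.
have Ps : P s != i by apply: contraTneq lt => ->; rewrite ltnn.
have Pns r : P r = i -> r != s by move=> Pr; apply: contraNneq Ps => <-; rewrite Pr.
(* absorbing a transposition that exchanges [s] with a box [r1] of the block [i] *)
have main r1' y' : P r1' = i ->
    chi (tperm r1' s * y')%g - \sum_(r | P r == i) chi (tperm r s * (tperm r1' s * y'))%g
    = - (chi y' - \sum_(r | P r == i) chi (tperm r s * y')%g).
  move=> Pr1; rewrite (bigD1 r1') ?Pr1 //= [in RHS](bigD1 r1') ?Pr1 //= mulgA tperm2 mul1g.
  rewrite (eq_bigr (fun r => - chi (tperm r s * y')%g)) => [|r /andP[/eqP Pr rr1]].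
    by rewrite sumrN; ring.
  rewrite -(chiP r1' r) ?Pr ?Pr1 // 1?eq_sym // !mulgA; congr (chi (_ * _)%g).
  have <- : (tperm r1' s ^ tperm r s)%g = tperm r1' r.
    by rewrite tpermJ tpermR tpermD // eq_sym Pns.
  by rewrite conjgE tpermV -!mulgA tperm2 mulg1.
have [->|r1s] := eqVneq r1 s; have [->|r2s] := eqVneq r2 s.
- by [].
- by move=> _ iP; rewrite tpermC !mulN1r main.
- by move=> _ iP; rewrite !mulN1r main.
move=> r12 P12; rewrite chiP // !mulN1r [in RHS]opprD opprK; congr (_ + _).
rewrite -sumrN; set t := tperm r1 r2.
have Pt r : P (t r) = P r by rewrite /t; case: tpermP => [->|->|] //.
rewrite (reindex_inj (@perm_inj _ t)) /=; apply: eq_big => [r|r Pr]; first by rewrite Pt.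
rewrite -(chiP r1 r2) //.
have ts : t s = s by rewrite tpermD // eq_sym.
by rewrite -{1}ts -tpermJ conjgE tpermV !mulgA tperm2 mul1g -(mulgA _ t t) tperm2 mulg1.
Qed.

(** The terms with [u r < u s] are given by the hypothesis, those with [u s < u r] by symmetry;
    what remains are the pairs inside the fibers of [u].  This evaluates the sum of all
    transpositions, both by the rows of the diagram and by labels. *)
Lemma sum_transpositions (g : 'I_n -> 'I_n -> algC) (u : 'I_n -> nat) (c : algC) :
  (forall r s, g r s = g s r) ->
  (forall s i, (i < u s)%N -> \sum_(r | u r == i) g r s = c) ->
  \sum_r \sum_s g r s =
    (2 * \sum_s u s)%:R * c + \sum_s \sum_(r | u r == u s) g r s.
Proof.
move=> sym gc.
have low : \sum_s \sum_(r | (u r < u s)%N) g r s = (\sum_s u s)%:R * c.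
  rewrite natr_sum mulr_suml; apply: eq_bigr => s _.
  rewrite mulr_natl -{2}(card_ord (u s)) -sumr_const.
  rewrite [RHS](eq_bigr (fun i : 'I_(u s) => \sum_(r | u r == i) g r s)) => [|i _]; last first.
    by rewrite gc.
  rewrite (exchange_big_dep xpredT) //= big_mkcond; apply: eq_bigr => r _.
  case: ifPn => [lt|nlt]; first by rewrite (big_pred1 (Ordinal lt)) // => i; rewrite /= eq_sym.
  by rewrite big1 // => i /eqP ri; rewrite ri ltn_ord in nlt.
have up : \sum_s \sum_(r | (u s < u r)%N) g r s = (\sum_s u s)%:R * c.
  rewrite -low (exchange_big_dep xpredT) //=; apply: eq_bigr => s _.
  by apply: eq_bigr => r _; apply: sym.
rewrite exchange_big /= mulnC natrM mulr_natr mulr2n mulrDl -{1}low -up -!big_split /=.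
apply: eq_bigr => s _; rewrite !(big_mkcond (fun r => _ _ _)) -!big_split; apply: eq_bigr => r _ /=.
by case: ltngtP => _; rewrite ?add0r ?addr0.
Qed.

Lemma hw_orthogonal_casimir psi y : hw_orthogonal psi ->
  \sum_(r : 'I_n) \sum_(s : 'I_n) psi (y * tperm r s)%g =
  (\sum_(s : 'I_n) #|[set r : 'I_n | rw r == rw s]|)%:R * psi y
    - (2 * \sum_(s : 'I_n) rw s)%:R * psi y.
Proof.
case=> [[H1 H2] _].
rewrite (@sum_transpositions _ rw (- psi y)) => [|r s|s i lt]; last 2 first.
- by rewrite tpermC.
- by apply/eqP; rewrite -addr_eq0 addrC H2.
rewrite mulrN addrC; congr (_ - _); rewrite natr_sum mulr_suml; apply: eq_bigr => s _.
rewrite (eq_bigr (fun=> psi y)) => [|r /eqP rs].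
  by rewrite sumr_const mulr_natl; congr (_ *+ _); apply: eq_card => r; rewrite !inE.
by apply: H1; apply/row_stabP => k; case: tpermP => [->|->|].
Qed.

Lemma antisymmetric_on_casimir (P : {ffun 'I_n -> 'I_n}) chi y : antisymmetric_on P chi ->
  (forall (s i : 'I_n), (i < P s)%N -> \sum_(r | P r == i) chi (tperm r s * y)%g = chi y) ->
  \sum_(r : 'I_n) \sum_(s : 'I_n) chi (tperm r s * y)%g =
  (2 * (n + \sum_(s : 'I_n) P s))%:R * chi y
    - (\sum_(s : 'I_n) #|[set r | P r == P s]|)%:R * chi y.
Proof.
move=> chiP low; rewrite (@sum_transpositions _ (fun s => P s) (chi y)) => [|r s|s i lt]; last 2 first.
- by rewrite tpermC.
- by rewrite -(low s (Ordinal (ltn_trans lt (ltn_ord _)))).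
rewrite mulnDr natrD mulrDl addrAC [RHS]addrC; congr (_ + _).
have -> : (2 * n)%:R * chi y = \sum_(s : 'I_n) (chi y *+ 2).
  by rewrite sumr_const card_ord -mulrnA mulr_natl.
rewrite natr_sum mulr_suml -sumrB; apply: eq_bigr => s _.
rewrite (bigD1 s) //= tperm1 mul1g (eq_bigr (fun=> - chi y)) => [|r /andP[/eqP rs ne]]; last first.
  by rewrite chiP //; apply/val_inj.
rewrite sumr_const.
have -> : #|[set r | P r == P s]| = #|[pred i | P i == P s & i != s]|.+1.
  rewrite (cardD1 s) inE eqxx add1n; congr _.+1; apply: eq_card => r; rewrite !inE.
  by rewrite andbC.
by rewrite -natr1 mulrDl mul1r mulNrn mulr_natl; ring.
Qed.

(** Take the sum of the labels minimal among all labellings that admit a nonzero function of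
    this kind.  Lowering one more label by [antisymmetric_on_lower] must then give zero.  The
    labelling with distinct labels shows that there are such labellings. *)
Lemma exists_lowest_label psi y0 : hw_orthogonal psi -> psi y0 != 0 ->
  exists (P : {ffun 'I_n -> 'I_n}) chi y1,
  [/\ hw_orthogonal chi, chi y1 != 0, antisymmetric_on P chi &
   forall (s i : 'I_n) y, (i < P s)%N -> \sum_(r | P r == i) chi (tperm r s * y)%g = chi y].
Proof.
move=> hpsi psi0.
pose good (P : {ffun 'I_n -> 'I_n}) :=
  exists chi y1, [/\ hw_orthogonal chi, chi y1 != 0 & antisymmetric_on P chi].
have ex0 : exists d, `[< exists P, good P /\ (\sum_s P s)%N = d >].
  exists (\sum_(s : 'I_n) [ffun s : 'I_n => s] s)%N; apply/asboolP.
  exists [ffun s => s]; split=> //; exists psi, y0; split=> // r s y rs.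
  by rewrite !ffunE => E; rewrite E eqxx in rs.
case: (ex_minnP ex0) => d /asboolP[P [[chi [y1 [hchi chi1 chiP]]] dP]] dmin.
exists P, chi, y1; split=> // s i y lt; apply/eqP; rewrite -subr_eq0; apply/eqP.
set P' := [ffun k => if k == s then i else P k].
have lowP := antisymmetric_on_lower chiP lt.
have hlow : hw_orthogonal (fun y => chi y + (-1) * \sum_(r | P r == i) chi (tperm r s * y)%g).
  apply: hw_orthogonal_comb => //.
  have := @hw_orthogonal_sum _ (fun r => P r == i) (fun=> 1) (fun r y => chi (tperm r s * y)%g).
  move=> /(_ (fun r _ => hw_orthogonal_translate _ hchi)).
  by congr hw_orthogonal; apply/funext => z; apply: eq_bigr => r _; rewrite mul1r.
apply/eqP; rewrite -oppr_eq0 opprB; apply/negP => /negP nz.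
have : (d <= \sum_s P' s)%N.
  apply: dmin; apply/asboolP; exists P'; split=> //.
  by exists (fun y => chi y + (-1) * \sum_(r | P r == i) chi (tperm r s * y)%g), y; rewrite mulN1r.
rewrite -dP leqNgt (bigD1 s) //= [X in (_ < X)%N](bigD1 s) //= ffunE eqxx.
rewrite (eq_bigr (fun r => P r : nat)) => [|r rs]; first by rewrite ltn_add2r lt.
by rewrite ffunE (negPf rs).
Qed.

(** Exchanging [r] and [s] multiplies [chi] by [-1] through the labels and by [1] through the
    rows. *)
Lemma cells_distinct (P : {ffun 'I_n -> 'I_n}) chi y r s :
  hw_orthogonal chi -> antisymmetric_on P chi ->
  chi y != 0 -> rw (y r) = rw (y s) -> P r = P s -> r = s.
Proof.
move=> [[H1 _] _] chiP nz rwrs Prs; apply/eqP; apply: contraT => rs.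
have := chiP r s y rs Prs.
have -> : (tperm r s * y)%g = (y * tperm (y r) (y s))%g.
  by rewrite -tpermJ conjgE mulKVg.
rewrite H1; last by apply/row_stabP => k; case: tpermP => [->|->|].
move/eqP; rewrite -subr_eq0 opprK -mulr2n -mulr_natl mulf_eq0 pnatr_eq0 /=.
by rewrite (negPf nz).
Qed.

Lemma offset_lt (s : 'I_n) : (reshape_offset l s < nth 0%N l (rw s))%N.
Proof. by apply: reshape_offsetP; rewrite sum_l. Qed.

Lemma box_inj (r s : 'I_n) :
  rw r = rw s -> reshape_offset l r = reshape_offset l s -> r = s.
Proof.
by move=> er ec; apply/val_inj; rewrite /= -(reshape_indexK l r) er ec reshape_indexK.
Qed.

Lemma exists_box (i j : nat) : (j < nth 0%N l i)%N ->
  exists s : 'I_n, rw s = i /\ reshape_offset l s = j.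
Proof.
move=> lt; have := flatten_indexP lt; rewrite sum_l => ltn.
by exists (Ordinal ltn); rewrite /= flatten_indexKl // flatten_indexKr.
Qed.

Lemma card_row (i : nat) : #|[set r : 'I_n | rw r == i]| = nth 0%N l i.
Proof.
pose f (r : 'I_n) : option 'I_(nth 0%N l i) := insub (reshape_offset l r).
have fE r : r \in [set r : 'I_n | rw r == i] ->
    exists2 j : 'I_(nth 0%N l i), val j = reshape_offset l r & f r = Some j.
  rewrite inE => /eqP ri; have lt : (reshape_offset l r < nth 0%N l i)%N by rewrite -ri offset_lt.
  by exists (Ordinal lt) => //; rewrite /f insubT.
have finj : {in [set r : 'I_n | rw r == i] &, injective f}.
  move=> r s rA sA; have [j jr ->] := fE r rA; have [k ks ->] := fE s sA.
  case=> jk; move: rA sA; rewrite !inE => /eqP ri /eqP si.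
  by apply: box_inj; rewrite ?ri ?si // -jr -ks jk.
rewrite -(card_in_imset finj).
have -> : [set f r | r in [set r : 'I_n | rw r == i]] = [set Some j | j : 'I_(nth 0%N l i)].
  apply/setP => o; apply/imsetP/imsetP => [[r rA ->]|[j _ ->]].
    by have [j _ ->] := fE r rA; exists j.
  have [s [sr so]] := exists_box (ltn_ord j); exists s; first by rewrite inE sr.
  have sA : s \in [set r : 'I_n | rw r == i] by rewrite inE sr.
  by have [k ks ->] := fE s sA; congr Some; apply/val_inj; rewrite ks.
by rewrite card_imset ?card_ord // => j k [].
Qed.

(** Otherwise take the function [chi], nonzero at [y0], and the labels [P] of
    [exists_lowest_label].  The sum of all transpositions acts on [chi] by a scalar on the
    right, expressed by the rows, and by a scalar on the left, expressed by the labels; the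
    two agree as the sum is central.  By [cells_distinct] the row and the label determine the
    position, so [card_fibers_le] bounds the fibers of [P], and the equality of the scalars
    makes the bound for the fibers of the rows sharp.  Then the label of a position is
    smaller than the length of its row, so (row, label) are the coordinates of a box: the
    labels are the columns, after a translation, and [chi] pairs with the polytabloid to a
    positive multiple of one of its values. *)
Lemma hw_orthogonal_eq0 psi : hw_orthogonal psi -> forall y, psi y = 0.
Proof.
move=> hpsi y; apply/eqP; apply: contraT => psi0.
have [P [chi [y0 [hchi chi0 chiP low]]]] := exists_lowest_label hpsi psi0.
have disj r s : rw (y0 r) = rw (y0 s) -> P r = P s -> r = s.
  exact: cells_distinct hchi chiP chi0.
have cardy (s : 'I_n) : #|[set r : 'I_n | rw (y0 r) == rw (y0 s)]| = nth 0%N l (rw (y0 s)).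
  rewrite -card_row -(card_imset _ (@perm_inj _ y0)); apply: eq_card => k; rewrite inE.
  apply/imsetP/eqP => [[r]|kE]; first by rewrite inE => /eqP ? ->.
  by exists (y0^-1%g k); rewrite ?inE permKV ?kE.
have Plt s : (P s < nth 0%N l (rw (y0 s)))%N.
  rewrite -cardy; apply: (card_fibers_eq (u := fun r => rw (y0 r)) (v := fun r => P r)).
    by move=> r s' er ep; apply: disj => //; apply/val_inj.
  have bound : (\sum_s #|[set r | P r == P s]| <= n + 2 * \sum_s rw (y0 s))%N.
    apply: (card_fibers_le (u := fun r => val (P r)) (v := fun r => rw (y0 r))).
    by move=> r s' ep er; apply: disj => //; apply/val_inj.
  have cas := antisymmetric_on_casimir chiP (fun s i => low s i y0).
  have : \sum_r \sum_s chi (tperm r s * y0)%g = \sum_r \sum_s chi (y0 * tperm r s)%g.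
    rewrite (reindex_inj (@perm_inj _ y0^-1%g)) /=; apply: eq_bigr => r _.
    rewrite (reindex_inj (@perm_inj _ y0^-1%g)) /=; apply: eq_bigr => s' _.
    by rewrite -tpermJ conjgE invgK -!mulgA mulVg mulg1.
  rewrite cas (hw_orthogonal_casimir _ hchi) -!mulrBl => /(mulIf chi0)/eqP.
  rewrite subr_eq addrAC eq_sym subr_eq -!natrD eqr_nat; move: bound.
  have -> : (\sum_s rw (y0 s) = \sum_(s : 'I_n) rw s)%N.
    by rewrite [RHS](reindex_inj (@perm_inj _ y0)).
  have -> : (\sum_s #|[set r | rw (y0 r) == rw (y0 s)]| =
      \sum_(s : 'I_n) #|[set r : 'I_n | rw r == rw s]|)%N.
    rewrite [RHS](reindex_inj (@perm_inj _ y0)) /=; apply: eq_bigr => s' _.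
    by rewrite cardy card_row.
  have arith (A B C D m : nat) :
      (A <= m + 2 * D -> B + A = 2 * (m + C) + 2 * D -> m + 2 * C <= B)%N by lia.
  by move=> bound /eqP; apply: arith bound.
(* the box in the row [rw (y0 s)] and the column [P s] *)
pose f s : 'I_n := cast_ord sum_l (Ordinal (flatten_indexP (Plt s))).
have rwf s : rw (f s) = rw (y0 s) by rewrite /= flatten_indexKl.
have offf s : reshape_offset l (f s) = P s by rewrite /= flatten_indexKr.
have finj : injective f.
  move=> r s frs; apply: disj; first by rewrite -!rwf frs.
  by apply/val_inj; rewrite /= -!offf frs.
pose y1 : 'S_n := perm finj.
have chi1 : chi y1 != 0.
  have := hchi => -[[H1 _] _]; rewrite -[y1](mulKVg y0) H1 //.
  by apply/row_stabP => k; rewrite permM permE rwf permKV.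
have [_ /(_ y1^-1%g)] := hchi.
under eq_bigr do rewrite /polytabloid /word_polytabloid mulr_sumr.
rewrite exchange_big /=.
rewrite (eq_bigr (fun q : 'S_n => \sum_(y : 'S_n) chi y1 *
    [forall k, rw ((y1^-1 * y)%g k) == rw (q k)]%:R)) => [|q /col_stabP qC]; last first.
  apply: eq_bigr => z _; case: forallP => [H|_]; last by rewrite !mulr0.
  rewrite !mulr1.
  have -> : z = (y1 * q * (q^-1 * (y1^-1 * z)))%g by rewrite !mulgA mulgK mulgV mul1g.
  have [[H1 _] _] := hchi; rewrite H1; last first.
    by apply/row_stabP => k; rewrite permM (eqP (H _)) permKV.
  (* a column permutation seen from the positions preserves the labels *)
  have -> : (y1 * q)%g = ((y1 * q * y1^-1) * y1)%g by rewrite mulgKV.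
  rewrite (antisymmetric_on_perm chiP).
    by rewrite !odd_permM odd_permV addbAC addbb mulrAC -expr2 sqrr_sign mul1r.
  move=> k; apply/val_inj; rewrite /= -!offf !permM.
  by rewrite -[f _](permE finj) permKV qC permE.
under eq_bigr do rewrite -mulr_sumr; rewrite -mulr_sumr => /eqP.
rewrite mulf_eq0 (negPf chi1) /=.
under eq_bigr do rewrite -natr_sum.
rewrite -natr_sum pnatr_eq0 => /eqP Z; exfalso; move: Z; apply/eqP.
(* the identity column permutation contributes at [y1] *)
rewrite -lt0n (bigD1 1%g) /=; last by apply/col_stabP => k; rewrite perm1.
rewrite (bigD1 y1) //= mulVg.
by have -> : [forall k, rw ((1 : 'S_n)%g k) == rw ((1 : 'S_n)%g k)] by apply/forallP.
Qed.

Lemma highest_weight_pairing psi y : highest_weight psi -> psi y != 0 ->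
  exists x, \sum_z psi z * polytabloid l (x * z)%g != 0.
Proof.
move=> hpsi; apply: contra_neqP => /forallNP N; apply: hw_orthogonal_eq0.
by split=> // x; apply/eqP; apply: contra_notT (N x).
Qed.

End PolytabloidDuality.

(** * Raising operators on polynomials *)

Section Derivations.
Variable K : numFieldType.
Variables (N : nat) (S : comNzRingType).
Local Notation R := (mpoly N K).
Implicit Types (ev d : R -> S).

Definition der_along ev d :=
  [/\ forall p q, d (p + q) = d p + d q,
      forall p q, d (p * q) = d p * ev q + ev p * d q &
      forall c, d (mpolyC N c) = 0].

Lemma mpoly_gen_ind (P : R -> Prop) : (forall c, P (mpolyC N c)) ->
  (forall v, P (mpolyX K (mnm1 v))) -> (forall p q, P p -> P q -> P (p + q)) ->
  (forall p q, P p -> P q -> P (p * q)) -> forall p, P p.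
Proof.
move=> PC PX PD PM; apply: mpolyind => [|c m p _ _ Pp]; first by rewrite -[0](mpolyC0 N); apply: PC.
apply: (PD) => //; rewrite -mul_mpolyC; apply: (PM); first exact: PC.
rewrite mpolyXE_id; have P1 : P 1 by rewrite -mpolyC1.
apply: (@big_ind _ P) => [//||v _]; first exact: PM.
by elim: (m v) => [|k IH]; rewrite ?expr0 // exprS; apply: (PM).
Qed.

(** Identities between derivations, in particular the commutation rules of the raising
    operators, need to be checked on variables only. *)
Lemma der_along_eq ev d1 d2 : der_along ev d1 -> der_along ev d2 ->
  (forall v, d1 (mpolyX K (mnm1 v)) = d2 (mpolyX K (mnm1 v))) -> d1 =1 d2.
Proof.
move=> [D1 M1 C1] [D2 M2 C2] X12; apply: mpoly_gen_ind => [c|v|p q Pp Pq|p q Pp Pq].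
- by rewrite C1 C2.
- exact: X12.
- by rewrite D1 D2 Pp Pq.
- by rewrite M1 M2 Pp Pq.
Qed.

End Derivations.

Section Derivation.
Variable K : numFieldType.
Variables (N : nat).
Local Notation R := (mpoly N K).
Variable d : R -> R.
Hypothesis der_d : der_along id d.

Lemma der0 : d 0 = 0.
Proof. by rewrite -(mpolyC0 N); case: der_d. Qed.

Lemma derZ c p : d (c *: p) = c *: d p.
Proof. by case: der_d => _ M C; rewrite -!mul_mpolyC M C mul0r add0r. Qed.

Lemma der_nat k : d k%:R = 0.
Proof. by case: der_d => _ _ C; rewrite -mpolyC_nat C. Qed.

Lemma der_sum (I : Type) (r : seq I) (P : pred I) (F : I -> R) :
  d (\sum_(i <- r | P i) F i) = \sum_(i <- r | P i) d (F i).
Proof. by case: der_d => D _ _; apply: (big_morph d D der0). Qed.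

Lemma derB p q : d (p - q) = d p - d q.
Proof. by case: der_d => D _ _; rewrite D -scaleN1r derZ scaleN1r. Qed.

Lemma der_prod (I : finType) (F : I -> R) :
  d (\prod_i F i) = \sum_t \prod_i (if i == t then d (F i) else F i).
Proof.
have gen (r : seq I) : uniq r ->
    d (\prod_(i <- r) F i) = \sum_(t <- r) \prod_(i <- r) (if i == t then d (F i) else F i).
  elim: r => [|x r IH] /=; first by rewrite !big_nil -mpolyC1 => _; case: der_d.
  case/andP=> xr ur; case: der_d => _ M _; rewrite !big_cons M IH // eqxx; congr (_ * _ + _).
    by rewrite !big_seq; apply: eq_bigr => i ir; case: eqP => // E; rewrite -E ir in xr.
  rewrite mulr_sumr !big_seq; apply: eq_bigr => t tr; rewrite big_cons.
  by case: eqP => // E; rewrite E tr in xr.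
exact: gen (index_enum_uniq I).
Qed.

End Derivation.

(** One of the three indices of the variables [X_ijt], as seen from a flat numbering of the
    variables: an index that can be read and replaced, the rest of the variable being
    unchanged. *)
Record slot (N m : nat) := Slot {
  letter : 'I_N -> 'I_m;
  put : 'I_N -> 'I_m -> 'I_N;
  letter_put : forall v k, letter (put v k) = k;
  put_letter : forall v, put v (letter v) = v;
  put_put : forall v k l, put (put v k) l = put v l
}.

Section Raise.
Variable K : numFieldType.
Variables (N m : nat) (s : slot N m).
Local Notation R := (mpoly N K).
Local Notation x v := (mpolyX K (mnm1 v)).

(** The action of the matrix unit [E_kl]. *)
Definition raise (k l : 'I_m) (p : R) : R :=
  \sum_(v | letter s v == l) x (put s v k) * mderiv v p.

Lemma raise_der k l : der_along id (raise k l).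
Proof.
split=> [p q|p q|c]; rewrite /raise.
- by rewrite -big_split; apply: eq_bigr => v _; rewrite mderivD mulrDr.
- rewrite mulr_suml mulr_sumr -big_split; apply: eq_bigr => v _ /=.
  by rewrite mderivM mulrDr; ring.
by rewrite big1 // => v _; rewrite mderivC mulr0.
Qed.

Lemma mderiv_x (u v : 'I_N) : mderiv u (x v) = (u == v)%:R.
Proof.
rewrite mderivX mnm1E eq_sym; case: eqP => [->|_]; last by rewrite scale0r.
rewrite (_ : mnm_sub _ _ = @mnm0 N) ?mpolyX0 ?scale1r //.
by apply/mnmP => w; rewrite mnmBE subnn mnm0E.
Qed.

Lemma raise_x k l v : raise k l (x v) = if letter s v == l then x (put s v k) else 0.
Proof.
rewrite /raise big_mkcond (bigD1 v) //= mderiv_x eqxx mulr1 big1 ?addr0 // => u uv.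
by rewrite mderiv_x (negPf uv) mulr0; case: ifP.
Qed.

(** For [k = l] the equation says that [f] has weight [wt], as [raise k k] counts the letters
    [k] of a monomial; for [k < l] it says that raising operators kill [f]. *)
Definition hw (wt : 'I_m -> nat) (f : R) := forall k l : 'I_m, (k <= l)%N ->
  raise k l f = ((k == l) * wt k)%:R * f.

Lemma hwM wt1 wt2 f g : hw wt1 f -> hw wt2 g -> hw (fun k => wt1 k + wt2 k)%N (f * g).
Proof.
move=> hf hg k l kl; have [_ M _] := raise_der k l.
by rewrite M hf // hg // mulnDr natrD; ring.
Qed.

Lemma hw1 : hw (fun=> 0%N) 1.
Proof. by move=> k l _; rewrite muln0 mul0r -mpolyC1; case: (raise_der k l). Qed.

Lemma hw_prod (I : Type) (r : seq I) (P : pred I) (wt : I -> 'I_m -> nat) (F : I -> R) :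
  (forall i, P i -> hw (wt i) (F i)) ->
  hw (fun k => \sum_(i <- r | P i) wt i k)%N (\prod_(i <- r | P i) F i).
Proof.
move=> HF; elim: r => [|i r IH].
  by move=> k l kl; rewrite !big_nil hw1.
move=> k l kl; rewrite !big_cons; case: ifP => Pi; last exact: IH.
exact: hwM (HF i Pi) IH k l kl.
Qed.

Variable n : nat.
Implicit Types (w : 'I_n -> 'I_N) (ts : seq 'I_n).

(* Only the positions in [ts] are differentiated, which allows induction on [ts]. *)
Definition word_deriv ts w (f : R) := foldr (@mderiv N K) f (map w ts).

Definition subst_letter w (t : 'I_n) (l : 'I_m) : 'I_n -> 'I_N :=
  fun r => if r == t then put s (w t) l else w r.

Lemma mderiv_raise v k l f : mderiv v (raise k l f) =
  raise k l (mderiv v f) + (letter s v == k)%:R * mderiv (put s v l) f.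
Proof.
rewrite /raise linear_sum /=.
rewrite (eq_bigr (fun u => x (put s u k) * mderiv u (mderiv v f)
   + (v == put s u k)%:R * mderiv u f)) => [|u _]; last first.
  by rewrite mderivM mderiv_x addrC mderiv_comm.
rewrite big_split /=; congr (_ + _).
case: eqP => [vk|nvk]; last first.
  rewrite mul0r big1 // => u _; case: eqP => [E|]; last by rewrite mul0r.
  by case: nvk; rewrite E letter_put.
rewrite (bigD1 (put s v l)) ?letter_put //= put_put -vk put_letter eqxx big1 ?addr0 //.
move=> u /andP[/eqP ul une]; case: eqP => [E|]; last by rewrite mul0r.
by rewrite E put_put -ul put_letter eqxx in une.
Qed.

(** The derivative along [v] commutes with [raise k l] up to the derivative along the variable
    obtained from [v] by the letter [l], if [v] has the letter [k]. *)
Lemma word_deriv_raise ts w k l f : uniq ts ->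
  word_deriv ts w (raise k l f) = raise k l (word_deriv ts w f)
    + \sum_(t <- ts | letter s (w t) == k) word_deriv ts (subst_letter w t l) f.
Proof.
rewrite /word_deriv; elim: ts => [|t ts IH] /=; first by rewrite big_nil addr0.
case/andP=> tts uts; rewrite IH // linearD /= mderiv_raise -addrA; congr (_ + _).
rewrite linear_sum big_cons /=.
have same r : r \in ts -> r != t by move=> rts; apply: contraNneq tts => <-.
have -> : \sum_(i <- ts | letter s (w i) == k)
     mderiv (subst_letter w i l t) (foldr (@mderiv N K) f (map (subst_letter w i l) ts))
  = \sum_(i <- ts | letter s (w i) == k)
     mderiv (w t) (foldr (@mderiv N K) f (map (subst_letter w i l) ts)).
  rewrite big_seq_cond [RHS]big_seq_cond; apply: eq_bigr => r /andP[rts _].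
  by rewrite /subst_letter eq_sym (negPf (same r rts)).
case: eqP => _; last by rewrite mul0r add0r.
rewrite mul1r; congr (_ + _); rewrite /subst_letter eqxx; congr (mderiv _ (foldr _ _ _)).
by apply/eq_in_map => r rts; rewrite (negPf (same r rts)).
Qed.

(** The coefficients of the full polarization of the part of degree [n] of [f]. *)
Definition polar f w := mcoeff (@mnm0 N) (word_deriv (enum 'I_n) w f).

Lemma mcoeff0_raise k l f : mcoeff (@mnm0 N) (raise k l f) = 0.
Proof.
rewrite /raise linear_sum big1 //= => v _.
rewrite (rmorphM (mcoeff (@mnm0 N))) /= mcoeffX.
by case: eqP => [/mnmP/(_ (put s v k))|]; rewrite ?mul0r // mnm1E eqxx mnm0E.
Qed.

Lemma polar_raise f w k l :
  polar (raise k l f) w = \sum_(t | letter s (w t) == k) polar f (subst_letter w t l).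
Proof.
rewrite /polar word_deriv_raise ?enum_uniq // linearD /= mcoeff0_raise add0r linear_sum /=.
by rewrite big_enum_cond.
Qed.

End Raise.
Arguments raise_der {K N m} s k l.
Arguments hw1 {K N m} s.

(** * Words and polytabloids *)

Section Contents.
Variables (n : nat) (l : seq nat).
Hypothesis sum_l : sumn l = n.
Local Notation rw := (reshape_index l).

Lemma content_perm (v : 'I_n -> nat) :
  (forall i, #|[set t | v t == i]| = nth 0%N l i) ->
  exists y : 'S_n, forall t, rw (y t) = v t.
Proof.
move=> cont.
pose V := [tuple v t | t < n]; pose W := [tuple rw t | t < n].
have : perm_eq V W.
  apply/allP => i _ /=; apply/eqP.
  have cnt (u : 'I_n -> nat) : count_mem i [tuple u t | t < n] = #|[set t | u t == i]|.
    rewrite -sum1_count big_map -sum1_card big_enum_cond /=.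
    by apply: eq_bigl => t; rewrite inE.
  by rewrite !cnt cont (card_row sum_l).
move=> /tuple_permP[p E]; exists p => t.
have := congr1 (fun s => nth 0%N s t) E.
rewrite -!(tnth_nth 0%N V) -(tnth_nth 0%N [tuple _ | _ < n]) !tnth_mktuple.
by move=> ->.
Qed.

Lemma polytabloid_content (v : 'I_n -> nat) : word_polytabloid l v != 0 ->
  forall i, #|[set t | v t == i]| = nth 0%N l i.
Proof.
move=> nz i.
have [q vq] : exists q : 'S_n, forall k, v k = rw (q k).
  apply: contra_neqP nz => N; rewrite /word_polytabloid big1 // => q _.
  case: forallP => [H|_]; last by rewrite mulr0.
  by case: N; exists q => k; apply/eqP.
rewrite -(card_row sum_l) -(card_imset [set t | v t == i] (@perm_inj _ q)); apply: eq_card => k.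
rewrite inE; apply/imsetP/eqP => [[t]|ki]; first by rewrite inE vq => /eqP ? ->.
by exists (q^-1%g k); rewrite ?inE ?vq permKV // ki.
Qed.

(** For [i < j], a term belongs to a column permutation and a box [s0] of the row [j] whose
    letter has been raised to [i].  The box [s1] in the row [i] and in the column of [s0] then
    carries the same letter, so the exchange of [s0] and [s1] pairs off terms of opposite
    signs.  For [i = j] the words are unchanged, and they are counted by the content. *)
Lemma polytabloid_raise (v : 'I_n -> nat) (i j : nat) : is_partition l -> (i <= j)%N ->
  \sum_(t | v t == i) word_polytabloid l (fun r => if r == t then j else v r) =
  ((i == j) * nth 0%N l i)%:R * word_polytabloid l v.
Proof.
move=> /andP[sorted_l _]; rewrite leq_eqVlt => /orP[/eqP <-|ij].
  rewrite eqxx mul1n.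
  rewrite (eq_bigr (fun=> word_polytabloid l v)) => [|t /eqP ti]; last first.
    by congr word_polytabloid; apply/funext => r; case: eqP => [->|].
  rewrite sumr_const -[LHS]mulr_natl.
  have [->|nz] := eqVneq (word_polytabloid l v) 0; first by rewrite !mulr0.
  congr (_%:R * _); rewrite -(polytabloid_content nz i).
  by apply: eq_card => t; rewrite !inE.
rewrite (ltn_eqF ij) mul0n mul0r /word_polytabloid exchange_big /=.
(* indexing the terms by the box [s0 = q t] makes the condition depend on [q] only through
   the letters carried by the boxes *)
pose b (s0 : 'I_n) (q : 'S_n) : bool := (rw s0 == j) &&
  [forall k, v k == if q k == s0 then i else rw (q k)].
rewrite (eq_bigr (fun q : 'S_n => \sum_s0 (-1) ^+ odd_perm q * (b s0 q)%:R)) => [|q _]; last first.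
  rewrite [RHS](reindex_inj (@perm_inj _ q)) big_mkcond; apply: eq_bigr => t _ /=.
  transitivity ((-1) ^+ odd_perm q * ((v t == i) &&
    [forall k, (if k == t then j else v k) == rw (q k)])%:R : algC).
    by case: (v t == i); rewrite ?mulr0.
  congr (_ * (nat_of_bool _)%:R); apply/idP/idP.
    case/andP=> /eqP vt /forallP H; apply/andP; split.
      by have := H t; rewrite eqxx eq_sym.
    apply/forallP => k; have := H k; rewrite (inj_eq perm_inj).
    by case: (k =P t) => [->|]; rewrite ?vt.
  case/andP=> rj /forallP H; apply/andP; split.
    by have := H t; rewrite eqxx.
  apply/forallP => k; have := H k; rewrite (inj_eq perm_inj).
  by case: (k =P t) => [-> _|_ /eqP->]; rewrite // eq_sym.
rewrite exchange_big big1 //= => s0 _.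
have [rj|nrj] := eqVneq (rw s0) j; last by rewrite big1 // => q _; rewrite /b (negPf nrj) mulr0.
(* the row [i] is at least as long as the row [j] *)
have lt1 : (reshape_offset l s0 < nth 0%N l i)%N.
  apply: leq_trans (offset_lt sum_l s0) _; rewrite rj.
  have [jl|jl] := ltnP j (size l); last by rewrite nth_default.
  apply: (sorted_leq_nth (leT := geq)) => //.
  - by move=> x y z; rewrite /geq /= => ? ?; lia.
  - by move=> x; rewrite /geq /=.
  - by rewrite inE (ltn_trans ij jl).
  - exact: ltnW.
have [s1 [s1i s1o]] := exists_box sum_l lt1.
have s01 : s0 != s1 by apply: contraTneq ij => E; rewrite -s1i -rj E ltnn.
set tau := tperm s0 s1.
have tauC : tau \in col_stab n l.
  by apply/col_stabP => k; rewrite /tau; case: tpermP => [->|->|].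
set X := \sum_(q in _) _.
suff : X = - X by move/eqP; rewrite -subr_eq0 opprK -mulr2n -mulr_natl mulf_eq0 pnatr_eq0 /= => /eqP.
rewrite -sumrN {1}/X (reindex_inj (mulIg tau)) /=; apply: eq_big => [q|q _].
  apply/idP/idP => H; last by rewrite col_stabM.
  by rewrite -[q]mulg1 -(tperm2 s0 s1) mulgA (col_stabM _ H).
rewrite odd_permM odd_tperm s01 addbT signrN mulNr; congr (- (_ * _%:R)).
rewrite /b rj eqxx /=; congr nat_of_bool; apply: eq_forallb => k.
congr (_ == _); rewrite permM /tau; case: tpermP => [->|->|/eqP n0 /eqP n1].
- by rewrite eqxx eq_sym (negPf s01) s1i.
- by rewrite !eqxx eq_sym (negPf s01) s1i.
by rewrite (negPf n0).
Qed.

End Contents.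

(** * Kronecker coefficients and highest weight polynomials *)

Section Polar.
Variables (N m n : nat) (s : slot N m).
Local Notation R := (mpoly N algC).

Lemma polarZ (c : nat) (f : R) (w : 'I_n -> 'I_N) : polar (c%:R * f) w = c%:R * polar f w.
Proof.
rewrite !mulr_natl /polar /word_deriv; elim: (enum 'I_n) f => [|t ts IH] f /=.
  by rewrite raddfMn.
have E : foldr (@mderiv N algC) (f *+ c) (map w ts) = foldr (@mderiv N algC) f (map w ts) *+ c.
  by elim: ts {IH} => //= t' ts' ->; rewrite raddfMn.
by rewrite E !raddfMn.
Qed.

Lemma polar_perm (f : R) (w : 'I_n -> 'I_N) (g : 'S_n) : polar f (w \o g) = polar f w.
Proof.
rewrite /polar /word_deriv; congr (mcoeff _ _); apply: mderiv_perm.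
rewrite map_comp; apply: perm_map; apply: uniq_perm; rewrite ?enum_uniq //.
  by rewrite map_inj_uniq ?enum_uniq //; apply: perm_inj.
move=> t; rewrite mem_enum; apply/mapP; exists (g^-1%g t); rewrite ?mem_enum //.
by rewrite permKV.
Qed.

Lemma polar_letter_count wt (f : R) (w : 'I_n -> 'I_N) k : hw s wt f -> polar f w != 0 ->
  #|[set t | letter s (w t) == k]| = wt k.
Proof.
move=> hf nz; have := congr1 (fun p => polar p w) (hf k k (leqnn k)).
rewrite polar_raise polarZ eqxx mul1n (eq_bigr (fun=> polar f w)) => [|t /eqP tk].
  rewrite sumr_const -[in LHS]mulr_natl => /(mulIf nz)/eqP; rewrite eqr_nat => /eqP <-.
  by apply: eq_card => t; rewrite !inE.
congr polar; apply/funext => r; rewrite /subst_letter.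
by case: eqP => // ->; rewrite -tk put_letter.
Qed.

Variable l : seq nat.
Hypotheses (sum_l : sumn l = n) (size_l : (size l <= m)%N).

Lemma row_lt (t : 'I_n) : (reshape_index l t < m)%N.
Proof. by apply: leq_trans size_l; apply: reshape_indexP; rewrite sum_l. Qed.

Definition row_ord (t : 'I_n) : 'I_m := Ordinal (row_lt t).

(** The words keep the other two indices of [w0], and their letters in the slot are the rows of
    the boxes [y t].  Raising from [row_ord s0] to [i] gives the defining equation of highest
    weight functions, by [polar_raise] at the word whose letter at [y^-1 s0] is [i]. *)
Lemma polar_highest_weight wt (f : R) (w0 : 'I_n -> 'I_N) : hw s wt f ->
  highest_weight l (fun y => polar f (fun t => put s (w0 t) (row_ord (y t)))).
Proof.
move=> hf; split=> [y p /row_stabP pR|y s0 i lt].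
  congr polar; apply/funext => t; congr put; apply/val_inj => /=.
  by rewrite permM pR.
pose k : 'I_m := Ordinal (ltn_trans lt (row_lt s0)).
pose w t := put s (w0 t) (row_ord (y t)).
pose t0 := y^-1%g s0.
have yt0 : y t0 = s0 by rewrite permKV.
have := hf k (row_ord s0) (ltnW lt).
have -> : (k == row_ord s0) = false by rewrite -val_eqE /= (ltn_eqF lt).
move=> /(congr1 (fun p => polar p (subst_letter s w t0 k))).
rewrite polar_raise polarZ mul0n mul0r => E; rewrite -[RHS]E.
rewrite [RHS](bigD1 t0) /=; last by rewrite /subst_letter eqxx letter_put.
congr (_ + _).
  congr polar; apply/funext => t; rewrite /subst_letter.
  by case: eqP => [->|//]; rewrite eqxx put_put /w put_put yt0.
rewrite (reindex_inj (@perm_inj _ y)) /=; apply: eq_big => t.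
  rewrite /subst_letter; have [->|tt0] := eqVneq t t0.
    by rewrite yt0 andbF gtn_eqF.
  by rewrite andbT /w letter_put -val_eqE.
move=> /eqP ti; congr polar; apply/funext => r; rewrite /subst_letter permM.
have ts0 : t != t0.
  by apply/eqP => tt0; have := lt; rewrite -ti tt0 yt0 ltnn.
have yts0 : y t != s0 by rewrite -yt0 (inj_eq perm_inj).
have [->|rt] := eqVneq r t.
  by rewrite (negPf ts0) tpermL /w put_put.
have [->|rt0] := eqVneq r t0.
  by rewrite yt0 tpermR /w put_put; congr put; apply/val_inj.
have e1 : y t != y r by rewrite (inj_eq perm_inj) eq_sym.
have e2 : s0 != y r by rewrite -yt0 (inj_eq perm_inj) eq_sym.
by rewrite tpermD.
Qed.

End Polar.

Section Variables3.
Variables a b c : nat.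
Local Notation box := ('I_a * 'I_b * 'I_c)%type.

Definition nvars := #|{: box}|.
Definition var (i : 'I_a) (j : 'I_b) (t : 'I_c) : 'I_nvars := enum_rank (i, j, t).
Definition boxof (v : 'I_nvars) : box := enum_val v.

Lemma boxof_var i j t : boxof (var i j t) = (i, j, t).
Proof. exact: enum_rankK. Qed.

Lemma var_boxof v : var (boxof v).1.1 (boxof v).1.2 (boxof v).2 = v.
Proof. by rewrite /var -!surjective_pairing enum_valK. Qed.

Definition slotA : slot nvars a.
Proof.
exists (fun v => (boxof v).1.1) (fun v k => var k (boxof v).1.2 (boxof v).2).
- by move=> v k; rewrite boxof_var.
- exact: var_boxof.
- by move=> v k l; rewrite boxof_var.
Defined.

Definition slotB : slot nvars b.
Proof.
exists (fun v => (boxof v).1.2) (fun v k => var (boxof v).1.1 k (boxof v).2).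
- by move=> v k; rewrite boxof_var.
- exact: var_boxof.
- by move=> v k l; rewrite boxof_var.
Defined.

Definition slotC : slot nvars c.
Proof.
exists (fun v => (boxof v).2) (fun v k => var (boxof v).1.1 (boxof v).1.2 k).
- by move=> v k; rewrite boxof_var.
- exact: var_boxof.
- by move=> v k l; rewrite boxof_var.
Defined.

End Variables3.

Lemma sumn_nth (a : nat) (l : seq nat) : (size l <= a)%N ->
  sumn l = (\sum_(i < a) nth 0%N l i)%N.
Proof.
move=> la; rewrite sumnE (big_nth 0%N) -(big_mkord xpredT (nth 0%N l)).
rewrite [RHS](big_cat_nat _ la) //= [X in _ = (_ + X)%N]big_nat_cond [X in _ = (_ + X)%N]big1 ?addn0 // => i.
by rewrite andbT => /andP[li _]; rewrite nth_default.
Qed.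

(** The derivative along the word that lists a monomial of [f] with multiplicities has the
    coefficient of that monomial times a product of factorials as constant term. *)
Lemma polar_neq0 (N : nat) (f : mpoly N algC) : f != 0 ->
  exists n (w : 'I_n -> 'I_N), polar f w != 0.
Proof.
move=> f0; have [m0 m0f] : exists m0, mcoeff m0 f != 0.
  apply: contra_neqP f0 => /forallNP N0; apply/mpolyP => m0; rewrite mcoeff0.
  by apply/eqP; apply: contra_notT (N0 m0).
pose S := flatten [seq nseq (m0 i) i | i <- enum 'I_N].
exists (size S), (tnth (in_tuple S)).
rewrite /polar /word_deriv map_tnth_enum /= /S -mderivm_foldr mcoeff_mderivm.
have -> : mnm_add m0 (@mnm0 N) = m0 by apply/mnmP => i; rewrite mnmDE mnm0E addn0.
rewrite -mulr_natl mulf_neq0 // pnatr_eq0 -lt0n prodn_gt0 // => i.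
by rewrite ffactnn fact_gt0.
Qed.

Section HwKronecker.
Variables (a b c : nat) (l m k : seq nat).
Hypotheses (size_l : (size l <= a)%N) (size_m : (size m <= b)%N) (size_k : (size k <= c)%N).

(** Pairing the polarization of [f] with a polytabloid in each of the three indices, by
    [highest_weight_pairing], gives a nonzero number.  The polarization is invariant under
    simultaneous translations of the three permutations, since derivatives commute, so the
    pairing can be averaged over these; a nonzero average makes one of the sums of
    [kroneckerP] nonzero. *)
Lemma hw_kronecker (f : mpoly (nvars a b c) algC) : f != 0 ->
  hw (slotA a b c) (fun i => nth 0%N l i) f ->
  hw (slotB a b c) (fun i => nth 0%N m i) f ->
  hw (slotC a b c) (fun i => nth 0%N k i) f ->
  kronecker l m k != 0%N.
Proof.
move=> f0 hA hB hC; have [n [w0 w0nz]] := polar_neq0 f0.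
have total (p : nat) (q : seq nat) (s : slot (nvars a b c) p) :
    (size q <= p)%N -> hw s (fun i => nth 0%N q i) f ->
    sumn q = n /\ forall i, #|[set t | val (letter s (w0 t)) == i]| = nth 0%N q i.
  move=> qp hs; have cnt := polar_letter_count _ hs w0nz; split.
    rewrite (sumn_nth qp) -[RHS]card_ord -sum1_card (partition_big (fun t => letter s (w0 t)) xpredT) //=.
    by apply: eq_bigr => i _; rewrite -cnt -sum1_card; apply: eq_bigl => t; rewrite inE.
  move=> i; have [ip|pi] := ltnP i p.
    by rewrite -(cnt (Ordinal ip)); apply: eq_card => t; rewrite !inE.
  rewrite nth_default ?(leq_trans qp) //; apply: eq_card0 => t; rewrite !inE.
  by apply: contraTF pi => /eqP <-; rewrite -ltnNge ltn_ord.
have [sl cl] := total _ _ _ size_l hA.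
have [sm cm] := total _ _ _ size_m hB.
have [sk ck] := total _ _ _ size_k hC.
have [y1 y1E] := content_perm sl cl.
have [y2 y2E] := content_perm sm cm.
have [y3 y3E] := content_perm sk ck.
pose phi (z1 z2 z3 : 'S_n) := polar f (fun t => var (row_ord sl size_l (z1 t))
  (row_ord sm size_m (z2 t)) (row_ord sk size_k (z3 t))).
have phi0 : phi y1 y2 y3 != 0.
  rewrite /phi (_ : (fun t => _) = w0) //; apply/funext => t; rewrite -[RHS]var_boxof.
  by congr var; apply/val_inj; rewrite /= ?y1E ?y2E ?y3E.
have phiA z2 z3 : highest_weight l (fun z1 => phi z1 z2 z3).
  have := polar_highest_weight sl size_l (fun t => var (row_ord sl size_l t)
    (row_ord sm size_m (z2 t)) (row_ord sk size_k (z3 t))) hA.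
  by congr highest_weight; apply/funext => z1; congr polar; apply/funext => t; rewrite /= boxof_var.
have phiB z1 z3 : highest_weight m (fun z2 => phi z1 z2 z3).
  have := polar_highest_weight sm size_m (fun t => var (row_ord sl size_l (z1 t))
    (row_ord sm size_m t) (row_ord sk size_k (z3 t))) hB.
  by congr highest_weight; apply/funext => z2; congr polar; apply/funext => t; rewrite /= boxof_var.
have phiC z1 z2 : highest_weight k (fun z3 => phi z1 z2 z3).
  have := polar_highest_weight sk size_k (fun t => var (row_ord sl size_l (z1 t))
    (row_ord sm size_m (z2 t)) (row_ord sk size_k t)) hC.
  by congr highest_weight; apply/funext => z3; congr polar; apply/funext => t; rewrite /= boxof_var.
have phi_inv g z1 z2 z3 : phi (g * z1)%g (g * z2)%g (g * z3)%g = phi z1 z2 z3.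
  rewrite /phi -[RHS](polar_perm _ _ g); congr polar; apply/funext => t /=.
  by rewrite !permM.
have [x1 nz1] := highest_weight_pairing sl (phiA y2 y3) phi0.
pose phi1 z2 z3 := \sum_z1 polytabloid l (x1 * z1)%g * phi z1 z2 z3.
have nz1' : phi1 y2 y3 != 0.
  by rewrite /phi1; under eq_bigr do rewrite mulrC.
have [x2 nz2] := highest_weight_pairing sm (highest_weight_sum _ (fun z1 _ => phiB z1 y3)) nz1'.
pose phi2 z3 := \sum_(z : 'S_n * 'S_n)
  (polytabloid l (x1 * z.1)%g * polytabloid m (x2 * z.2)%g) * phi z.1 z.2 z3.
have nz2' : phi2 y3 != 0.
  rewrite /phi2 -(pair_bigA _ (fun z1 z2 =>
    (polytabloid l (x1 * z1)%g * polytabloid m (x2 * z2)%g) * phi z1 z2 y3)) /=.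
  rewrite exchange_big /=; move: nz2; congr (_ != 0); apply: eq_bigr => z2 _.
  by rewrite mulr_suml; apply: eq_bigr => z1 _; rewrite mulrAC.
have [x3 nz3] := highest_weight_pairing sk (highest_weight_sum _ (fun z _ => phiC z.1 z.2)) nz2'.
apply/(kroneckerP sl sm sk).
apply: contrapT => N.
have Z (z1 z2 z3 : 'S_n) : \sum_(g in [set: 'S_n]%G) polytabloid l (x1 * g * z1)%g *
    polytabloid m (x2 * g * z2)%g * polytabloid k (x3 * g * z3)%g = 0.
  apply/eqP; apply: contra_notT N => nz.
  by exists x1, x2, x3, z1, z2, z3.
pose tot := \sum_(z : 'S_n * 'S_n * 'S_n) phi z.1.1 z.1.2 z.2 *
  (polytabloid l (x1 * z.1.1)%g * polytabloid m (x2 * z.1.2)%g * polytabloid k (x3 * z.2)%g).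
have tot_nz : tot != 0.
  rewrite /tot -(pair_bigA _ (fun z z3 => phi z.1 z.2 z3 *
    (polytabloid l (x1 * z.1)%g * polytabloid m (x2 * z.2)%g * polytabloid k (x3 * z3)%g))) /=.
  rewrite exchange_big /=; move: nz3; congr (_ != 0); apply: eq_bigr => z3 _.
  by rewrite mulr_suml; apply: eq_bigr => z _; ring.
have totg (g : 'S_n) : tot = \sum_(z : 'S_n * 'S_n * 'S_n) phi z.1.1 z.1.2 z.2 *
  (polytabloid l (x1 * g * z.1.1)%g * polytabloid m (x2 * g * z.1.2)%g * polytabloid k (x3 * g * z.2)%g).
  pose mv (z : 'S_n * 'S_n * 'S_n) := ((g * z.1.1)%g, (g * z.1.2)%g, (g * z.2)%g).
  have mv_inj : injective mv by move=> [[u1 u2] u3] [[v1 v2] v3] [] /mulgI-> /mulgI-> /mulgI->.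
  by rewrite /tot (reindex_inj mv_inj); apply: eq_bigr => z _ /=; rewrite phi_inv !mulgA.
have : \sum_(g in [set: 'S_n]%G) tot = 0.
  rewrite (eq_bigr _ (fun g _ => totg g)) exchange_big big1 //= => z _.
  by rewrite -mulr_sumr Z mulr0.
rewrite sumr_const -mulr_natl => /eqP; rewrite mulf_eq0 (negPf tot_nz) orbF pnatr_eq0.
by rewrite eqn0Ngt cardG_gt0.
Qed.

End HwKronecker.

Section WordPoly.
Variables (K : numFieldType) (n : nat).

(** The symmetrization of a tensor with coefficients [Phi]. *)
Definition word_poly (N : nat) (Phi : ('I_n -> 'I_N) -> K) : mpoly N K :=
  \sum_(w : {ffun 'I_n -> 'I_N}) Phi w *: \prod_t mpolyX K (mnm1 (w t)).

(** Replacing a letter [j] by [i] at a position of a word and replacing it back are inverse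
    bijections between the words with [j] and those with [i] at that position. *)
Lemma raise_word_poly (N p : nat) (s : slot N p) Phi i j :
  raise s i j (word_poly Phi) =
  word_poly (fun w => \sum_(t | letter s (w t) == i) Phi (subst_letter s w t j)).
Proof.
pose x (v : 'I_N) := mpolyX K (mnm1 v).
have der : der_along id (@raise K _ _ s i j) := raise_der s i j.
pose sub q (w : {ffun 'I_n -> 'I_N}) t := [ffun r => subst_letter s w t q r].
have subE q (w : {ffun 'I_n -> 'I_N}) t : sub q w t = subst_letter s w t q :> (_ -> _).
  by apply/funext => r; rewrite ffunE.
rewrite /word_poly (der_sum der).
transitivity (\sum_(t : 'I_n) \sum_(w : {ffun 'I_n -> 'I_N} | letter s (w t) == j)
    Phi w *: \prod_r x (sub i w t r)).
  rewrite [RHS](exchange_big_dep xpredT) //=; apply: eq_bigr => w _.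
  rewrite (derZ der) (der_prod der) scaler_sumr [RHS]big_mkcond; apply: eq_bigr => t _ /=.
  case: ifP => tj.
    congr (_ *: _); apply: eq_bigr => r _; rewrite /sub ffunE /subst_letter.
    by case: eqP => // ->; rewrite raise_x tj.
  by rewrite (bigD1 t) //= eqxx raise_x tj mul0r scaler0.
transitivity (\sum_(t : 'I_n) \sum_(w : {ffun 'I_n -> 'I_N} | letter s (w t) == i)
    Phi (sub j w t) *: \prod_r x (w r)).
  apply: eq_bigr => t _.
  rewrite (reindex_onto (sub j ^~ t) (sub i ^~ t)) /=.
    apply: eq_big => w.
      rewrite subE /subst_letter eqxx letter_put eqxx /=; apply/eqP/eqP => [<-|wi].
        by rewrite ffunE /subst_letter eqxx letter_put.
      apply/ffunP => r; rewrite ffunE /subst_letter !ffunE /subst_letter.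
      by case: (r =P t) => // ->; rewrite eqxx put_put -wi put_letter.
    move=> /andP[_ /eqP E]; congr (_ *: _); apply: eq_bigr => r _.
    by rewrite [sub i (sub j w t) t]E.
  move=> w /eqP wj; apply/ffunP => r; rewrite ffunE /subst_letter !ffunE /subst_letter.
  by case: (r =P t) => // ->; rewrite eqxx put_put -wj put_letter.
rewrite (exchange_big_dep xpredT) //=; apply: eq_bigr => w _.
rewrite scaler_suml; apply: eq_bigr => t _; congr (Phi _ *: _).
by rewrite subE.
Qed.

(** Two words give the same monomial if and only if they differ by a permutation of the
    positions, so the symmetry of [Phi] prevents cancellation. *)
Lemma word_poly_neq0 (N : nat) (Phi : ('I_n -> 'I_N) -> K) w0 :
  (forall w (g : 'S_n), Phi (w \o g) = Phi w) -> Phi w0 != 0 -> word_poly Phi != 0.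
Proof.
move=> inv nz.
pose mon (w : 'I_n -> 'I_N) := \big[@mnm_add N/@mnm0 N]_(t : 'I_n) mnm1 (w t).
have monE (w : {ffun 'I_n -> 'I_N}) : \prod_t mpolyX K (mnm1 (w t)) = mpolyX K (mon w).
  by rewrite mprodXE.
have mon_count w v : mon w v = #|[set t | w t == v]|.
  rewrite mnm_sumE -sum1_card [RHS]big_mkcond; apply: eq_bigr => t _.
  by rewrite mnm1E inE; case: eqP.
have same w : mon w = mon w0 -> Phi w = Phi w0.
  move=> E; pose V := [tuple w t | t < n]; pose W := [tuple w0 t | t < n].
  have : perm_eq V W.
    apply/allP => v _ /=; apply/eqP.
    have cnt (u : 'I_n -> 'I_N) : count_mem v [tuple u t | t < n] = mon u v.
      rewrite mon_count -sum1_count big_map -sum1_card big_enum_cond /=.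
      by apply: eq_bigl => t; rewrite inE.
    by rewrite !cnt E.
  move=> /tuple_permP[g Eg]; rewrite -(inv w0 g); congr Phi; apply/funext => t /=.
  have /val_inj /(congr1 (fun u => tnth u t)) := Eg : val V = val [tuple tnth W (g i) | i < n].
  by rewrite !tnth_mktuple.
apply: contraNneq nz => /(congr1 (mcoeff (mon w0))).
rewrite mcoeff0 /word_poly linear_sum /=.
rewrite (eq_bigr (fun w : {ffun 'I_n -> 'I_N} => (mon w == mon w0)%:R * Phi w0)) => [|w _]; last first.
  rewrite monE linearZ /= mcoeffX mulrC; case: eqP => [/same -> //|_]; by rewrite !mul0r.
rewrite -mulr_suml -natr_sum => /eqP; rewrite mulf_eq0 => /orP[|//].
rewrite pnatr_eq0 (bigD1 [ffun t => w0 t]) //=.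
rewrite (_ : ([ffun t => w0 t] : {ffun _}) = w0 :> (_ -> _)) ?eqxx //.
by apply/funext => t; rewrite ffunE.
Qed.

End WordPoly.

Section KroneckerHw.
Variables (a b c : nat) (l m k : seq nat) (n : nat).
Hypotheses (sum_l : sumn l = n) (sum_m : sumn m = n) (sum_k : sumn k = n).
Hypotheses (part_l : is_partition l) (part_m : is_partition m) (part_k : is_partition k).
Hypotheses (size_l : (size l <= a)%N) (size_m : (size m <= b)%N) (size_k : (size k <= c)%N).

(** The products of three polytabloids that [kroneckerP] sums over the group, extended from
    permutations to words, are the coefficients of a tensor invariant under the permutations
    of the positions; each of its terms satisfies the highest weight equations by
    [polytabloid_raise]. *)
Lemma kronecker_hw : kronecker l m k != 0%N ->
  exists2 f : mpoly (nvars a b c) algC, f != 0 &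
  [/\ hw (slotA a b c) (fun i => nth 0%N l i) f,
      hw (slotB a b c) (fun i => nth 0%N m i) f &
      hw (slotC a b c) (fun i => nth 0%N k i) f].
Proof.
move=> /(kroneckerP sum_l sum_m sum_k)[x1 [x2 [x3 [y1 [y2 [y3 nz]]]]]].
pose lA (v : 'I_(nvars a b c)) : nat := letter (slotA a b c) v.
pose lB (v : 'I_(nvars a b c)) : nat := letter (slotB a b c) v.
pose lC (v : 'I_(nvars a b c)) : nat := letter (slotC a b c) v.
pose Phi (w : 'I_n -> 'I_(nvars a b c)) := \sum_(g in [set: 'S_n]%G)
  word_polytabloid l (fun t => lA (w ((x1 * g)%g t))) *
  word_polytabloid m (fun t => lB (w ((x2 * g)%g t))) *
  word_polytabloid k (fun t => lC (w ((x3 * g)%g t))).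
have reidx (q : seq nat) (v : 'I_n -> nat) (h : 'S_n) (i j : nat) : sumn q = n -> is_partition q ->
    (i <= j)%N ->
    \sum_(t | v t == i) word_polytabloid q (fun r => if h r == t then j else v (h r)) =
    ((i == j) * nth 0%N q i)%:R * word_polytabloid q (fun r => v (h r)).
  move=> sq pq ij; rewrite -(polytabloid_raise sq _ pq ij) (reindex_inj (@perm_inj _ h)).
  apply: eq_bigr => t _; congr word_polytabloid; apply/funext => r.
  by rewrite (inj_eq perm_inj).
exists (word_poly Phi).
  pose w0 t := var (row_ord sum_l size_l (y1 t)) (row_ord sum_m size_m (y2 t))
    (row_ord sum_k size_k (y3 t)).
  apply: (word_poly_neq0 (w0 := w0)).
    move=> w h; rewrite /Phi (reindex_inj (mulIg h^-1%g)) /=; apply: eq_big => g; rewrite ?inE // => _.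
    by congr (_ * _ * _); congr word_polytabloid; apply/funext => t; rewrite mulgA permM permKV.
  move: nz; congr (_ != 0); apply: eq_bigr => g _; rewrite /lA /lB /lC.
  by congr (_ * _ * _); congr word_polytabloid; apply/funext => t; rewrite /= boxof_var permM.
have scale (d : nat) (Psi : ('I_n -> 'I_(nvars a b c)) -> algC) :
    d%:R * word_poly Psi = word_poly (fun w => d%:R * Psi w).
  rewrite /word_poly mulr_natl -sumrMnl; apply: eq_bigr => w _.
  by rewrite mulr_natl scalerMnl.
split=> i j ij; rewrite raise_word_poly scale; congr word_poly; apply/funext => w;
  rewrite /Phi exchange_big mulr_sumr; apply: eq_bigr => g _ /=.
- have := reidx l (lA \o w) (x1 * g)%g i j sum_l part_l ij; rewrite -val_eqE /= !mulrA => <-.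
  rewrite !mulr_suml; apply: eq_bigr => t _.
  congr (_ * _ * _); congr word_polytabloid; apply/funext => r; rewrite /lA /lB /lC /subst_letter.
  + by case: eqP => //= _; rewrite boxof_var.
  + by case: eqP => //= ->; rewrite boxof_var.
  by case: eqP => //= ->; rewrite boxof_var.
- have := reidx m (lB \o w) (x2 * g)%g i j sum_m part_m ij; rewrite -val_eqE /= => E.
  have mid (d x y z : algC) : d * (x * y * z) = x * (d * y) * z by ring.
  have sum_mid (P : pred 'I_n) F (x z : algC) : x * (\sum_(t | P t) F t) * z = \sum_(t | P t) x * F t * z.
    by rewrite mulr_sumr mulr_suml.
  rewrite mid -E sum_mid; apply: eq_bigr => t _.
  congr (_ * _ * _); congr word_polytabloid; apply/funext => r; rewrite /lA /lB /lC /subst_letter.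
  + by case: eqP => //= ->; rewrite boxof_var.
  + by case: eqP => //= _; rewrite boxof_var.
  by case: eqP => //= ->; rewrite boxof_var.
have := reidx k (lC \o w) (x3 * g)%g i j sum_k part_k ij; rewrite -val_eqE /= => E.
have last (d x y z : algC) : d * (x * y * z) = x * y * (d * z) by ring.
rewrite last -E big_distrr; apply: eq_bigr => t _ /=.
congr (_ * _ * _); congr word_polytabloid; apply/funext => r; rewrite /lA /lB /lC /subst_letter.
+ by case: eqP => //= ->; rewrite boxof_var.
+ by case: eqP => //= ->; rewrite boxof_var.
by case: eqP => //= _; rewrite boxof_var.
Qed.

End KroneckerHw.

(** * Triangular substitutions in a highest weight polynomial *)

Section Substitution.
Variable K : numFieldType.
Variables (N : nat).
Local Notation R := (mpoly N K).
Local Notation x v := (mpolyX K (mnm1 v)).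

(** Evaluations, and polynomial evaluations composed with them, are identified through the values
    on variables. *)
Lemma mmap_unique (S : comNzRingType) (h : {rmorphism K -> S}) (Y : 'I_N -> S)
    (e : R -> S) :
  (forall c, e (mpolyC N c) = h c) -> (forall v, e (x v) = Y v) ->
  {morph e : p q / p + q} -> {morph e : p q / p * q} -> forall p, e p = mmap h Y p.
Proof.
move=> eC eX eD eM; apply: mpoly_gen_ind => [c|v|p q Ep Eq|p q Ep Eq].
- by rewrite eC mmapC.
- by rewrite eX mmapX mmap1U.
- by rewrite eD rmorphD Ep Eq.
- by rewrite eM rmorphM Ep Eq.
Qed.

Section Weights.
Variables (m : nat) (s : slot N m) (wt : 'I_m -> nat) (f : R).
Hypothesis hf : hw s wt f.

Lemma supp_weight (mon : multinom N) k : mon \in msupp f ->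
  (\sum_(v | letter s v == k) mon v)%N = wt k.
Proof.
move=> mf.
have := congr1 (mcoeff mon) (hf (leqnn k)); rewrite eqxx mul1n.
rewrite {1}[f]mpolyE (der_sum (raise_der s k k)) mulr_natl mcoeffMn.
have rX (u : multinom N) : raise s k k (mpolyX K u) =
    (\sum_(v | letter s v == k) u v)%:R *: mpolyX K u.
  rewrite /raise natr_sum scaler_suml; apply: eq_bigr => v /eqP vk.
  rewrite -vk put_letter mderivX -scalerAr; have [->|uv] := posnP (u v).
    by rewrite !scale0r.
  congr (_ *: _); rewrite -mpolyXD; congr (mpolyX _ _); apply/mnmP => t.
  by rewrite mnmDE mnmBE mnm1E; case: eqP => [<-|_] /=; rewrite ?subn0 // subnKC.
rewrite (eq_bigr (fun u => (mcoeff u f * (\sum_(v | letter s v == k) u v)%:R) *: mpolyX K u));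
  last by move=> u _; rewrite (derZ (raise_der s k k)) rX scalerA.
have cZ cc u : mcoeff mon (cc *: mpolyX K u) = cc * (u == mon)%:R.
  by rewrite mcoeffZ mcoeffX.
rewrite linear_sum (eq_bigr _ (fun u _ => cZ (mcoeff u f * (\sum_(v | letter s v == k) u v)%:R) u)).
rewrite (bigD1_seq mon) ?msupp_uniq //= eqxx mulr1.
rewrite [X in _ + X]big1 ?addr0 => [|u um]; last by rewrite (negPf um) mulr0.
move: mf; rewrite mcoeff_msupp => nz; rewrite -[RHS]mulr_natr => /(mulfI nz)/eqP.
by rewrite eqr_nat => /eqP.
Qed.

Variables (S : comNzRingType) (h : {rmorphism K -> S}).
Implicit Types Y : 'I_N -> S.

Lemma mmap_scale Y k c :
  mmap h (fun v => if letter s v == k then c * Y v else Y v) f = c ^+ wt k * mmap h Y f.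
Proof.
rewrite /mmap mulr_sumr !big_seq; apply: eq_bigr => mon mf.
rewrite mulrCA; congr (_ * _); rewrite /mmap1 -(supp_weight k mf).
rewrite -prodrXr [X in X * _]big_mkcond -big_split; apply: eq_bigr => v _ /=.
by case: ifP => _; rewrite ?mul1r // exprMn.
Qed.

(** As a polynomial in [c], the left side has derivative the value of [raise k l f = 0] at the
    same point, so it is constant in characteristic [0]. *)
Lemma mmap_shear Y (k l : 'I_m) c : (k < l)%N ->
  mmap h (fun v => if letter s v == l then Y v + c * Y (put s v k) else Y v) f = mmap h Y f.
Proof.
move=> kl; have nkl : (k == l) = false by rewrite -val_eqE (ltn_eqF kl).
pose hP : {rmorphism K -> {poly S}} := polyC \o h.
(* [c] is replaced by an indeterminate *)
pose Z v : {poly S} := if letter s v == l then (Y v)%:P + (Y (put s v k))%:P * 'X else (Y v)%:P.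
have der p : (mmap hP Z p)^`() = mmap hP Z (raise s k l p).
  have [rD rM rC] := @raise_der K _ _ s k l; move: p.
  apply: (@der_along_eq _ _ _ (mmap hP Z) (fun p => (mmap hP Z p)^`())
    (fun p => mmap hP Z (raise s k l p))).
  - split=> [p q|p q|c']; first by rewrite rmorphD derivD.
      by rewrite rmorphM derivM.
    by rewrite mmapC /= derivC.
  - split=> [p q|p q|c']; first by rewrite rD rmorphD.
      by rewrite rM rmorphD !rmorphM.
    by rewrite rC rmorph0.
  move=> v; rewrite mmapX mmap1U raise_x /Z; case: ifP => _; last by rewrite derivC rmorph0.
  by rewrite mmapX mmap1U letter_put nkl derivD derivC derivM derivC derivX mul0r add0r mulr1 add0r.
have const i : (mmap hP Z f)`_i.+1 = 0.
  have := congr1 (fun p : {poly S} => p`_i) (der f).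
  rewrite (hf (ltnW kl)) nkl mul0n mul0r rmorph0 coef0 coef_deriv => E.
  have inv : h (i.+1%:R^-1) * i.+1%:R = 1 :> S.
    by rewrite -(rmorph_nat h) -rmorphM mulVf ?rmorph1 // pnatr_eq0.
  by rewrite -[LHS]mul1r -inv -mulrA mulr_natl E mulr0.
have ev c' : (mmap hP Z f).[c'] =
    mmap h (fun v => if letter s v == l then Y v + c' * Y (put s v k) else Y v) f.
  apply: (@mmap_unique _ h _ (fun p => (mmap hP Z p).[c'])) => [c1|v|p q|p q].
  - by rewrite mmapC hornerC.
  - by rewrite mmapX mmap1U /Z; case: ifP => _; rewrite !hornerE // mulrC.
  - by rewrite rmorphD hornerD.
  - by rewrite rmorphM hornerM.
have evc c' : (mmap hP Z f).[c'] = (mmap hP Z f)`_0.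
  rewrite (size1_polyC (p := mmap hP Z f)) ?hornerC ?coefC //.
  by apply/leq_sizeP => -[|i] // _.
rewrite -ev evc -(evc 0) ev; congr (mmap h _ f); apply/funext => v.
by rewrite mul0r addr0; case: ifP.
Qed.

Lemma mmap_column Y (j : 'I_m) d (cf : 'I_m -> S) :
  mmap h (fun v => if letter s v == j
    then d * Y v + \sum_(i : 'I_m | (i < j)%N) cf i * Y (put s v i) else Y v) f
  = d ^+ wt j * mmap h Y f.
Proof.
have gen (r : seq 'I_m) : all (fun i : 'I_m => i < j)%N r ->
    mmap h (fun v => if letter s v == j
      then d * Y v + \sum_(i <- r) cf i * Y (put s v i) else Y v) f
    = d ^+ wt j * mmap h Y f.
  elim: r => [_|i r IH /= /andP[ij rj]].
    rewrite -mmap_scale; congr (mmap h _ f); apply/funext => v.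
    by rewrite big_nil addr0.
  rewrite -IH // -[RHS](mmap_shear _ (cf i) ij); congr (mmap h _ f); apply/funext => v.
  case: ifP => // vj; rewrite letter_put -val_eqE (ltn_eqF ij) big_cons -addrA.
  by congr (_ + _); rewrite addrC.
rewrite -(gen [seq i : 'I_m <- index_enum 'I_m | (i < j)%N]) ?filter_all //.
by congr (mmap h _ f); apply/funext => v; rewrite big_filter.
Qed.

Definition subst_mx (A : 'M[S]_m) Y (v : 'I_N) : S :=
  \sum_p A p (letter s v) * Y (put s v p).

(** The matrix is built column by column from the last one, so that the columns to the left,
    which enter as the values [Y], are still unchanged. *)
Lemma mmap_subst_mx (A : 'M[S]_m) Y : (forall p q : 'I_m, (q < p)%N -> A p q = 0) ->
  mmap h (subst_mx A Y) f = (\prod_j A j j ^+ wt j) * mmap h Y f.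
Proof.
move=> upper.
pose Z k v := if (k <= letter s v)%N then subst_mx A Y v else Y v.
have step k : (k <= m)%N ->
    mmap h (Z (m - k)%N) f = (\prod_(j : 'I_m | (m - k <= j)%N) A j j ^+ wt j) * mmap h Y f.
  elim: k => [_|k IH km].
    rewrite subn0 big_pred0 ?mul1r => [|j]; last by rewrite leqNgt ltn_ord.
    by congr (mmap h _ f); apply/funext => v; rewrite /Z leqNgt ltn_ord.
  have mk : (m - k.+1 < m)%N by lia.
  pose j := Ordinal mk.
  have mkE : (m - k)%N = j.+1 by rewrite /=; lia.
  rewrite (bigD1 j) //= -mulrA.
  have -> : \prod_(i : 'I_m | (m - k.+1 <= i)%N && (i != j)) A i i ^+ wt i =
            \prod_(i : 'I_m | (m - k <= i)%N) A i i ^+ wt i.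
    by apply: eq_bigl => i; rewrite mkE -val_eqE /= ltn_neqAle eq_sym andbC.
  rewrite -(IH (ltnW km)) -[RHS](mmap_column _ j (A j j) (fun i => A i j)); congr (mmap h _ f).
  apply/funext => v; rewrite /Z mkE.
  case: (ltngtP (letter s v) j) => [lt|gt|vj].
  - by rewrite -val_eqE /= (ltn_eqF lt).
  - by rewrite -val_eqE /= (gtn_eqF gt).
  - have jE : letter s v = j by apply/val_inj.
    rewrite jE eqxx /subst_mx jE (bigD1 j) //=.
    have -> : put s v j = v by rewrite -jE put_letter.
    congr (_ + _).
    rewrite (bigID (fun i : 'I_m => (i < j)%N)) /=.
    rewrite addrC big1 ?add0r => [|i /andP[ne nlt]]; last first.
      by rewrite upper ?mul0r //; move: ne nlt; rewrite -val_eqE /=; lia.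
    apply: eq_big => i; first by rewrite andb_idl // => lt; rewrite -val_eqE (ltn_eqF lt).
    by move=> /andP[_ lt]; rewrite letter_put ltnNge (ltnW lt).
have := step m (leqnn m); rewrite subnn => E.
rewrite -(eq_bigl _ _ (fun j : 'I_m => leq0n j)) -E.
by congr (mmap h _ f); apply/funext => v.
Qed.

End Weights.
End Substitution.

(** * Eigenvectors of the moment matrix *)

Lemma commutator_der (K : numFieldType) (N : nat) (d1 d2 : mpoly N K -> mpoly N K) :
  der_along id d1 -> der_along id d2 -> der_along id (fun p => d1 (d2 p) - d2 (d1 p)).
Proof.
move=> der1 der2; have [D1 M1 C1] := der1; have [D2 M2 C2] := der2.
split=> [p q|p q|c]; first by rewrite D2 D1 D1 D2; ring.
  by rewrite M2 M1 D1 D2 !M1 !M2; ring.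
by rewrite C1 C2 (der0 der1) (der0 der2) subrr.
Qed.

Section Commutators.
Variables (K : numFieldType) (N m m' : nat) (s : slot N m) (s' : slot N m').

Definition slots_commute := [/\ forall v k, letter s' (put s v k) = letter s' v,
  forall v k, letter s (put s' v k) = letter s v &
  forall v k l, put s (put s' v k) l = put s' (put s v l) k].

Lemma raise_commute k l i j (p : mpoly N K) : slots_commute ->
  raise s' k l (raise s i j p) = raise s i j (raise s' k l p).
Proof.
case=> L' L PP; apply/eqP; rewrite -subr_eq0; apply/eqP; move: p.
apply: (@der_along_eq K N _ id
  (fun p => raise s' k l (raise s i j p) - raise s i j (raise s' k l p)) (fun=> 0)).
- exact: commutator_der (raise_der _ _ _) (raise_der _ _ _).
- by split=> [p q|p q|c]; rewrite ?addr0 ?mul0r ?mulr0 ?addr0.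
move=> v; rewrite !raise_x; case: ifP => lj; case: ifP => ll; rewrite ?raise_x ?L ?L' ?lj ?ll ?PP ?subrr //.
- by rewrite (der0 (raise_der _ _ _)) subrr.
- by rewrite (der0 (raise_der _ _ _)) subrr.
by rewrite !(der0 (raise_der _ _ _)) subrr.
Qed.

(** The relation [[E_kl, E_ij] = delta_li E_kj - delta_kj E_il] between matrix units. *)
Lemma raise_commutator (k l i j : 'I_m) (p : mpoly N K) :
  raise s k l (raise s i j p) - raise s i j (raise s k l p)
    = (l == i)%:R * raise s k j p - (k == j)%:R * raise s i l p.
Proof.
move: p; apply: (@der_along_eq K N _ id
  (fun p => raise s k l (raise s i j p) - raise s i j (raise s k l p))
  (fun p => (l == i)%:R * raise s k j p - (k == j)%:R * raise s i l p)).
- exact: commutator_der (raise_der _ _ _) (raise_der _ _ _).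
- have [D3 M3 C3] := @raise_der K _ _ s k j; have [D4 M4 C4] := @raise_der K _ _ s i l.
  split=> [p q|p q|c]; first by rewrite D3 D4; ring.
    by rewrite M3 M4; ring.
  by rewrite C3 C4 !mulr0 subr0.
have r0 := der0 (@raise_der K _ _ s _ _).
move=> v; rewrite !raise_x; case: ifP => lj; case: ifP => ll;
  rewrite ?r0 ?raise_x ?letter_put ?put_put ?(eq_sym i l) ?(eq_sym j k) ?lj ?ll;
  by case: (l == i); case: (k == j); rewrite ?mul1r ?mul0r ?mulr0.
Qed.

End Commutators.

Section MomentMatrix.
Variable K : numFieldType.
Variables (N m : nat) (s : slot N m) (wt : nat -> nat) (f : mpoly N K).
Local Notation R := (mpoly N K).
Local Notation x v := (mpolyX K (mnm1 v)).
Hypothesis hf : hw s (fun i : 'I_m => wt i) f.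

(** With the indices in this order the matrix is upper triangular, and [raise] acts on it by
    commutators. *)
Definition moment_mx : 'M[R]_m := \matrix_(p, q) raise s q p f.

(** The product of the commuting matrices [M - wt 0 f, ..., M - wt (j - 1) f] applied to
    [u]. *)
Fixpoint eig_step (j : nat) (u : 'cV[R]_m) : 'cV[R]_m :=
  if j is j'.+1 then eig_step j' ((moment_mx - ((wt j')%:R * f)%:M) *m u) else u.

(** If the weights are distinct, the column [i] is the eigenvector of [moment_mx] for [wt i * f]
    in the span of the first [i + 1] basis vectors; the power of [f] brings all columns to
    the degree [m] in [f]. *)
Definition eig_mx : 'M[R]_m :=
  \matrix_(p, i) (f ^+ (m - i) * eig_step i (delta_mx i 0) p 0).

Lemma moment_mx_upper (p q : 'I_m) : (q < p)%N -> moment_mx p q = 0.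
Proof.
move=> qp; rewrite mxE hf; last exact: ltnW.
by rewrite -val_eqE /= (ltn_eqF qp) mul0n mul0r.
Qed.

Lemma moment_mx_diag p : moment_mx p p = (wt p)%:R * f.
Proof. by rewrite mxE hf // eqxx mul1n. Qed.

(* A vector supported on the first [j] coordinates is killed by [eig_step j]: the factors
   for [j - 1, ..., 0] shorten the support by one each. *)
Definition supported (j : nat) (u : 'cV[R]_m) := forall p : 'I_m, (j <= p)%N -> u p 0 = 0.

Lemma step_entry (j i : nat) (u : 'cV[R]_m) (p : 'I_m) : (i <= p.+1)%N -> supported i u ->
  ((moment_mx - ((wt j)%:R * f)%:M) *m u) p 0 = ((wt p)%:R - (wt j)%:R) * f * u p 0.
Proof.
move=> ip ui; rewrite mulmxBl mul_scalar_mx !mxE (bigD1 p) //= moment_mx_diag.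
rewrite big1 ?addr0 => [|q qp]; first by ring.
case: (ltngtP q p) => [lt|gt|/val_inj E]; last by rewrite E eqxx in qp.
  by rewrite moment_mx_upper ?mul0r.
by rewrite ui ?mulr0 // (leq_trans ip).
Qed.

Lemma step_supported (j i : nat) u : supported i u ->
  supported i ((moment_mx - ((wt j)%:R * f)%:M) *m u).
Proof.
by move=> ui p ip; rewrite (step_entry _ (leqW ip) ui) ui ?mulr0.
Qed.

Lemma step_shrink j u : supported j.+1 u ->
  supported j ((moment_mx - ((wt j)%:R * f)%:M) *m u).
Proof.
move=> uj p jp; rewrite (step_entry _ _ uj) //.
have [->|jp'] := eqVneq j p; first by rewrite subrr !mul0r.
by rewrite uj ?mulr0 // ltn_neqAle jp' jp.
Qed.

Lemma eig_step_supported i j u : supported i u -> supported i (eig_step j u).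
Proof. by elim: j u => //= j IH u ui; apply: IH; apply: step_supported. Qed.

Lemma eig_step_eq0 j u : supported j u -> eig_step j u = 0.
Proof.
elim: j u => [u u0|j IH u uj /=]; last by apply: IH; apply: step_shrink.
by apply/colP => p; rewrite mxE u0.
Qed.

Lemma eig_step_diag j (i : 'I_m) u : supported i.+1 u ->
  eig_step j u i 0 = (\prod_(k < j) ((wt i)%:R - (wt k)%:R)) * f ^+ j * u i 0.
Proof.
elim: j u => [|j IH] u ui /=; first by rewrite big_ord0 !mul1r.
rewrite IH; last exact: step_supported.
by rewrite (step_entry _ _ ui) // big_ord_recr /= exprS; ring.
Qed.

Lemma delta_supported (i : 'I_m) : supported i.+1 (delta_mx i 0).
Proof. by move=> p ip; rewrite mxE -val_eqE /= gtn_eqF. Qed.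

Lemma eig_mx_upper (p i : 'I_m) : (i < p)%N -> eig_mx p i = 0.
Proof.
by move=> ip; rewrite mxE (eig_step_supported _ (@delta_supported i)) ?mulr0.
Qed.

Lemma eig_mx_diag_neq0 (i : 'I_m) : f != 0 -> (forall k : nat, (k < i)%N -> (wt i < wt k)%N) ->
  eig_mx i i != 0.
Proof.
move=> f0 dec; rewrite mxE (eig_step_diag _ (@delta_supported i)) mxE !eqxx mulr1.
rewrite !mulf_neq0 ?expf_neq0 //; apply/prodf_neq0 => k _.
rewrite -oppr_eq0 opprB -natrB ?(ltnW (dec _ _)) // -mpolyC_nat mpolyC_eq0 pnatr_eq0.
by rewrite subn_eq0 -ltnNge dec.
Qed.

(* [D] stands for a derivation [raise k l] in the slot of [moment_mx], where [e] is the matrix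
   unit [E_kl], or in another slot, where [e = 0]; [lam] is the weight of [f] under it. *)
Section Derive.
Variable D : R -> R.
Hypothesis der : der_along id D.
Variables (lam : nat) (e : 'M[R]_m).
Hypothesis Df : D f = lam%:R * f.
Hypothesis DM : map_mx D moment_mx = lam%:R *: moment_mx + moment_mx *m e - e *m moment_mx.

Lemma map_mulmx (q r t : nat) (A : 'M[R]_(q, r)) (B : 'M[R]_(r, t)) :
  map_mx D (A *m B) = map_mx D A *m B + A *m map_mx D B.
Proof.
apply/matrixP => i k; rewrite !mxE (der_sum der) -big_split; apply: eq_bigr => j _ /=.
by case: der => _ M _; rewrite M !mxE.
Qed.

(** As [D] acts on the matrix by [lam] plus the commutator with [e], the operator [D + e] on
    vectors commutes with multiplication by the matrix up to [lam]. *)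
Lemma derive_step (j : nat) (u : 'cV[R]_m) :
  let B := moment_mx - ((wt j)%:R * f)%:M in
  map_mx D (B *m u) + e *m (B *m u) = lam%:R *: (B *m u) + B *m (map_mx D u + e *m u).
Proof.
move=> B; have DB : map_mx D B = lam%:R *: B + B *m e - e *m B.
  have -> : map_mx D B = map_mx D moment_mx - lam%:R *: ((wt j)%:R * f)%:M.
    apply/matrixP => p q; rewrite !mxE (derB der); congr (_ - _).
    have [_ M _] := der; case: (p == q); rewrite ?mulr1n ?mulr0n ?(der0 der) ?mulr0 //.
    by rewrite M Df (der_nat der) mul0r add0r mulrCA.
  rewrite DM scalerBr mulmxBl mulmxBr mul_scalar_mx mul_mx_scalar.
  move: (_ *: moment_mx) (moment_mx *m e) (e *m moment_mx) (lam%:R *: _%:M) (_ *: e) => A1 A2 A3 A4 A5.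
  by rewrite opprB !addrA; apply/matrixP => p q; rewrite !mxE; ring.
clearbody B; rewrite map_mulmx DB mulmxDr mulmxBl mulmxDl -scalemxAl !mulmxA.
move: (lam%:R *: _) (B *m e *m u) (e *m B *m u) (B *m map_mx D u) => A1 A2 A3 A4.
by apply/matrixP => p q; rewrite !mxE; ring.
Qed.

Lemma derive_eig_step (j : nat) (u : 'cV[R]_m) :
  map_mx D (eig_step j u) =
    (j * lam)%:R *: eig_step j u - e *m eig_step j u + eig_step j (map_mx D u + e *m u).
Proof.
elim: j u => [|j IH] u /=.
  by rewrite mul0n scale0r add0r addrC addrK.
rewrite IH derive_step.
have stepD j' u1 u2 : eig_step j' (u1 + u2) = eig_step j' u1 + eig_step j' u2.
  by elim: j' u1 u2 => //= j' IH' u1 u2; rewrite mulmxDr IH'.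
have stepZ j' c u1 : eig_step j' (c *: u1) = c *: eig_step j' u1.
  by elim: j' u1 => //= j' IH' u1; rewrite -scalemxAr IH'.
rewrite stepD stepZ mulSn natrD scalerDl.
by rewrite [LHS]addrA; congr (_ + _); rewrite addrC addrA.
Qed.

End Derive.
End MomentMatrix.

Section Families.
Variable K : numFieldType.
Variable N : nat.
Local Notation R := (mpoly N K).

(** The members [Y u] transform as the variables do, up to a twist by the weight [nu]. *)
Definition vector_family (m : nat) (s : slot N m) (nu : nat -> nat) (Y : 'I_N -> R) :=
  forall k l : 'I_m, (k <= l)%N -> forall u, raise s k l (Y u) =
    ((k == l) * nu k)%:R * Y u + (if letter s u == l then Y (put s u k) else 0).

(** Each member is a highest weight polynomial, whose weight contains its own letter. *)
Definition weight_family (m : nat) (s : slot N m) (nu : nat -> nat) (Y : 'I_N -> R) :=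
  forall u, hw s (fun k : 'I_m => nu k + (letter s u == k))%N (Y u).

Lemma vector_family_x (m : nat) (s : slot N m) :
  vector_family s (fun=> 0%N) (fun v => mpolyX K (mnm1 v)).
Proof. by move=> k l _ u; rewrite raise_x muln0 mul0r add0r. Qed.

Lemma der_exp (D : R -> R) (lam j : nat) f : der_along id D -> D f = lam%:R * f ->
  D (f ^+ j) = (j * lam)%:R * f ^+ j.
Proof.
move=> der Df; have [_ M _] := der.
elim: j => [|j IH]; first by rewrite mul0n mul0r expr0 (der_nat der 1).
by rewrite exprS M IH Df mulSn natrD; ring.
Qed.

Section OneSlot.
Variables (m : nat) (s : slot N m) (wt : nat -> nat) (f : R).
Hypothesis hf : hw s (fun i : 'I_m => wt i) f.
Local Notation M := (moment_mx s f).
Local Notation E := (eig_mx s wt f).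

(** By [derive_eig_step], a derivation acts on the column [i] by [m] times the weight of [f], minus the
    matrix unit acting on the rows, plus the column built from [E_kl e_i].  The latter is
    [e_k] if [l = i] and zero otherwise; for [k < i] the vector [e_k] is killed by
    [eig_step i]. *)
Lemma raise_eig_mx_self (k l p i : 'I_m) : (k <= l)%N ->
  raise s k l (E p i) = (m * ((k == l) * wt k))%:R * E p i - (p == k)%:R * E l i
    + ((k == l) && (i == k))%:R * E p i.
Proof.
move=> kl; have der := @raise_der K _ _ s k l.
set lam := ((k == l) * wt k)%N; have Df : raise s k l f = lam%:R * f by exact: hf.
pose e : 'M[R]_m := delta_mx k l.
have DM : map_mx (raise s k l) M = lam%:R *: M + M *m e - e *m M.
  apply/matrixP => p' q; rewrite !mxE.
  have := raise_commutator s k l q p' f; rewrite Df => /eqP.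
  rewrite subr_eq => /eqP ->.
  have [_ LM _] := @raise_der K _ _ s q p'.
  rewrite LM (der_nat (raise_der s q p')) mul0r add0r [LHS]addrC -[RHS]addrA.
  congr (_ + _); congr (_ - _).
    rewrite (bigD1 k) //= !mxE eqxx /= big1 ?addr0 => [|j jk].
      by rewrite mulrC eq_sym.
    by rewrite !mxE (negPf jk) mulr0.
  rewrite (bigD1 l) //= !mxE eqxx andbT /= big1 ?addr0 => [|j jl].
    by rewrite eq_sym.
  by rewrite !mxE (negPf jl) andbF mul0r.
rewrite !mxE; have [_ LM _] := der; rewrite LM (der_exp _ der Df).
have := congr1 (fun A : 'cV[R]_m => A p 0) (derive_eig_step wt der Df DM i (delta_mx i 0)).
rewrite mxE => ->; rewrite !mxE.
have -> : map_mx (raise s k l) (delta_mx i 0) = 0 :> 'cV[R]_m.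
  by apply/matrixP => p' q; rewrite !mxE (der_nat der).
rewrite add0r /e mul_delta_mx_cond.
have -> : eig_step s wt f i (delta_mx k 0 *+ (l == i)) p 0 =
    ((k == l) && (i == k))%:R * eig_step s wt f i (delta_mx i 0) p 0.
  have z0 (d : 'I_m) : (d < i)%N -> eig_step s wt f i (delta_mx d 0) = 0.
    move=> di; apply: eig_step_eq0 => //.
    by move=> q iq; rewrite mxE -val_eqE /= gtn_eqF // (leq_trans di).
  have s0 : eig_step s wt f i 0 = 0.
    by apply: eig_step_eq0 => // q _; rewrite mxE.
  case: (l =P i) => [li|nli]; last first.
    rewrite mulr0n s0 mxE; case: (k =P l) => [kl'|]; last by rewrite mul0r.
    by case: (i =P k) => [ik|]; [case: nli; rewrite -kl' ik | rewrite mul0r].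
  rewrite mulr1n; have [kl'|nkl] := eqVneq k l.
    by rewrite kl' li eqxx mul1r.
  by rewrite z0 ?mxE ?mul0r // -li ltn_neqAle nkl kl.
rewrite (bigD1 l) //= !mxE eqxx andbT big1 ?addr0 => [|j jl]; last first.
  by rewrite !mxE (negPf jl) andbF mul0r.
have -> : (m * lam)%:R = ((m - i) * lam)%:R + (i * lam)%:R :> R.
  by rewrite -natrD -mulnDl subnK // ltnW.
by ring.
Qed.

(** The rows of [eig_mx] transform dually to the vector family [Y], and the two actions cancel
    in the sum over them; what is left is the highest weight of the column. *)
Lemma weight_family_self (nu : nat -> nat) Y : vector_family s nu Y ->
  weight_family s (fun k => m * wt k + nu k)%N (subst_mx s E Y).
Proof.
move=> hY v k l kl; have der := @raise_der K _ _ s k l; have [_ LM _] := der.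
rewrite /subst_mx (der_sum der).
set i := letter s v; set lam := (k == l)%N.
transitivity (\sum_p (((k == l) * (m * wt k + nu k + (i == k)))%:R * (E p i * Y (put s v p))
   + ((if p == l then E p i * Y (put s v k) else 0) - (if p == k then E l i * Y (put s v p) else 0)))).
  apply: eq_bigr => p _; rewrite LM raise_eig_mx_self // hY // letter_put put_put.
  have -> : ((k == l) && (i == k))%:R = ((k == l) * (i == k))%:R :> R by case: (k == l); rewrite ?mul1n.
  case: (p == l); case: (p == k); rewrite !(natrD, natrM) ?mul0r ?mul1r ?mulr0 ?addr0 ?subr0;
    by ring.
rewrite big_split /= -mulr_sumr sumrB -!big_mkcond !big_pred1_eq subrr addr0.
by [].
Qed.

End OneSlot.

(** The entries of [eig_mx] for one slot are highest weight polynomials of weight [m * wt'] in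
    another slot, so a substitution in the first preserves the type of family in the
    second. *)
Section TwoSlots.
Variables (m m' : nat) (s : slot N m) (s' : slot N m') (wt wt' : nat -> nat) (f : R).
Hypothesis hf : hw s (fun i : 'I_m => wt i) f.
Hypothesis hf' : hw s' (fun i : 'I_m' => wt' i) f.
Hypothesis comm : slots_commute s s'.
Local Notation E := (eig_mx s wt f).

Lemma raise_eig_mx_other (k l : 'I_m') (p i : 'I_m) : (k <= l)%N ->
  raise s' k l (E p i) = (m * ((k == l) * wt' k))%:R * E p i.
Proof.
move=> kl; have der := @raise_der K _ _ s' k l.
set lam := ((k == l) * wt' k)%N; have Df : raise s' k l f = lam%:R * f by exact: hf'.
have DM : map_mx (raise s' k l) (moment_mx s f) =
    lam%:R *: moment_mx s f + moment_mx s f *m 0 - 0 *m moment_mx s f.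
  rewrite mulmx0 mul0mx subr0 addr0; apply/matrixP => p' q; rewrite !mxE raise_commute // Df.
  by have [_ -> _] := @raise_der K _ _ s q p'; rewrite (der_nat (raise_der s q p')) mul0r add0r.
rewrite !mxE; have [_ LM _] := der; rewrite LM (der_exp _ der Df).
have := congr1 (fun A : 'cV[R]_m => A p 0) (derive_eig_step wt der Df DM i (delta_mx i 0)).
have -> : map_mx (raise s' k l) (delta_mx i 0) = 0 :> 'cV[R]_m.
  by apply/matrixP => p' q; rewrite !mxE (der_nat der).
rewrite !mul0mx subr0 addr0 mxE => ->; rewrite !mxE.
have -> : eig_step s wt f i 0 p 0 = 0 by rewrite (eig_step_eq0 hf) ?mxE // => q _; rewrite mxE.
have -> : (m * lam)%:R = ((m - i) * lam)%:R + (i * lam)%:R :> R.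
  by rewrite -natrD -mulnDl subnK // ltnW.
by ring.
Qed.

Lemma vector_family_other (nu : nat -> nat) Y : vector_family s' nu Y ->
  vector_family s' (fun k => m * wt' k + nu k)%N (subst_mx s E Y).
Proof.
have [L' L PP] := comm.
move=> hY k l kl v; have der := @raise_der K _ _ s' k l; have [_ LM _] := der.
rewrite /subst_mx (der_sum der) mulr_sumr.
have -> : (if letter s' v == l
    then \sum_p E p (letter s (put s' v k)) * Y (put s (put s' v k) p) else 0)
  = \sum_p (if letter s' v == l then E p (letter s v) * Y (put s' (put s v p) k) else 0).
  case: ifP => _; last by rewrite big1.
  by rewrite L; apply: eq_bigr => p _; rewrite PP.
rewrite -big_split; apply: eq_bigr => p _ /=.
rewrite LM raise_eig_mx_other // hY // L'.
by case: ifP => _; rewrite !(natrM, natrD); ring.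
Qed.

Lemma weight_family_other (nu : nat -> nat) Y : weight_family s' nu Y ->
  weight_family s' (fun k => m * wt' k + nu k)%N (subst_mx s E Y).
Proof.
have [L' L PP] := comm.
move=> hY v k l kl; have der := @raise_der K _ _ s' k l; have [_ LM _] := der.
rewrite /subst_mx (der_sum der) mulr_sumr; apply: eq_bigr => p _.
rewrite LM raise_eig_mx_other // hY // L'.
by rewrite !(natrM, natrD); ring.
Qed.

End TwoSlots.
End Families.

Lemma slotsAB (a b c : nat) : slots_commute (slotA a b c) (slotB a b c).
Proof. by split=> *; rewrite /= !boxof_var. Qed.
Lemma slotsAC (a b c : nat) : slots_commute (slotA a b c) (slotC a b c).
Proof. by split=> *; rewrite /= !boxof_var. Qed.
Lemma slotsBC (a b c : nat) : slots_commute (slotB a b c) (slotC a b c).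
Proof. by split=> *; rewrite /= !boxof_var. Qed.

Lemma slots_commute_sym N m m' (s : slot N m) (s' : slot N m') :
  slots_commute s s' -> slots_commute s' s.
Proof. by case=> H1 H2 H3; split=> // v k l; rewrite H3. Qed.

(** * Shifting a strictly decreasing weight by a variable *)

Section RegularWeight.
Variable K : numFieldType.
Variables (a b c : nat).
Local Notation R := (mpoly (nvars a b c) K).
Local Notation lA := (letter (slotA a b c)).
Local Notation lB := (letter (slotB a b c)).
Local Notation lC := (letter (slotC a b c)).

Definition hw3 (be ga al : nat -> nat) (g : R) :=
  [/\ hw (slotA a b c) (fun i : 'I_a => be i) g,
      hw (slotB a b c) (fun j : 'I_b => ga j) g &
      hw (slotC a b c) (fun t : 'I_c => al t) g].

Definition decreasing (d : nat) (w : nat -> nat) :=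
  forall i j : nat, (i < j)%N -> (j < d)%N -> (w j < w i)%N.

Variables (be ga al : nat -> nat) (f : R).
Hypotheses (f0 : f != 0) (hf : hw3 be ga al f).
Hypotheses (dec_be : decreasing a be) (dec_ga : decreasing b ga) (dec_al : decreasing c al).

(** Each substitution turns the vector family of the variables into a weight family in its slot
    and adds a multiple of the weight of [f] in the other two. *)
Definition shifted_var : 'I_(nvars a b c) -> R :=
  subst_mx (slotC a b c) (eig_mx (slotC a b c) al f)
    (subst_mx (slotB a b c) (eig_mx (slotB a b c) ga f)
      (subst_mx (slotA a b c) (eig_mx (slotA a b c) be f) (fun v => mpolyX K (mnm1 v)))).

Lemma shifted_var_hw v :
  hw3 (fun i => (a + b + c) * be i + (i == lA v))%N (fun j => (a + b + c) * ga j + (j == lB v))%N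
      (fun t => (a + b + c) * al t + (t == lC v))%N (shifted_var v).
Proof.
case: hf => hA hB hC.
have AB := slotsAB a b c; have AC := slotsAC a b c; have BC := slotsBC a b c.
have BA := slots_commute_sym AB; have CA := slots_commute_sym AC; have CB := slots_commute_sym BC.
have famA := weight_family_other hC hA CA (weight_family_other hB hA BA
  (weight_family_self hA (vector_family_x K (slotA a b c)))).
have famB := weight_family_other hC hB CB (weight_family_self hB
  (vector_family_other hA hB AB (vector_family_x K (slotB a b c)))).
have famC := weight_family_self hC (vector_family_other hB hC BC
  (vector_family_other hA hC AC (vector_family_x K (slotC a b c)))).
split.
- have := famA v; congr hw; apply/funext => i /=.
  by rewrite eq_sym -val_eqE /= addn0 !addnA -!mulnDl; congr (_ * _ + _)%N; clear; lia.
- have := famB v; congr hw; apply/funext => i /=.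
  by rewrite eq_sym -val_eqE /= addn0 !addnA -!mulnDl; congr (_ * _ + _)%N; clear; lia.
have := famC v; congr hw; apply/funext => i /=.
by rewrite eq_sym -val_eqE /= addn0 !addnA -!mulnDl; congr (_ * _ + _)%N; clear; lia.
Qed.

(** By [mmap_subst_mx] the value is [f] times powers of the diagonal entries of the three
    matrices, which are nonzero as the weights are distinct. *)
Lemma mmap_shifted_var_neq0 : mmap (@mpolyC (nvars a b c) K) shifted_var f != 0.
Proof.
case: hf => hA hB hC; rewrite /shifted_var.
rewrite (mmap_subst_mx hC) => [|p q qp]; last exact: eig_mx_upper hC _ _ qp.
rewrite (mmap_subst_mx hB) => [|p q qp]; last exact: eig_mx_upper hB _ _ qp.
rewrite (mmap_subst_mx hA) => [|p q qp]; last exact: eig_mx_upper hA _ _ qp.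
have -> : mmap (@mpolyC (nvars a b c) K) (fun v => mpolyX K (mnm1 v)) f = f.
  by symmetry; apply: (@mmap_unique K _ _ _ _ id).
rewrite !mulf_neq0 //; apply/prodf_neq0 => i _; apply: expf_neq0.
- by apply: (eig_mx_diag_neq0 hC) => // k ki; apply: dec_al.
- by apply: (eig_mx_diag_neq0 hB) => // k ki; apply: dec_ga.
by apply: (eig_mx_diag_neq0 hA) => // k ki; apply: dec_be.
Qed.

Variables (F : realFieldType) (x : 'I_a -> F) (y : 'I_b -> F) (z : 'I_c -> F).
Hypothesis form0 : \sum_i x i *+ be i + \sum_j y j *+ ga j + \sum_t z t *+ al t = 0.
Hypothesis form_ge0 : forall v, shifted_var v != 0 -> 0 <= x (lA v) + y (lB v) + z (lC v).

(** A monomial of [f] that does not vanish at the [shifted_var] involves the index [t], since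
    [al t > 0].  The form takes the value zero on the weight of the monomial and nonnegative
    values on its variables, so it is zero on each variable that occurs. *)
Lemma exists_shift (t : 'I_c) : (0 < al t)%N ->
  exists v, [/\ lC v = t, shifted_var v != 0 & x (lA v) + y (lB v) + z (lC v) = 0].
Proof.
move=> alt; apply: contrapT => /forallNP none.
have := mmap_shifted_var_neq0; apply/negP/negPn; rewrite /mmap big_seq big1 // => mon monf.
case: hf => hA hB hC.
have [v0 v0t mv0] : exists2 v, lC v = t & (0 < mon v)%N.
  apply: contrapT => N; move: alt; rewrite -(supp_weight hC t monf) big1 // => v /eqP vt.
  by apply/eqP; rewrite -leqn0 leqNgt; apply/negP => mv; apply: N; exists v.
have [zero|nonzero] := pselect (exists2 v, (0 < mon v)%N & shifted_var v = 0).
  have [v mv Pv0] := zero; rewrite /mmap1 (bigD1 v) //= Pv0 expr0n.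
  by rewrite gtn_eqF //= mul0r mulr0.
have nz v : (0 < mon v)%N -> shifted_var v != 0.
  by move=> mv; apply/eqP => E; apply: nonzero; exists v.
case: (none v0); split=> //; first exact: nz.
have total : \sum_v (x (lA v) + y (lB v) + z (lC v)) *+ mon v = 0.
  have part (d : nat) (s : slot (nvars a b c) d) (wt : nat -> nat) (w : 'I_d -> F) :
      hw s (fun i : 'I_d => wt i) f ->
      \sum_v w (letter s v) *+ mon v = \sum_i w i *+ wt i.
    move=> hs; rewrite (partition_big (letter s) xpredT) //=; apply: eq_bigr => i _.
    by rewrite -(supp_weight hs i monf) -sumrMnr; apply: eq_bigr => v /eqP ->.
  rewrite -[RHS]form0 -(part _ _ _ x hA) -(part _ _ _ y hB) -(part _ _ _ z hC) -!big_split.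
  by apply: eq_bigr => v _ /=; rewrite !mulrnDl.
have ge v : 0 <= (x (lA v) + y (lB v) + z (lC v)) *+ mon v.
  have [->|mv] := posnP (mon v); first by rewrite mulr0n.
  by rewrite mulrn_wge0 // form_ge0 // nz.
move/eqP: total; rewrite psumr_eq0 // => /allP/(_ v0); rewrite mem_index_enum => /(_ isT) /=.
by rewrite mulrn_eq0 gtn_eqF //= => /eqP.
Qed.

End RegularWeight.

(** * Minors of a standard tableau *)

Definition nonincreasing (d : nat) (w : nat -> nat) :=
  forall i j : nat, (i <= j)%N -> (j < d)%N -> (w j <= w i)%N.

Lemma partition_nonincreasing (l : seq nat) d : is_partition l -> nonincreasing d (nth 0%N l).
Proof.
move=> /andP[sl _] i j ij _; have [jl|jl] := ltnP j (size l); last by rewrite nth_default.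
apply: (sorted_leq_nth (leT := geq)) => //.
- by move=> x y z; rewrite /geq /= => ? ?; lia.
- by move=> x; rewrite /geq /=.
- by rewrite inE (leq_ltn_trans ij jl).
Qed.

(* Partitions are lists without zeros, so the weight is cut at its first zero. *)
Lemma exists_partition (d : nat) (w : nat -> nat) : nonincreasing d w ->
  exists l, [/\ is_partition l, (size l <= d)%N & forall i, (i < d)%N -> nth 0%N l i = w i].
Proof.
elim: d => [|d IH] dec; first by exists [::].
have [wd0|wdpos] := posnP (w d).
  have [l [pl sl lE]] := IH (fun i j ij jd => dec i j ij (leqW jd)).
  exists l; split=> // [|i]; first exact: leqW.
  rewrite ltnS leq_eqVlt => /orP[/eqP ->|]; last exact: lE.
  by rewrite nth_default.
exists (mkseq w d.+1); rewrite size_mkseq; split=> // [|i id]; last by rewrite nth_mkseq.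
apply/andP; split; last first.
  apply/mapP => -[i]; rewrite mem_iota add0n => /andP[_ id] w0.
  by have := dec i d id (ltnSn d); rewrite -w0 leqNgt wdpos.
apply/(sortedP 0%N) => i; rewrite size_mkseq => id.
by rewrite !nth_mkseq // ?(ltnW id) //; apply: dec => //; apply: leqnSn.
Qed.

Section Minors.
Variables (K : numFieldType) (N k : nat).
Local Notation R := (mpoly N K).

Lemma der_det (D : R -> R) (A : 'M[R]_k) : der_along id D ->
  D (\det A) = \sum_r \det (\matrix_(i, j) if i == r then D (A i j) else A i j).
Proof.
move=> der; rewrite /determinant (der_sum der) exchange_big; apply: eq_bigr => s _ /=.
have [_ M _] := der; rewrite M.
have -> : D ((-1) ^+ s) = 0.
  case: (odd_perm s); rewrite ?expr0 ?expr1 ?(der_nat der 1) //.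
  by rewrite -(sub0r 1) (derB der) (der0 der) (der_nat der 1) subrr.
rewrite mul0r add0r (der_prod der) mulr_sumr; apply: eq_bigr => r _; congr (_ * _).
by apply: eq_bigr => i _; rewrite mxE.
Qed.

End Minors.

Section TableauMinor.
Variables (K : numFieldType) (a b : nat) (T : 'I_a -> 'I_b -> 'I_(a * b)).
Hypothesis hT : standard_tableau T.

Lemma tableau_box : exists2 tau : 'I_(a * b) -> 'I_a * 'I_b,
  (forall s, T (tau s).1 (tau s).2 = s) & forall i j, tau (T i j) = (i, j).
Proof.
have [[tau tK Tk] _ _] := hT; exists tau => [s|i j]; first exact: Tk.
exact: (tK (i, j)).
Qed.

(* The indices range over [nat], as those of weights do, so that the counts are [0] outside of
   the tableau. *)
Definition row_count (k i : nat) :=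
  #|[set ij : 'I_a * 'I_b | (T ij.1 ij.2 < k)%N && (ij.1 == i :> nat)]|.
Definition col_count (k j : nat) :=
  #|[set ij : 'I_a * 'I_b | (T ij.1 ij.2 < k)%N && (ij.2 == j :> nat)]|.

Section MinorRows.
Variables (k N d : nat) (kab : (k <= a * b)%N) (v : 'I_(a * b) -> 'I_(a * b) -> 'I_N).
Local Notation wd := (widen_ord kab).
Definition minor_mx : 'M[mpoly N K]_k := \matrix_(r, t) mpolyX K (mnm1 (v (wd r) (wd t))).

(** Raising a letter in a row turns this row into an earlier row of the minor, so that two rows
    become equal. *)
Lemma minor_rows (s : slot N d) (lab : 'I_(a * b) -> 'I_d) :
  (forall r t, letter s (v r t) = lab r) ->
  (forall r (p : 'I_d), (p < lab r)%N ->
     exists2 r' : 'I_(a * b), (r' < r)%N & forall t, put s (v r t) p = v r' t) ->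
  hw s (fun p => #|[set r : 'I_k | lab (wd r) == p]|) (\det minor_mx).
Proof.
move=> lab_letter move_up p q pq; have der := @raise_der K _ _ s p q.
rewrite (der_det _ der).
rewrite (eq_bigr (fun r => if lab (wd r) == q then (p == q)%:R * \det minor_mx else 0)); last first.
  move=> r _; case: ifP => [/eqP rq|nrq]; last first.
    rewrite (expand_det_row _ r) big1 // => t _.
    by rewrite !mxE eqxx raise_x lab_letter nrq mul0r.
  have [E|npq] := eqVneq p q.
    rewrite mul1r; congr (\det _); apply/matrixP => i t; rewrite !mxE.
    case: eqP => // ->; rewrite raise_x lab_letter rq eqxx; congr (mpolyX _ (mnm1 _)).
    by rewrite E -rq -(lab_letter _ (wd t)) put_letter.
  have lt : (p < lab (wd r))%N by rewrite rq ltn_neqAle npq pq.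
  have [r' r'r Er'] := move_up _ _ lt.
  have r'k : (r' < k)%N := ltn_trans r'r (ltn_ord r).
  have nr : Ordinal r'k != r by rewrite -val_eqE /= ltn_eqF.
  rewrite mul0r (determinant_alternate nr) // => t; rewrite !mxE eqxx (negPf nr).
  rewrite raise_x lab_letter rq eqxx; congr (mpolyX _ (mnm1 _)).
  by rewrite Er'; congr v; apply/val_inj.
rewrite -big_mkcond sumr_const -[LHS]mulr_natl natrM mulrCA -[RHS]mulrA.
have [->|npq] := eqVneq p q; last by rewrite !mul0r.
by congr (_ * (_%:R * _)); apply: eq_card => r; rewrite inE.
Qed.

Lemma minor_cols (s : slot N (a * b)) :
  (forall r t, letter s (v r t) = t) -> (forall r t p, put s (v r t) p = v r p) ->
  hw s (fun t => (t < k)%N : nat) (\det minor_mx).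
Proof.
move=> letter_v put_v p q pq; rewrite -det_tr; have der := @raise_der K _ _ s p q.
rewrite (der_det _ der).
rewrite (eq_bigr (fun t => if wd t == q then (p == q)%:R * \det minor_mx^T else 0)); last first.
  move=> t _; case: ifP => [/eqP tq|ntq]; last first.
    rewrite (expand_det_row _ t) big1 // => r _.
    by rewrite !mxE eqxx raise_x letter_v ntq mul0r.
  have [E|npq] := eqVneq p q.
    rewrite mul1r; congr (\det _); apply/matrixP => i r; rewrite !mxE.
    by case: eqP => // ->; rewrite raise_x letter_v tq eqxx put_v E.
  have pt : (p < t)%N by have := ltn_neqAle p q; rewrite npq pq -tq.
  have nt : Ordinal (ltn_trans pt (ltn_ord t)) != t by rewrite -val_eqE /= ltn_eqF.
  rewrite mul0r (determinant_alternate nt) // => r; rewrite !mxE eqxx (negPf nt).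
  by rewrite raise_x letter_v tq eqxx put_v; congr (mpolyX _ (mnm1 (v _ _))); apply/val_inj.
have [->|npq] := eqVneq p q; last by rewrite big1 ?mul0n ?mul0r // => t _; case: ifP => _ //; exact: mul0r.
rewrite !mul1n mul1r; have [qk|qk] := ltnP q k.
  rewrite mul1r (bigD1 (Ordinal qk)) //= ifT ?big1 ?addr0 // => [t|].
    by case: ifP => // /eqP tq /eqP[]; apply/val_inj; rewrite /= -tq.
  by apply/eqP/val_inj.
rewrite mul0r big1 // => t _; case: ifP => // /eqP tq.
by move: (ltn_ord t); rewrite ltnNge -tq in qk *; rewrite qk.
Qed.

End MinorRows.

(** The boxes with entries less than [k] form a Young diagram, so raising the first or the second
    index of a row yields the row of another box in it.  The minor is nonzero since it takes
    the value [1] when [X_ijt] is specialized to [1] for [t = T(i,j)] and to [0]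
    otherwise. *)
Lemma tableau_minor (k : nat) : (k <= a * b)%N ->
  exists2 g : mpoly (nvars a b (a * b)) K, g != 0 &
    hw3 (row_count k) (col_count k) (fun t => (t < k)%N : nat) g.
Proof.
move=> kab; have [tau tauK Ttau] := tableau_box; have [_ inc_row inc_col] := hT.
pose v (s t : 'I_(a * b)) := var (tau s).1 (tau s).2 t.
have tauI : injective tau by move=> r s E; rewrite -(tauK r) E tauK.
have card_tau (P : 'I_a * 'I_b -> bool) :
    #|[set r : 'I_k | P (tau (widen_ord kab r))]| = #|[set ij : 'I_a * 'I_b | (T ij.1 ij.2 < k)%N && P ij]|.
  have wI : injective (fun r : 'I_k => tau (widen_ord kab r)).
    by move=> r s /tauI /(congr1 val) /= /val_inj.
  rewrite -(card_imset _ wI); apply: eq_card => -[i j]; rewrite inE /=.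
  apply/imsetP/andP => [[r]|[Tk Pij]].
    rewrite inE => Pr E; rewrite -E in Pr; split=> //.
    by have := tauK (widen_ord kab r); rewrite -E /= => ->; rewrite /= ltn_ord.
  have E : tau (widen_ord kab (Ordinal Tk)) = (i, j).
    by rewrite -Ttau; congr tau; apply/val_inj.
  by exists (Ordinal Tk); rewrite ?inE E.
exists (\det (minor_mx kab v)).
  apply/eqP => /(congr1 (mmap (@idfun K) (fun u => (T (boxof u).1.1 (boxof u).1.2 == (boxof u).2)%:R))).
  rewrite rmorph0 -det_map_mx /=.
  rewrite (_ : map_mx _ _ = 1%:M) ?det1; first by apply/eqP; rewrite oner_eq0.
  apply/matrixP => s t; rewrite !mxE mmapX mmap1U boxof_var /= tauK.
  by rewrite -val_eqE.
split.
- have H := @minor_rows k _ _ kab v (slotA a b (a * b)) (fun r => (tau r).1).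
  have -> : (fun i : 'I_a => row_count k i) = (fun i => #|[set r : 'I_k | (tau (widen_ord kab r)).1 == i]|).
    by apply/funext => i; rewrite /row_count -(card_tau (fun ij => ij.1 == i :> nat)).
  apply: H => [r t|r p pr]; first by rewrite /= boxof_var.
  exists (T p (tau r).2); first by rewrite -{2}(tauK r); apply: inc_row.
  by move=> t; rewrite /= boxof_var /v Ttau.
- have H := @minor_rows k _ _ kab v (slotB a b (a * b)) (fun r => (tau r).2).
  have -> : (fun j : 'I_b => col_count k j) = (fun j => #|[set r : 'I_k | (tau (widen_ord kab r)).2 == j]|).
    by apply/funext => i; rewrite /col_count -(card_tau (fun ij => ij.2 == i :> nat)).
  apply: H => [r t|r p pr]; first by rewrite /= boxof_var.
  exists (T (tau r).1 p); first by rewrite -{2}(tauK r); apply: inc_col.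
  by move=> t; rewrite /= boxof_var /v Ttau.
by apply: minor_cols => [r t|r t p]; rewrite /= boxof_var.
Qed.
End TableauMinor.

(** * The linear form of an additive tableau *)

Lemma polytabloid_col (n : nat) (l : seq nat) (q y : 'S_n) : q \in col_stab n l ->
  polytabloid l (q * y)%g = (-1) ^+ odd_perm q * polytabloid l y.
Proof.
move=> qC; rewrite /polytabloid /word_polytabloid (reindex_inj (mulgI q)) mulr_sumr /=.
apply: eq_big => [r|r _]; first by rewrite col_stabM.
rewrite odd_permM signr_addb -mulrA; congr (_ * (_ * (nat_of_bool _)%:R)).
apply/forallP/forallP => H j; last by rewrite !permM.
by have := H (q^-1%g j); rewrite !permM permKV.
Qed.

Section KroneckerWords.
Variables (n : nat) (l m k : seq nat).
Hypotheses (sum_l : sumn l = n) (sum_m : sumn m = n) (sum_k : sumn k = n).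

(** Expand the first two polytabloids in a nonzero sum of [kroneckerP] over column permutations
    [q1] and [q2]; some term [S q1 q2] is nonzero.  It fixes two words up to the translation
    by [g].  If two boxes [c], [d] in one column of [k] carried the same letters in both
    words, replacing [g] by its product with the corresponding transposition would preserve
    the words and change the sign of the third polytabloid, so [S q1 q2 = 0]. *)
Lemma kronecker_words : kronecker l m k != 0%N -> exists s1 s2 : 'S_n,
  forall c d : 'I_n, reshape_offset k c = reshape_offset k d ->
    reshape_index l (s1 c) = reshape_index l (s1 d) ->
    reshape_index m (s2 c) = reshape_index m (s2 d) -> c = d.
Proof.
move=> /(kroneckerP sum_l sum_m sum_k)[x1 [x2 [x3 [y1 [y2 [y3 nz]]]]]].
pose A p (x y q g : 'S_n) : bool :=
  [forall j, reshape_index p ((x * g * y)%g j) == reshape_index p (q j)].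
pose S q1 q2 : algC := \sum_(g in [set: 'S_n]%G)
  (A l x1 y1 q1 g)%:R * (A m x2 y2 q2 g)%:R * polytabloid k (x3 * g * y3)%g.
have [q1 [q2 Snz]] : exists q1 q2, S q1 q2 != 0.
  apply: contrapT => /forallNP N; move: nz; apply/negP/negPn/eqP.
  have S0 q1 q2 : S q1 q2 = 0.
    by apply/eqP; apply: contrapT => /negP nz; apply: (N q1); exists q2.
  transitivity (\sum_(q1 in col_stab n l) \sum_(q2 in col_stab n m)
      (-1) ^+ odd_perm q1 * (-1) ^+ odd_perm q2 * S q1 q2); last first.
    by rewrite big1 // => q1 _; rewrite big1 // => q2 _; rewrite S0 mulr0.
  rewrite /S; under [RHS]eq_bigr do under eq_bigr do rewrite mulr_sumr.
  under [RHS]eq_bigr do rewrite exchange_big.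
  rewrite [RHS]exchange_big; apply: eq_bigr => g _ /=.
  have -> : polytabloid l (x1 * g * y1)%g =
    \sum_(q in col_stab n l) (-1) ^+ odd_perm q * (A l x1 y1 q g)%:R by [].
  have -> : polytabloid m (x2 * g * y2)%g =
    \sum_(q in col_stab n m) (-1) ^+ odd_perm q * (A m x2 y2 q g)%:R by [].
  rewrite big_distrlr mulr_suml; apply: eq_bigr => q1 _ /=.
  rewrite mulr_suml; apply: eq_bigr => q2 _.
  by rewrite mulrACA !mulrA.
exists (x3 * x1^-1 * q1)%g, (x3 * x2^-1 * q2)%g => c d ec er1 er2.
apply/eqP; apply: contraT => cd; move: Snz; apply: contraNT => _.
set t := tperm c d; pose h := tperm (x3 c) (x3 d).
have tC : t \in col_stab n k by apply/col_stabP => j; rewrite /t; case: tpermP => [->|->|].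
have A_h p x y q g : reshape_index p ((x3 * x^-1 * q)%g c) = reshape_index p ((x3 * x^-1 * q)%g d) ->
    A p x y q (h * g)%g = A p x y q g.
  rewrite !permM => E.
  have hq j : reshape_index p (q (x^-1%g (h (x j)))) = reshape_index p (q j).
    rewrite /h; case: tpermP => [xj|xj|]; first by rewrite -E -xj permK.
      by rewrite E -xj permK.
    by rewrite permK.
  apply/forallP/forallP => H j; apply/eqP; rewrite -hq.
    by rewrite -(eqP (H _)) !permM permKV tpermK.
  by rewrite -(eqP (H _)) !permM permKV.
suff : S q1 q2 = - S q1 q2.
  by move/eqP; rewrite -subr_eq0 opprK -mulr2n -mulr_natl mulf_eq0 pnatr_eq0.
rewrite {1}/S (reindex_inj (mulgI h)) /= -sumrN; apply: eq_big => g; first by rewrite !inE.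
move=> _; rewrite !A_h //.
have -> : (x3 * (h * g) * y3)%g = (t * (x3 * g * y3))%g.
  by rewrite /h -tpermJ conjgE !mulgA mulgV mul1g.
by rewrite polytabloid_col // odd_tperm cd expr1 mulN1r mulrN.
Qed.

End KroneckerWords.

Section Domination.
Variable F : realFieldType.

(** Abel summation: the sum of [z (w s)] is a constant minus a combination of the numbers of [s]
    with [w s <= t], with the positive coefficients [z (t + 1) - z t]. *)
Lemma sum_dominated (n d : nat) (u v : 'I_n -> nat) (z : nat -> F) :
  (forall t, (t.+1 < d)%N -> z t < z t.+1) ->
  (forall s, (u s < d)%N) -> (forall s, (v s < d)%N) ->
  (forall t, #|[set s | (u s < t)%N]| <= #|[set s | (v s < t)%N]|)%N ->
  \sum_s z (v s) <= \sum_s z (u s) /\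
  (\sum_s z (u s) <= \sum_s z (v s) -> forall t, #|[set s | u s == t]| = #|[set s | v s == t]|).
Proof.
move=> inc ud vd dom.
have abel (w : 'I_n -> nat) : (forall s, w s < d)%N ->
    \sum_s z (w s) = n%:R * z d.-1 - \sum_(t < d.-1) (z t.+1 - z t) *+ #|[set s | (w s < t.+1)%N]|.
  move=> wd.
  have one s : z (w s) = z d.-1 - \sum_(t < d.-1) (if (w s < t.+1)%N then z t.+1 - z t else 0).
    have wl : (w s <= d.-1)%N by have := wd s; case: (d).
    rewrite -(big_mkord xpredT (fun t => if (w s < t.+1)%N then z t.+1 - z t else 0)).
    rewrite (big_cat_nat _ wl) //= big_nat_cond big1 ?add0r => [|i]; last first.
      by rewrite andbT => /andP[_ iw]; rewrite ltnNge iw.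
    rewrite (eq_big_nat _ _ (F2 := fun t => z t.+1 - z t)) => [|i /andP[wi _]]; last by rewrite ltnS wi.
    by rewrite telescope_sumr // opprB addrC subrK.
  rewrite (eq_bigr _ (fun s _ => one s)) sumrB sumr_const card_ord mulr_natl; congr (_ - _).
  rewrite exchange_big; apply: eq_bigr => t _ /=.
  by rewrite -big_mkcond sumr_const; congr (_ *+ _); apply: eq_card => s; rewrite inE.
have pos (t : 'I_d.-1) : 0 < z t.+1 - z t by rewrite subr_gt0 inc //; have := ltn_ord t; lia.
have term (t : 'I_d.-1) : (z t.+1 - z t) *+ #|[set s | (u s < t.+1)%N]| <=
    (z t.+1 - z t) *+ #|[set s | (v s < t.+1)%N]|.
  by apply: ler_wpMn2l; [exact: ltW | exact: dom].
rewrite (abel u ud) (abel v vd); split; first by rewrite lerB // ler_sum.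
rewrite lerD2l lerN2 => le.
have eq_lt t : #|[set s | (u s < t)%N]| = #|[set s | (v s < t)%N]|.
  case: t => [|t]; first by rewrite !eq_card0 // => s; rewrite !inE.
  have [td|dt] := ltnP t d.-1; last first.
    transitivity #|[set: 'I_n]|; last symmetry; apply: eq_card => s; rewrite !inE.
      by have := ud s; lia.
    by have := vd s; lia.
  have : \sum_(i < d.-1) ((z i.+1 - z i) *+ #|[set s | (v s < i.+1)%N]| -
      (z i.+1 - z i) *+ #|[set s | (u s < i.+1)%N]|) == 0.
    by rewrite sumrB subr_eq0 eq_le le ler_sum.
  rewrite psumr_eq0 => [|i _]; last by rewrite subr_ge0.
  move=> /allP/(_ (Ordinal td)); rewrite mem_index_enum => /(_ isT) /=.
  rewrite subr_eq0 eq_sym => /eqP; rewrite -[LHS]mulr_natr -[RHS]mulr_natr => /mulfI E; apply/eqP.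
  by rewrite -(eqr_nat F) E // gt_eqF // (pos (Ordinal td)).
move=> t; have split_lt (w : 'I_n -> nat) : #|[set s | (w s < t.+1)%N]| =
    (#|[set s | (w s < t)%N]| + #|[set s | w s == t]|)%N.
  rewrite -cardsUI [X in (_ + X)%N]eq_card0 ?addn0 => [|s]; last first.
    by rewrite !inE; case: eqP => [->|]; rewrite ?ltnn ?andbF.
  by apply: eq_card => s; rewrite !inE ltnS leq_eqVlt orbC.
by have := eq_lt t.+1; rewrite !split_lt eq_lt => /addnI.
Qed.

End Domination.

Section ColumnInjective.
Variables (n : nat) (k : seq nat).
Hypotheses (sum_k : sumn k = n) (part_k : is_partition k).
Local Notation rw := (reshape_index k).
Local Notation off := (reshape_offset k).

(** Each column has at most as many boxes with [u < t] as it has boxes in the first [t] rows.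
    The injection moves a box [s] with [u s < t] to the row [u s] if its column reaches the
    row [t]; in a shorter column all boxes lie in the first [t] rows and it stays. *)
Lemma column_domination (u : 'I_n -> nat) (t : nat) :
  (forall c d : 'I_n, off c = off d -> u c = u d -> c = d) ->
  (#|[set s | (u s < t)%N]| <= #|[set s : 'I_n | (rw s < t)%N]|)%N.
Proof.
move=> uinj.
pose tall (s : 'I_n) := [exists s0 : 'I_n, (off s0 == off s) && (t <= rw s0)%N].
pose f (s : 'I_n) := if tall s then odflt s [pick r : 'I_n | (rw r == u s) && (off r == off s)] else s.
have fE s : (u s < t)%N -> tall s -> rw (f s) = u s /\ off (f s) = off s.
  move=> ut ts; rewrite /f ts; case: pickP => [r /andP[/eqP ? /eqP ?] //|none].
  have /existsP[s0 /andP[/eqP o0 t0]] := ts.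
  have lt : (off s < nth 0%N k (u s))%N.
    rewrite -o0; apply: leq_trans (offset_lt sum_k s0) _.
    apply: (partition_nonincreasing (d := (rw s0).+1) part_k) => //.
    exact: leq_trans (ltnW ut) t0.
  have [r [r1 r2]] := exists_box sum_k lt.
  by have := none r; rewrite r1 r2 !eqxx.
have offf s : (u s < t)%N -> off (f s) = off s.
  by move=> ut; case: (boolP (tall s)) => ts; [have [] := fE s ut ts | rewrite /f (negPf ts)].
have finj : {in [set s | (u s < t)%N] &, injective f}.
  move=> r s; rewrite !inE => ru su frs.
  have ors : off r = off s by rewrite -(offf r ru) -(offf s su) frs.
  have trs : tall r = tall s by rewrite /tall ors.
  case: (boolP (tall s)) => ts; last by move: frs; rewrite /f trs (negPf ts).
  have [r1 _] := fE r ru (etrans trs ts); have [s1 _] := fE s su ts.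
  by apply: uinj => //; rewrite -r1 -s1 frs.
rewrite -(card_in_imset finj); apply/subset_leq_card/fintype.subsetP => r /imsetP[s].
rewrite !inE => su ->; case: (boolP (tall s)) => ts; first by have [-> _] := fE s su ts.
rewrite /f (negPf ts); move: ts; rewrite negb_exists => /forallP/(_ s).
by rewrite eqxx /= -ltnNge.
Qed.

End ColumnInjective.

Section FormInequality.
Variables (F : realFieldType) (a b : nat) (T : 'I_a -> 'I_b -> 'I_(a * b)).
Variables (x : 'I_a -> F) (y : 'I_b -> F).
Hypothesis hT : standard_tableau T.
Hypothesis xyT : forall (i k : 'I_a) (j l : 'I_b), (T i j < T k l)%N <-> x i + y j < x k + y l.

Lemma sum_letters (p n : nat) (q : seq nat) (w : 'I_n -> 'I_p) (g : 'I_p -> F) :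
  (forall i : 'I_p, #|[set s | w s == i]| = nth 0%N q i) ->
  \sum_s g (w s) = \sum_i g i * (nth 0%N q i)%:R.
Proof.
move=> cnt; rewrite (partition_big w xpredT) //=; apply: eq_bigr => i _.
rewrite -cnt (eq_bigr (fun=> g i)) => [|s /eqP -> //].
by rewrite sumr_const mulr_natr; congr (_ *+ _); apply: eq_card => s; rewrite !inE.
Qed.

(** Mark the boxes of the diagram of [k] by the two words of [kronecker_words] and let [u] be
    the value of [T] at the two letters.  The first two sums are the sum of [z (u s)], the
    last one that of [z] at the rows; the marks are distinct in each column, so
    [column_domination] and [sum_dominated] apply.  In the case of equality [T(i,j)] is a
    value of [u] as often as a row index, which fixes both contents. *)
Lemma kron_form (l m k : seq nat) : Kron a b (a * b) (l, m, k) ->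
  let form := \sum_i x i * (nth 0%N l i)%:R + \sum_j y j * (nth 0%N m j)%:R
     - \sum_i \sum_j (x i + y j) * (nth 0%N k (T i j))%:R in
  0 <= form /\ (form = 0 ->
    (forall i : 'I_a, nth 0%N l i = \sum_j nth 0%N k (T i j))%N /\
    (forall j : 'I_b, nth 0%N m j = \sum_i nth 0%N k (T i j))%N).
Proof.
case=> -[pl pm pk] [sl sm sk kr] form.
have [tau tauK Ttau] := tableau_box hT.
have sum_l := erefl (sumn l); have [sum_m sum_k] : sumn m = sumn l /\ sumn k = sumn l.
  by move: kr; rewrite /kronecker; case: andP => [[/eqP ? /eqP ?]|].
set n := sumn l in sum_l sum_m sum_k.
have [s1 [s2 inj12]] := kronecker_words sum_l sum_m sum_k kr.
pose w1 s := row_ord sum_l sl (s1 s); pose w2 s := row_ord sum_m sm (s2 s).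
pose w3 := row_ord sum_k sk.
have cnt1 (i : 'I_a) : #|[set s | w1 s == i]| = nth 0%N l i.
  rewrite -(card_row sum_l) -(card_imset [set s | w1 s == i] (@perm_inj _ s1)).
  apply: eq_card => r; rewrite inE; apply/imsetP/eqP => [[s]|ri].
    by rewrite inE => /eqP <- ->.
  by exists (s1^-1%g r); rewrite ?inE ?permKV // -val_eqE /= permKV ri.
have cnt2 (i : 'I_b) : #|[set s | w2 s == i]| = nth 0%N m i.
  rewrite -(card_row sum_m) -(card_imset [set s | w2 s == i] (@perm_inj _ s2)).
  apply: eq_card => r; rewrite inE; apply/imsetP/eqP => [[s]|ri].
    by rewrite inE => /eqP <- ->.
  by exists (s2^-1%g r); rewrite ?inE ?permKV // -val_eqE /= permKV ri.
have cnt3 (t : 'I_(a * b)) : #|[set s | w3 s == t]| = nth 0%N k t.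
  by rewrite -(card_row sum_k); apply: eq_card => s; rewrite !inE -val_eqE.
pose u s := T (w1 s) (w2 s).
pose z (t : nat) : F := if insub t is Some s then x (tau s).1 + y (tau s).2 else 0.
have zE (t : 'I_(a * b)) : z t = x (tau t).1 + y (tau t).2 by rewrite /z valK.
have zinc t : (t.+1 < a * b)%N -> z t < z t.+1.
  move=> tb; have tb' := ltnW tb.
  rewrite -[t]/(val (Ordinal tb')) -[t.+1]/(val (Ordinal tb)) !zE.
  by apply/xyT; rewrite !tauK.
have dom t : (#|[set s | (u s < t)%N]| <= #|[set s | (w3 s < t)%N]|)%N.
  apply: (column_domination sum_k pk (u := fun s => u s)) => c d ocd ucd.
  have /(congr1 tau) : u c = u d by apply/val_inj.
  by rewrite !Ttau => -[e1 e2]; apply: inj12.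
have [le eqP0] := sum_dominated zinc (fun s => ltn_ord (u s)) (fun s => ltn_ord (w3 s)) dom.
have sum_u : \sum_s z (u s) = \sum_i x i * (nth 0%N l i)%:R + \sum_j y j * (nth 0%N m j)%:R.
  rewrite -(sum_letters _ cnt1) -(sum_letters _ cnt2) -big_split; apply: eq_bigr => s _ /=.
  by rewrite zE Ttau.
have sum_w : \sum_s z (w3 s) = \sum_i \sum_j (x i + y j) * (nth 0%N k (T i j))%:R.
  rewrite (sum_letters (fun t => z t) cnt3) pair_bigA /=.
  rewrite (reindex (fun ij => T ij.1 ij.2)) /=; last first.
    by exists tau => [[i j] _|t _]; rewrite ?Ttau ?tauK.
  by apply: eq_bigr => -[i j] _; rewrite zE Ttau.
rewrite /form -sum_u -sum_w subr_ge0; split=> // /eqP; rewrite subr_eq0 => /eqP E.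
have cntu (i : 'I_a) (j : 'I_b) : #|[set s | (w1 s == i) && (w2 s == j)]| = nth 0%N k (T i j).
  rewrite -cnt3 -[RHS](eqP0 _ (T i j)); last by rewrite E.
  apply: eq_card => s; rewrite !inE; apply/andP/eqP => [[/eqP <- /eqP <-] //|].
  by move=> /val_inj /(congr1 tau); rewrite !Ttau => -[-> ->].
have fiber (d1 d2 : nat) (v1 : 'I_n -> 'I_d1) (v2 : 'I_n -> 'I_d2) i :
    #|[set s | v1 s == i]| = (\sum_j #|[set s | (v1 s == i) && (v2 s == j)]|)%N.
  rewrite -sum1_card (partition_big v2 xpredT) //=; apply: eq_bigr => j _.
  by rewrite -sum1_card; apply: eq_bigl => s; rewrite !inE.
split=> [i|j]; first by rewrite -cnt1 (fiber _ _ w1 w2); apply: eq_bigr => j _; rewrite cntu.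
rewrite -cnt2 (fiber _ _ w2 w1); apply: eq_bigr => i _; rewrite -cntu.
by apply: eq_card => s; rewrite !inE andbC.
Qed.

End FormInequality.

(** * Regular faces of the Kronecker polyhedron *)

Section KronWeights.
Variables a b c : nat.

Lemma hw3_Kron (be ga al : nat -> nat) (g : mpoly (nvars a b c) algC) : g != 0 ->
  hw3 be ga al g -> nonincreasing a be -> nonincreasing b ga -> nonincreasing c al ->
  exists l m k, Kron a b c (l, m, k) /\
    [/\ forall i : 'I_a, nth 0%N l i = be i, forall j : 'I_b, nth 0%N m j = ga j &
        forall t : 'I_c, nth 0%N k t = al t].
Proof.
move=> g0 [gA gB gC] /exists_partition[l [pl sl lE]] /exists_partition[m [pm sm mE]]
  /exists_partition[k [pk sk kE]].
exists l, m, k; split; last by split=> i; rewrite ?lE ?mE ?kE.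
split=> //; split=> //; apply: (hw_kronecker sl sm sk g0).
- by congr hw: gA; apply/funext => i; rewrite lE.
- by congr hw: gB; apply/funext => i; rewrite mE.
by congr hw: gC; apply/funext => i; rewrite kE.
Qed.

Lemma Kron_hw3 l m k : Kron a b c (l, m, k) ->
  exists2 g : mpoly (nvars a b c) algC, g != 0 & hw3 (nth 0%N l) (nth 0%N m) (nth 0%N k) g.
Proof.
case=> -[pl pm pk] [sl sm sk kr].
have [sum_m sum_k] : sumn m = sumn l /\ sumn k = sumn l.
  by move: kr; rewrite /kronecker; case: andP => [[/eqP ? /eqP ?]|].
exact: (kronecker_hw (erefl _) sum_m sum_k pl pm pk sl sm sk kr).
Qed.

End KronWeights.

Section LinearForms.
Variable R : realType.

Section Triple.
Variables a b c : nat.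
Implicit Type u : 'cV[R]_(a + b + c).

Definition formA u (i : 'I_a) := u (lshift c (lshift b i)) 0.
Definition formB u (j : 'I_b) := u (lshift c (rshift a j)) 0.
Definition formC u (t : 'I_c) := u (rshift (a + b) t) 0.

Lemma triple_form (p : 'rV[R]_a) (q : 'rV[R]_b) (r : 'rV[R]_c) u :
  (triple p q r *m u) 0 0 =
    \sum_i p 0 i * formA u i + \sum_j q 0 j * formB u j + \sum_t r 0 t * formC u t.
Proof.
rewrite mxE !big_split_ord /=; congr (_ + _ + _); apply: eq_bigr => i _;
  by rewrite /triple ?row_mxEl ?row_mxEr.
Qed.

Lemma triple_sum (I : Type) (s : seq I) (P : pred I) (e : I -> R) (p : I -> 'rV[R]_a)
    (q : I -> 'rV[R]_b) (r : I -> 'rV[R]_c) :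
  \sum_(i <- s | P i) e i *: triple (p i) (q i) (r i) =
  triple (\sum_(i <- s | P i) e i *: p i) (\sum_(i <- s | P i) e i *: q i)
         (\sum_(i <- s | P i) e i *: r i).
Proof.
rewrite /triple; elim: s => [|i s IH]; first by rewrite !big_nil !row_mx0.
by rewrite !big_cons; case: (P i) => //; rewrite IH !scale_row_mx !add_row_mx.
Qed.

End Triple.

Lemma cone_form0 (N n : nat) (u : 'cV[R]_N) (s : 'I_n -> 'rV[R]_N) (e : 'I_n -> R) :
  (forall i, 0 <= (s i *m u) 0 0) -> (forall i, 0 <= e i) ->
  0 <= ((\sum_i e i *: s i) *m u) 0 0 /\
  (((\sum_i e i *: s i) *m u) 0 0 = 0 -> forall i, 0 < e i -> (s i *m u) 0 0 = 0).
Proof.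
move=> s0 e0; have E : ((\sum_i e i *: s i) *m u) 0 0 = \sum_i e i * (s i *m u) 0 0.
  by rewrite mulmx_suml summxE; apply: eq_bigr => i _; rewrite -scalemxAl mxE.
rewrite E; split; first by apply: sumr_ge0 => i _; apply: mulr_ge0.
move/eqP; rewrite psumr_eq0 => [|i _]; last exact: mulr_ge0.
move=> /allP H i ei; have := H i; rewrite mem_index_enum => /(_ isT) /=.
by rewrite mulf_eq0 gt_eqF //= => /eqP.
Qed.

Lemma PKron_gen (a b c : nat) l m k : Kron a b c (l, m, k) ->
  PKron R a b c (triple (part_vec R a l) (part_vec R b m) (part_vec R c k)).
Proof.
move=> H; exists 1%N, (fun=> triple (part_vec R a l) (part_vec R b m) (part_vec R c k)), (fun=> 1).
split=> [_|_|]; [by exists l, m, k | exact: ler01 |].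
by rewrite big_ord_recl big_ord0 scale1r addr0.
Qed.

Lemma part_vec_form (d : nat) (x : 'I_d -> R) (l : seq nat) :
  \sum_i part_vec R d l 0 i * x i = \sum_i x i *+ nth 0%N l i.
Proof. by apply: eq_bigr => i _; rewrite mxE mulr_natl. Qed.

(** A point of the face in the open chamber is a nonnegative combination of triples with nonzero
    Kronecker coefficients, and those with a positive coefficient lie in the face.  The product
    of their highest weight polynomials has the sum of the triples as weight; it is in the
    open chamber too, because a wall that contains the sum contains all summands. *)
Lemma regular_face_poly (a b c : nat) (u : 'cV[R]_(a + b + c)) :
  (forall v, PKron R a b c v -> 0 <= (v *m u) 0 0) ->
  regular [set v | PKron R a b c v /\ (v *m u) 0 0 = 0]%classic ->
  exists be ga al (f : mpoly (nvars a b c) algC),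
    [/\ f != 0, hw3 be ga al f,
        [/\ decreasing a be, decreasing b ga & decreasing c al],
        forall t, (t < c)%N -> (0 < al t)%N &
        \sum_i formA u i *+ be i + \sum_j formB u j *+ ga j + \sum_t formC u t *+ al t = 0].
Proof.
move=> u_ge0 [p [q [r [[[n [s [e [sK e0 sumE]]]] form0] [dp dq dr]]]]].
have /choice[l /choice[m /choice[k lmkP]]] := sK.
have KrE i : Kron a b c (l i, m i, k i) by have [] := lmkP i.
have sE i : s i = triple (part_vec R a (l i)) (part_vec R b (m i)) (part_vec R c (k i)).
  by have [] := lmkP i.
have sP i : PKron R a b c (s i) by rewrite sE; apply: PKron_gen.
have s0 i : 0 <= (s i *m u) 0 0 by apply: u_ge0.
have [_ H0] := cone_form0 s0 e0; rewrite sumE in form0; have {}H0 := H0 form0.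
pose be j := (\sum_(i | (0 < e i)%R) nth 0 (l i) j)%N.
pose ga j := (\sum_(i | (0 < e i)%R) nth 0 (m i) j)%N.
pose al j := (\sum_(i | (0 < e i)%R) nth 0 (k i) j)%N.
have [f f0 hf] : exists2 f : mpoly (nvars a b c) algC, f != 0 & hw3 be ga al f.
  have /choice[g gP] : forall i, exists g : mpoly (nvars a b c) algC,
      g != 0 /\ hw3 (nth 0%N (l i)) (nth 0%N (m i)) (nth 0%N (k i)) g.
    by move=> i; have [g g0 hg] := Kron_hw3 (KrE i); exists g.
  exists (\prod_(i | 0 < e i) g i); first by apply/prodf_neq0 => i _; have [] := gP i.
  by split; apply: hw_prod => i _; have [_ [? ? ?]] := gP i.
have vecs : triple p q r = triple (\sum_i e i *: part_vec R a (l i))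
    (\sum_i e i *: part_vec R b (m i)) (\sum_i e i *: part_vec R c (k i)).
  by rewrite sumE -triple_sum; apply: eq_bigr => i _; rewrite sE.
have [/eq_row_mx[pE qE] rE] := eq_row_mx vecs.
have positive (d : nat) (w : 'rV[R]_d) (x : 'I_n -> seq nat) (t : 'I_d) :
    w = \sum_i e i *: part_vec R d (x i) -> 0 < w 0 t ->
    (0 < \sum_(i | (0 < e i)%R) nth 0 (x i) t)%N.
  move=> -> ; rewrite summxE lt0n => pos; apply: contraTN pos => /eqP z; rewrite -leNgt.
  rewrite big1 // => i _; rewrite !mxE; have [ei|ei] := boolP (0 < e i); last first.
    by have := e0 i; rewrite le_eqVlt (negPf ei) orbF => /eqP <-; rewrite mul0r.
  move/eqP: z; rewrite sum_nat_eq0 => /forallP/(_ i); rewrite ei => /eqP ->.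
  by rewrite mulr0.
have strict (d : nat) (w : 'rV[R]_d) (x : 'I_n -> seq nat) :
    (forall i, is_partition (x i)) ->
    w = \sum_i e i *: part_vec R d (x i) -> strictly_dominant w ->
    decreasing d (fun t => \sum_(i | (0 < e i)%R) nth 0 (x i) t)%N.
  move=> px wE [wdec _] i j ij jd; rewrite ltnNge; apply/negP => le.
  have id := ltn_trans ij jd.
  have := wdec (Ordinal id) (Ordinal jd) ij; rewrite ltNge => /negP; apply.
  have same t : 0 < e t -> nth 0%N (x t) i = nth 0%N (x t) j.
    move=> et; apply/eqP; rewrite eqn_leq (partition_nonincreasing (px t) (ltnW ij) (ltnSn j)) andbT.
    rewrite leqNgt; apply/negP => lt; move: le; rewrite leqNgt => /negP; apply.
    rewrite (bigD1 t) //= [X in (_ < X)%N](bigD1 t) //= -addSn leq_add //.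
    by apply: leq_sum => t' _; apply: (partition_nonincreasing (px t') (ltnW ij) (ltnSn j)).
  rewrite wE !summxE le_eqVlt; apply/orP; left; apply/eqP; apply: eq_bigr => t _; rewrite !mxE.
  have [et|et] := boolP (0 < e t); first by rewrite same.
  by have := e0 t; rewrite le_eqVlt (negPf et) orbF => /eqP <-; rewrite !mul0r.
have parts i : [/\ is_partition (l i), is_partition (m i) & is_partition (k i)].
  by have [] := KrE i.
have dec_be : decreasing a be by apply: strict pE dp => i; have [] := parts i.
have dec_ga : decreasing b ga by apply: strict qE dq => i; have [] := parts i.
have dec_al : decreasing c al by apply: strict rE dr => i; have [] := parts i.
exists be, ga, al, f; split=> // [t tc|].
  by apply: (positive c r k (Ordinal tc)) => //; case: dr.
have dist (d : nat) (x : 'I_d -> R) (w : 'I_n -> seq nat) :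
    \sum_i x i *+ (\sum_(t | (0 < e t)%R) nth 0%N (w t) i)%N =
    \sum_(t | 0 < e t) \sum_i x i *+ nth 0%N (w t) i.
  by rewrite exchange_big; apply: eq_bigr => i _ /=; rewrite -sumrMnr.
rewrite /be /ga /al !dist -!big_split big1 // => t et /=.
by rewrite -!part_vec_form -triple_form -sE H0.
Qed.

Lemma decreasing_shift (d D i0 : nat) (w : nat -> nat) : decreasing d w -> (0 < D)%N ->
  nonincreasing d (fun i => D * w i + (i == i0))%N.
Proof.
move=> dec D0 i j ij jd; move: ij; rewrite leq_eqVlt => /orP[/eqP -> //|ij].
have lt := dec i j ij jd.
have : (D * w j + D <= D * w i)%N by rewrite -mulnSr leq_mul2l lt orbT.
by case: (j == i0); case: (i == i0); lia.
Qed.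

(** The face contains points with last parts [D al + e_t] for all [t].  They are independent: a
    relation with coefficients [v t] gives [D al t * sum v + v t = 0], and summing over [t]
    gives [sum v = 0]. *)
Lemma face_dim_ge (a b c : nat) (F : set 'rV[R]_(a + b + c)) :
  is_face (PKron R a b c) F -> regular F -> (c <= face_dim F)%N.
Proof.
case=> u [u_ge0 ->] /(regular_face_poly u_ge0)[be [ga [al [f [f0 hf [dbe dga dal] alpos form0]]]]].
pose D := (a + b + c)%N.
pose lA v := letter (slotA a b c) v; pose lB v := letter (slotB a b c) v.
pose lC v := letter (slotC a b c) v.
have gens v : shifted_var be ga al f v != 0 -> exists w : 'rV[R]_(a + b + c),
    [/\ PKron R a b c w, (w *m u) 0 0 = formA u (lA v) + formB u (lB v) + formC u (lC v) &
     forall t, rsubmx w 0 t = (D * al t + (t == lC v))%:R].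
  move=> nz; have D0 : (0 < D)%N by rewrite /D addn_gt0 (leq_ltn_trans (leq0n _) (ltn_ord (lC v))) orbT.
  have [l [m [k [Kr [lE mE kE]]]]] := hw3_Kron nz (shifted_var_hw hf v)
    (@decreasing_shift _ D _ _ dbe D0) (@decreasing_shift _ D _ _ dga D0)
    (@decreasing_shift _ D _ _ dal D0).
  exists (triple (part_vec R a l) (part_vec R b m) (part_vec R c k)); split.
  - exact: PKron_gen.
  - rewrite triple_form !part_vec_form.
    have shift (d : nat) (x : 'I_d -> R) (w : seq nat) (wt : nat -> nat) (i0 : 'I_d) :
        (forall i : 'I_d, nth 0%N w i = D * wt i + (i == i0 :> nat))%N ->
        \sum_i x i *+ nth 0%N w i = (\sum_i x i *+ wt i) *+ D + x i0.
      move=> wE; rewrite -sumrMnl -[x i0](big_pred1_eq +%R) big_mkcond -big_split.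
      by apply: eq_bigr => i _ /=; rewrite wE mulrnDr mulnC mulrnA -val_eqE; case: eqP.
    rewrite (shift _ _ _ _ _ lE) (shift _ _ _ _ _ mE) (shift _ _ _ _ _ kE).
    have : (\sum_i formA u i *+ be i + \sum_j formB u j *+ ga j + \sum_t formC u t *+ al t) *+ D = 0.
      by rewrite form0 mul0rn.
    have arith (A B C x y z : R) : A + B + C = 0 -> A + x + (B + y) + (C + z) = x + y + z by lra.
    by rewrite !mulrnDl => /arith.
  by move=> t; rewrite /triple row_mxKr mxE kE.
have shiftP := exists_shift f0 hf dbe dga dal form0.
have /choice[w wP] : forall t : 'I_c, exists w : 'rV[R]_(a + b + c),
    [/\ PKron R a b c w, (w *m u) 0 0 = 0 & forall t', rsubmx w 0 t' = (D * al t' + (t' == t))%:R].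
  move=> t; have [v nz|v [vt nz form_v]] := shiftP _ t (alpos t (ltn_ord t)).
    by have [w [wK <- _]] := gens v nz; apply: u_ge0.
  by have [w [wK wf wt]] := gens v nz; exists w; split=> // [|t']; rewrite ?wf ?wt // /lC vt.
have cN : (c < (a + b + c).+1)%N by rewrite ltnS leq_addl.
apply: (leq_trans _ (leq_bigmax_cond (Ordinal cN) _)) => //=.
apply/asboolP; exists (\matrix_t w t); split=> [t|].
  by rewrite rowK; have [? ? _] := wP t.
apply: inj_row_free => v v0.
have coord (t : 'I_c) : (D * al t)%:R * (\sum_i v 0 i) + v 0 t = 0.
  have := congr1 (fun z : 'rV_(a + b + c) => rsubmx z 0 t) v0.
  rewrite !mxE => E; rewrite -[RHS]E mulr_sumr -[v 0 t](big_pred1_eq +%R) big_mkcond -big_split.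
  apply: eq_bigr => i _ /=; have [_ _ wt] := wP i.
  have := wt t; rewrite !mxE => ->; rewrite natrD mulrDr mulrC; congr (_ + _).
  by rewrite eq_sym; case: eqP => _; rewrite ?mulr1 ?mulr0.
have tot0 : \sum_i v 0 i = 0.
  have : (1 + (\sum_(t < c) D * al t)%:R) * (\sum_i v 0 i) = 0.
    rewrite mulrDl mul1r natr_sum mulr_suml addrC -big_split /=.
    by rewrite big1 // => t _; rewrite coord.
  by move/eqP; rewrite mulf_eq0 gt_eqF ?ltr_wpDr ?ler0n // => /eqP.
by apply/rowP => t; have := coord t; rewrite tot0 mulr0 add0r mxE.
Qed.

End LinearForms.

(** * The face of the tableau *)

Section TableauFace.
Variables (R : realType) (a b : nat) (T : 'I_a -> 'I_b -> 'I_(a * b)).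
Hypotheses (ha : (1 <= a)%N) (hb : (1 <= b)%N) (hT : standard_tableau T).
Local Notation c := (a * b)%N.
Implicit Type la : 'rV[R]_c.

Lemma row_countE k (i : 'I_a) : row_count T k i = (\sum_j (T i j < k)%N)%N.
Proof.
rewrite /row_count -sum1_card (partition_big (fun ij => ij.2) xpredT) //=; apply: eq_bigr => j _.
rewrite (eq_bigl (fun ij => (ij == (i, j)) && (T i j < k)%N)) => [|[i' j']]; last first.
  rewrite !inE /= xpair_eqE -[(_ == _ :> nat)]/(i' == i).
  by case: (i' =P i) => [->|_]; case: (j' =P j) => [->|_]; rewrite ?andbT ?andbF.
rewrite big_mkcondr big_pred1_eq; by case: ifP.
Qed.

Lemma col_countE k (j : 'I_b) : col_count T k j = (\sum_i (T i j < k)%N)%N.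
Proof.
rewrite /col_count -sum1_card (partition_big (fun ij => ij.1) xpredT) //=; apply: eq_bigr => i _.
rewrite (eq_bigl (fun ij => (ij == (i, j)) && (T i j < k)%N)) => [|[i' j']]; last first.
  rewrite !inE /= xpair_eqE -[(_ == _ :> nat)]/(j' == j).
  by case: (i' =P i) => [->|_]; case: (j' =P j) => [->|_]; rewrite ?andbT ?andbF.
rewrite big_mkcondr big_pred1_eq; by case: ifP.
Qed.

Lemma row_count_dec k : nonincreasing a (row_count T k).
Proof.
have [_ inc _] := hT; move=> i j ij ja; have ia := leq_ltn_trans ij ja.
rewrite -[i]/(val (Ordinal ia)) -[j]/(val (Ordinal ja)) !row_countE; apply: leq_sum => t _.
move: ij; rewrite leq_eqVlt => /orP[/eqP E|ij].
  have -> : Ordinal ja = Ordinal ia by apply/val_inj.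
  exact: leqnn.
have := inc (Ordinal ia) (Ordinal ja) t ij.
by case: (ltnP (T (Ordinal ja) t) k) => // tk lt; rewrite (ltn_trans lt tk).
Qed.

Lemma col_count_dec k : nonincreasing b (col_count T k).
Proof.
have [_ _ inc] := hT; move=> i j ij jb; have ib := leq_ltn_trans ij jb.
rewrite -[i]/(val (Ordinal ib)) -[j]/(val (Ordinal jb)) !col_countE; apply: leq_sum => t _.
move: ij; rewrite leq_eqVlt => /orP[/eqP E|ij].
  have -> : Ordinal jb = Ordinal ib by apply/val_inj.
  exact: leqnn.
have := inc t (Ordinal ib) (Ordinal jb) ij.
by case: (ltnP (T t (Ordinal jb)) k) => // tk lt; rewrite (ltn_trans lt tk).
Qed.

(** Summation by parts writes [la] as the combination of the vectors [(1, ..., 1, 0, ..., 0)] with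
    the coefficients [la k - la (k + 1)], where [la] is extended by zero; the vector with
    [k + 1] ones is the weight of a minor. *)
Lemma tableau_face_sub v : tableau_face R T v -> PKron R a b c v.
Proof.
case=> la [[la_dec la_ge0] ->].
pose L (n : nat) : R := if insub n is Some t then la 0 t else 0.
have LE (t : 'I_c) : L t = la 0 t by rewrite /L valK.
have Lc : L c = 0 by rewrite /L insubN // ltnn.
have Ldec (t : 'I_c) : 0 <= L t - L t.+1.
  rewrite subr_ge0 LE /L; case: insubP => [s _ st|_]; last exact: la_ge0.
  by apply: la_dec; rewrite st.
have tel (t : 'I_c) : \sum_(k < c) (L k - L k.+1) * (t < k.+1)%N%:R = la 0 t.
  rewrite -(big_mkord xpredT (fun k => (L k - L k.+1) * (t < k.+1)%N%:R)).
  rewrite (big_cat_nat _ (ltnW (ltn_ord t))) //= big_nat_cond big1 ?add0r => [|i]; last first.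
    by rewrite andbT => /andP[_ it]; rewrite ltnS leqNgt it mulr0.
  rewrite (eq_big_nat _ _ (F2 := fun k => (- L k.+1) - (- L k))) => [|k /andP[tk _]]; last first.
    by rewrite ltnS tk mulr1 opprK addrC.
  by rewrite telescope_sumr ?(ltnW (ltn_ord t)) // Lc oppr0 opprK add0r LE.
have /choice[l /choice[m /choice[q lmqP]]] : forall k : 'I_c, exists l m q : seq nat,
    Kron a b c (l, m, q) /\ [/\ forall i : 'I_a, nth 0%N l i = row_count T k.+1 i,
       forall j : 'I_b, nth 0%N m j = col_count T k.+1 j &
       forall t : 'I_c, nth 0%N q t = (t < k.+1)%N].
  move=> k; have [g g0 hg] := tableau_minor algC hT (ltn_ord k).
  have dec3 : nonincreasing c (fun t => (t < k.+1)%N : nat).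
    by move=> i j ij _; case: (ltnP j k.+1) => // jk; rewrite (leq_ltn_trans ij jk).
  exact: hw3_Kron g0 hg (@row_count_dec _) (@col_count_dec _) dec3.
exists c, (fun k => triple (part_vec R a (l k)) (part_vec R b (m k)) (part_vec R c (q k))),
  (fun k : 'I_c => L k - L k.+1).
split=> [k|k|]; [|exact: Ldec|].
  by exists (l k), (m k), (q k); have [] := lmqP k.
rewrite triple_sum; congr triple; apply/rowP => i; rewrite summxE ?mxE.
- under eq_bigr do rewrite -tel; rewrite exchange_big; apply: eq_bigr => k _ /=.
  by rewrite !mxE; have [_ [-> _ _]] := lmqP k; rewrite row_countE natr_sum mulr_sumr.
- under eq_bigr do rewrite -tel; rewrite exchange_big; apply: eq_bigr => k _ /=.
  by rewrite !mxE; have [_ [_ -> _]] := lmqP k; rewrite col_countE natr_sum mulr_sumr.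
rewrite -tel; apply: eq_bigr => k _; rewrite !mxE.
by have [_ [_ _ ->]] := lmqP k.
Qed.

Lemma tableau_face_regular : regular (tableau_face R T).
Proof.
have [_ inc_row inc_col] := hT.
pose la : 'rV[R]_c := \row_t (c - t)%:R.
have la_dec (s t : 'I_c) : (s < t)%N -> la 0 t < la 0 s.
  by move=> st; rewrite !mxE ltr_nat; have := ltn_ord t; lia.
have la_pos (s : 'I_c) : 0 < la 0 s by rewrite mxE ltr0n subn_gt0.
exists (row_sums T la), (col_sums T la), la; split.
  exists la; split=> //; split=> [s t /la_dec/ltW //|s]; exact: ltW.
pose i0 : 'I_a := Ordinal ha; pose j0 : 'I_b := Ordinal hb.
split; split=> //.
- move=> i k ik; rewrite !mxE (bigD1 j0) //= [X in _ < X](bigD1 j0) //=.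
  by rewrite ltr_leD ?la_dec ?inc_row // ler_sum // => j _; rewrite ltW // la_dec ?inc_row.
- by move=> i; rewrite mxE (bigD1 j0) //= ltr_wpDr // sumr_ge0 // => j _; exact: ltW.
- move=> i k ik; rewrite !mxE (bigD1 i0) //= [X in _ < X](bigD1 i0) //=.
  by rewrite ltr_leD ?la_dec ?inc_col // ler_sum // => j _; rewrite ltW // la_dec ?inc_col.
by move=> i; rewrite mxE (bigD1 i0) //= ltr_wpDr // sumr_ge0 // => j _; exact: ltW.
Qed.

Lemma tableau_face_dim : (face_dim (tableau_face R T) <= c)%N.
Proof.
apply/bigmax_leqP => d /asboolP[M [MF Mfree]].
have /choice[la laP] := MF.
pose B : 'M[R]_(c, a + b + c) := row_mx (row_mx (\matrix_(t, i) \sum_j (T i j == t)%:R)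
   (\matrix_(t, j) \sum_i (T i j == t)%:R)) 1%:M.
pose L : 'M[R]_(d, c) := \matrix_(r, t) la r 0 t.
have sel r (s : 'I_c) : \sum_t L r t * (s == t)%:R = la r 0 s.
  rewrite (bigD1 s) //= eqxx mulr1 big1 ?addr0 ?mxE // => t ts.
  by rewrite eq_sym (negPf ts) mulr0.
have ME : M = L *m B.
  apply/row_matrixP => r; have [_ ->] := laP r.
  rewrite row_mul /B !mul_mx_row mulmx1 /triple; congr (row_mx (row_mx _ _) _);
    apply/rowP => i; rewrite !mxE //.
  - rewrite (eq_bigr (fun t => \sum_j L r t * (T i j == t)%:R)) => [|t _]; last first.
      by rewrite !mxE mulr_sumr.
    by rewrite exchange_big; apply: eq_bigr => j _; rewrite sel.
  rewrite (eq_bigr (fun t => \sum_j L r t * (T j i == t)%:R)) => [|t _]; last first.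
    by rewrite !mxE mulr_sumr.
  by rewrite exchange_big; apply: eq_bigr => j _; rewrite sel.
move: Mfree; rewrite /row_free => /eqP <-; rewrite ME.
exact: mulmx_max_rank.
Qed.

(** The form is nonnegative on generators by [kron_form].  If it vanishes on a combination of
    generators, it does on those with a positive coefficient; they have the form
    [(a_T(la), b_T(la), la)], and hence so does the combination. *)
Lemma tableau_face_is_face : additive_tableau R T -> is_face (PKron R a b c) (tableau_face R T).
Proof.
case=> x [y [_ _ xyT]].
have [tau tauK Ttau] := tableau_box hT.
pose u : 'cV[R]_(a + b + c) := col_mx (col_mx (\col_i x i) (\col_j y j))
  (\col_t - (x (tau t).1 + y (tau t).2)).
have reT (g : 'I_c -> R) : \sum_t g t = \sum_i \sum_j g (T i j).
  rewrite pair_bigA (reindex (fun ij => T ij.1 ij.2)) //=.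
  by exists tau => [[i j] _|t _]; rewrite ?Ttau ?tauK.
have formE p q r : (triple p q r *m u) 0 0 = \sum_i x i * p 0 i + \sum_j y j * q 0 j
    - \sum_i \sum_j (x i + y j) * r 0 (T i j).
  rewrite triple_form; congr (_ + _ + _).
  - by apply: eq_bigr => i _; rewrite /formA /u !col_mxEu mxE mulrC.
  - by apply: eq_bigr => i _; rewrite /formB /u col_mxEu col_mxEd mxE mulrC.
  have -> : \sum_i \sum_j (x i + y j) * r 0 (T i j) = \sum_t (x (tau t).1 + y (tau t).2) * r 0 t.
    by rewrite reT; apply: eq_bigr => i _; apply: eq_bigr => j _; rewrite Ttau.
  rewrite -sumrN; apply: eq_bigr => t _.
  by rewrite /formC /u col_mxEd mxE mulrN mulrC.
have gen l m k : Kron a b c (l, m, k) ->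
    let v := triple (part_vec R a l) (part_vec R b m) (part_vec R c k) in
    0 <= (v *m u) 0 0 /\ ((v *m u) 0 0 = 0 ->
      v = triple (row_sums T (part_vec R c k)) (col_sums T (part_vec R c k)) (part_vec R c k)).
  move=> Kr v; have [ge0 eq0] := kron_form hT xyT Kr.
  have E : (v *m u) 0 0 = \sum_i x i * (nth 0%N l i)%:R + \sum_j y j * (nth 0%N m j)%:R
     - \sum_i \sum_j (x i + y j) * (nth 0%N k (T i j))%:R.
    rewrite formE; congr (_ + _ - _); apply: eq_bigr => i _; rewrite ?mxE //.
    by apply: eq_bigr => j _; rewrite mxE.
  rewrite E; split=> // /eq0[lE mE]; rewrite /v; congr triple; apply/rowP => i; rewrite !mxE.
    by rewrite lE natr_sum; apply: eq_bigr => j _; rewrite mxE.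
  by rewrite mE natr_sum; apply: eq_bigr => j _; rewrite mxE.
have gen_ge0 (n : nat) (s : 'I_n -> 'rV[R]_(a + b + c)) : (forall i, exists l m k, Kron a b c (l, m, k) /\
    s i = triple (part_vec R a l) (part_vec R b m) (part_vec R c k)) -> forall i, 0 <= (s i *m u) 0 0.
  by move=> sK i; have [l [m [k [/gen[? _] ->]]]] := sK i.
exists u; split=> [v [n [s [e [sK e0 ->]]]]|].
  by have [] := cone_form0 (gen_ge0 n s sK) e0.
apply/seteqP; split=> v.
  move=> vT; split; first exact: tableau_face_sub.
  have [la [_ ->]] := vT; rewrite formE; apply/eqP; rewrite subr_eq0; apply/eqP.
  under [RHS]eq_bigr do under eq_bigr do rewrite mulrDl.
  under [RHS]eq_bigr do rewrite big_split /=.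
  rewrite big_split /=; congr (_ + _).
    by apply: eq_bigr => i _; rewrite mxE mulr_sumr.
  by rewrite exchange_big; apply: eq_bigr => j _; rewrite mxE mulr_sumr.
case=> -[n [s [e [sK e0 ->]]]] form0.
have [_ /(_ form0) s0] := cone_form0 (gen_ge0 n s sK) e0.
have /choice[la laP] : forall i, exists la : 'rV[R]_c, dominant la /\
    (0 < e i -> s i = triple (row_sums T la) (col_sums T la) la).
  move=> i; have [l [m [k [Kr sE]]]] := sK i; exists (part_vec R c k); split.
    have [[_ _ pk] _] := Kr; split=> [t1 t2 t12|t]; rewrite !mxE ?ler0n //.
    by rewrite ler_nat; apply: (partition_nonincreasing (d := c) pk (ltnW t12)).
  by move=> ei; have [_ H] := gen l m k Kr; have := s0 i ei; rewrite sE => /H.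
exists (\sum_i e i *: la i); split.
  split=> [t1 t2 t12|t]; rewrite !summxE.
    apply: ler_sum => i _; rewrite !mxE; apply: ler_wpM2l => //.
    by have [[dec _] _] := laP i; apply: dec.
  by apply: sumr_ge0 => i _; rewrite mxE mulr_ge0 //; have [[_ ->]] := laP i.
rewrite (eq_bigr (fun i => e i *: triple (row_sums T (la i)) (col_sums T (la i)) (la i))) => [|i _]; last first.
  have [_ H] := laP i; have := e0 i; rewrite le_eqVlt => /orP[/eqP <-|/H -> //].
  by rewrite !scale0r.
have lin (I : finType) (g : I -> 'I_c) : \sum_j (\sum_i e i *: la i) 0 (g j) =
    \sum_i e i * \sum_j la i 0 (g j).
  rewrite (eq_bigr (fun j => \sum_i e i * la i 0 (g j))) => [|j _]; last first.
    by rewrite summxE; apply: eq_bigr => i _; rewrite mxE.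
  by rewrite exchange_big; apply: eq_bigr => i _; rewrite mulr_sumr.
rewrite triple_sum; congr triple; apply/rowP => i; rewrite summxE mxE lin;
  by apply: eq_bigr => j _; rewrite !mxE.
Qed.

End TableauFace.

Theorem proposition9 (R : realType) (a b : nat) (ha : (1 <= a)%N) (hb : (1 <= b)%N)
    (T : 'I_a -> 'I_b -> 'I_(a * b))
    (hT : standard_tableau T) (hadd : additive_tableau R T) :
  is_face (PKron R a b (a * b)) (tableau_face R T) /\
  regular (tableau_face R T) /\
  (forall F : set 'rV[R]_(a + b + a * b),
     is_face (PKron R a b (a * b)) F -> regular F ->
     (face_dim (tableau_face R T) <= face_dim F)%N).
Proof.
split; first exact: tableau_face_is_face.
split; first exact: tableau_face_regular.
move=> F faceF regF; apply: leq_trans (tableau_face_dim R T) _.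
exact: face_dim_ge faceF regF.
Qed.
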